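(* Let $1\le p<\infty$, $0<\theta\le\infty$, $\omega\in{}^c\Omega_\theta$, $v\in\mathcal W(\mathbb{R}^n)$, and $X:={}^cLM_{p\theta,\omega}(\mathbb{R}^n,v)$. For measurable $f$ and measurable $A\subset\mathbb{R}^n$ put $N_A(f):=\big(\int_A|f|^{p'}v^{1-p'}\big)^{1/p'}$ if $p>1$, and $N_A(f):=\operatorname{ess\,sup}_A|f|v^{-1}$ if $p=1$. (i) If $0<\theta\le1$, then $\|f\|_{X'}\approx\sup_{t>0}N_{B(0,t)}(f)\,\|\omega\|_{\theta,(0,t)}^{-1}$. (ii) If $1<\theta\le\infty$, then $$\|f\|_{X'}\approx\Big(\int_{(0,\infty)}N_{B(0,t)}(f)^{\theta'}\,d\Big(\|\omega\|_{\theta,(0,t+)}^{-\theta'}\Big)\Big)^{1/\theta'}+\frac{N_{\mathbb{R}^n}(f)}{\|\omega\|_{\theta,(0,\infty)}},$$ where $\theta'=\theta/(\theta-1)$ ($\theta'=1$ if $\theta=\infty$). In both cases the constants of equivalence are independent of $f$.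
   Context: $B(0,r)$ is the open ball of radius $r$ centered at $0$, ${}^cB(0,r):=\mathbb{R}^n\setminus B(0,r)$; $p'=p/(p-1)$ for $1<p<\infty$. $\|g\|_{\theta,A}:=(\int_A|g|^\theta)^{1/\theta}$ (ess sup if $\theta=\infty$). $\mathcal W(\mathbb{R}^n)$: measurable functions positive and finite a.e. ${}^cLM_{p\theta,\omega}(\mathbb{R}^n,v)$ is the set of $f$ with $\int_{{}^cB(0,t)}|f|^pv<\infty$ for all $t>0$ and $\|f\|_X:=\big\|\omega(r)\big(\int_{{}^cB(0,r)}|f|^pv\big)^{1/p}\big\|_{\theta,(0,\infty)}<\infty$. ${}^c\Omega_\theta$: measurable $\omega\ge0$ on $(0,\infty)$ with $0<\|\omega\|_{\theta,(0,t)}<\infty$ for all $t>0$. The associate space norm is $\|f\|_{X'}:=\sup\{\int_{\mathbb{R}^n}|fg|:\|g\|_X\le1\}$. $\|\omega\|_{\theta,(0,t+)}:=\lim_{s\to t+}\|\omega\|_{\theta,(0,s)}$, and the integral $\int f\,d\varphi$ with respect to the non-increasing function $\varphi(t)=\|\omega\|_{\theta,(0,t+)}^{-\theta'}$ is defined as $-\int f\,d(-\varphi)$ (Lebesgue–Stieltjes integral). Conventions $0/0=0$, $0\cdot(\pm\infty)=0$, $1/(\pm\infty)=0$.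
   Formalization: The integral in (ii) is taken against the positive measure d(-φ), since the literal sign makes it negative and (ii) false (θ=∞, ω(t)=t); f, v, ω are real-valued Borel functions, the general measurable case following by a change on a null set and truncation. *)

(* Defs.v *)
From HB Require Import structures.
From mathcomp Require Import all_boot all_order all_algebra.
From mathcomp Require Import all_classical all_reals all_analysis.
Import Order.TTheory GRing.Theory Num.Theory numFieldNormedType.Exports.

Set Implicit Arguments.
Unset Strict Implicit.
Unset Printing Implicit Defensive.

Local Open Scope classical_set_scope.
Local Open Scope ring_scope.

(** Points of R^n are row vectors; we give this alias a pointed structure
    (origin 0) so that it can carry a generated sigma-algebra. *)
Definition Rvec (R : realType) (n : nat) := 'rV[R]_n.
HB.instance Definition _ (R : realType) n := Choice.on (Rvec R n).
HB.instance Definition _ (R : realType) n := isPointed.Build (Rvec R n) 0.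

Definition box (R : realType) (n : nat) (a b : Rvec R n) : set (Rvec R n) :=
  [set x | forall i, a ord0 i <= x ord0 i < b ord0 i].

Definition boxes (R : realType) (n : nat) : set (set (Rvec R n)) :=
  [set A | exists a b, A = box a b].

(** R^n with its Borel sigma-algebra (generated by the half-open boxes). *)
Definition RnB (R : realType) (n : nat) := g_sigma_algebraType (@boxes R n).

(** Lebesgue measure on R^n (on Borel sets): the measure giving every box
    its volume. Such a measure exists and is unique. *)
Definition is_lebesgue_Rn (R : realType) (n : nat)
    (lam : {measure set (RnB R n) -> \bar R}) : Prop :=
  forall a b : Rvec R n, (forall i, a ord0 i <= b ord0 i) ->
    lam (box a b) = (\prod_i (b ord0 i - a ord0 i))%:E.

Definition enorm (R : realType) (n : nat) (x : Rvec R n) : R :=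
  Num.sqrt (\sum_i x ord0 i ^+ 2).

Definition oball (R : realType) (n : nat) (r : R) : set (RnB R n) :=
  [set x | enorm x < r].

Local Open Scope ereal_scope.

Definition Lnorm_on d (T : measurableType d) (R : realType)
    (mu : {measure set T -> \bar R}) (q : \bar R) (A : set T)
    (g : T -> \bar R) : \bar R :=
  match q with
  | r%:E => (\int[mu]_(x in A) (`|g x| `^ r)) `^ (r^-1)
  | +oo => ereal_inf [set y | {ae mu, forall x, A x -> `|g x| <= y}]
  | -oo => 0
  end.

Notation lebR R := (@lebesgue_measure R).

Definition wnorm (R : realType) (theta : \bar R) (omega : R -> R) (t : R) :=
  Lnorm_on (T := measurableTypeR R) (lebR R) theta `]0%R, t[%classic (fun s => (omega s)%:E).

Definition wnorm_inf (R : realType) (theta : \bar R) (omega : R -> R) :=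
  Lnorm_on (T := measurableTypeR R) (lebR R) theta `]0%R, +oo[%classic (fun s => (omega s)%:E).

Definition cOmega (R : realType) (theta : \bar R) (omega : R -> R) : Prop :=
  measurable_fun (`]0%R, +oo[%classic : set (measurableTypeR R)) omega /\
  (forall t : R, (0 < t)%R -> (0 <= omega t)%R) /\
  (forall t : R, (0 < t)%R -> 0 < wnorm theta omega t < +oo).

Definition weightW (R : realType) (n : nat)
    (lam : {measure set (RnB R n) -> \bar R}) (v : RnB R n -> R) : Prop :=
  measurable_fun setT v /\ {ae lam, forall x, (0 < v x)%R}.

Definition cint (R : realType) (n : nat)
    (lam : {measure set (RnB R n) -> \bar R}) (p : R) (v : RnB R n -> R)
    (f : RnB R n -> R) (r : R) : \bar R :=
  \int[lam]_(x in ~` @oball R n r) ((`|f x| `^ p * v x)%R)%:E.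

Definition Xnorm (R : realType) (n : nat)
    (lam : {measure set (RnB R n) -> \bar R}) (p : R) (theta : \bar R)
    (omega : R -> R) (v : RnB R n -> R) (f : RnB R n -> R) : \bar R :=
  Lnorm_on (T := measurableTypeR R) (lebR R) theta `]0%R, +oo[%classic
    (fun r => (omega r)%:E * (cint lam p v f r) `^ (p^-1)).

Definition inX (R : realType) (n : nat)
    (lam : {measure set (RnB R n) -> \bar R}) (p : R) (theta : \bar R)
    (omega : R -> R) (v : RnB R n -> R) (f : RnB R n -> R) : Prop :=
  measurable_fun setT f /\
  (forall t : R, (0 < t)%R -> cint lam p v f t < +oo) /\
  Xnorm lam p theta omega v f < +oo.

Definition Xassoc (R : realType) (n : nat)
    (lam : {measure set (RnB R n) -> \bar R}) (p : R) (theta : \bar R)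
    (omega : R -> R) (v : RnB R n -> R) (f : RnB R n -> R) : \bar R :=
  ereal_sup [set \int[lam]_x (`|f x * g x|%R)%:E | g in
    [set g | inX lam p theta omega v g /\ Xnorm lam p theta omega v g <= 1]].

Definition conj_exp (R : realType) (p : R) : R := (p / (p - 1))%R.

Definition conj_eexp (R : realType) (theta : \bar R) : R :=
  match theta with r%:E => (r / (r - 1))%R | _ => 1%R end.

Definition Nnorm (R : realType) (n : nat)
    (lam : {measure set (RnB R n) -> \bar R}) (p : R) (v : RnB R n -> R)
    (A : set (RnB R n)) (f : RnB R n -> R) : \bar R :=
  if (1 < p)%R then
    (\int[lam]_(x in A)
        ((`|f x| `^ conj_exp p) * (v x `^ (1 - conj_exp p)))%:E)
      `^ ((conj_exp p)^-1)
  else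
    ereal_inf [set y | {ae lam, forall x, A x -> ((`|f x| / v x)%R)%:E <= y}].

(** ||omega||_{theta,(0,t+)} = lim_{s -> t+} ||omega||_{theta,(0,s)}
    (these norms are finite for omega in ^c Omega_theta). *)
Definition wnorm_plus (R : realType) (theta : \bar R) (omega : R -> R) (t : R) : R :=
  lim (fine (wnorm theta omega s) @[s --> t^'+]).

Definition phi (R : realType) (theta : \bar R) (omega : R -> R) (t : R) : R :=
  (wnorm_plus theta omega t `^ (- conj_eexp theta))%R.

Definition is_LS_of_minus_phi (R : realType) (theta : \bar R) (omega : R -> R)
    (nu : {measure set (measurableTypeR R) -> \bar R}) : Prop :=
  forall a b : R, (0 < a)%R -> (a <= b)%R ->
    nu `]a, b]%classic = (phi theta omega a - phi theta omega b)%:E.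

Definition einv (R : realType) (x : \bar R) : \bar R :=
  match x with r%:E => (r^-1)%:E | _ => 0 end.

(* Main.v *)
(* Write u = v^(1/p), F = f/u and H = g u, so that fg = FH, N_A(f) is the L^{p'}(A) norm of
   F, and the norm of g only involves the L^p norms of H outside balls.

   Everything is discretized along the dyadic levels 2^i of the non-decreasing function
   W(t) = ||omega||_{theta,(0,t)}. On the spherical layer where 2^i < W(|x|) <= 2^{i+1},
   Hoelder bounds the pairing by N times the L^p norm gamma_i of H over {W(|x|) > 2^i}, and the
   norm of g controls the sequence 2^i gamma_i in l^theta. The sequence 2^{-i} N is controlled
   by the supremum in (i), and in (ii) by the Stieltjes integral, since its measure has mass
   of order 2^{-i theta'} on {2^i < W <= 2^{i+2}} unless W never exceeds 2^{i+2}; that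
   exceptional case is what the term N_{R^n} / ||omega|| accounts for. The function W may jump when
   theta is infinite, and then the argument needs that spheres are Lebesgue-null.

   Conversely, L^p duality on a ball gives test functions yielding N_{B(0,t)}/W(t); for (ii)
   one superposes such functions for all levels, with coefficients first regularized so that
   they decay geometrically, which makes the tails of their sum comparable to single terms. *)
Require Import Defs.
From HB Require Import structures.
From mathcomp Require Import all_boot all_order all_algebra.
From mathcomp Require Import all_classical all_reals all_analysis.
From mathcomp Require Import measurable_realfun ring lra.
Import Order.TTheory GRing.Theory Num.Theory numFieldNormedType.Exports.
Local Open Scope classical_set_scope.
Local Open Scope ring_scope.
Local Open Scope ereal_scope.
Set Implicit Arguments.
Unset Strict Implicit.
Unset Printing Implicit Defensive.

(** * Norms over a set *)

Section LnormOn.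
Context d (T : measurableType d) (R : realType).
Variable mu : {measure set T -> \bar R}.
Implicit Types (A D : set T) (g : T -> \bar R) (c : \bar R).

(** Left continuity of W, valid for every theta, makes {W <= l} closed on the right and {W > l} open
    on the left; only right limits of W can jump. Two shapes follow. Norms over a layer are bounded
    through balls of radius a' < a with a in the layer, which misses at most one sphere. And the
    Stieltjes mass is taken on (2^i, 2^{i+2}]: from a with W(a) close to 2^{i+1}, the part of (2^i,
    2^{i+1}] beyond a may carry no mass, while a further factor 2 guarantees a fixed fraction. The
    price is that layers overlap twice.

    All sums are finite: the levels are l 2^i with i < m and an arbitrary base l > 0, and every
    bound is uniform in l and m.

    The regularization ratio is q = 2^{-1/theta'}. The coefficients of the test function are
    c_i^{theta'-1} / 2^i, and c_i >= q c_{i+1} together with q^{theta'} = 1/2 is exactly what makes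
    them decay by the factor q.

    An essential supremum over a null set is -oo in the given encoding, so signs of norms are not
    automatic when p = 1 or theta is infinite; positivity of the measure of balls restores them. *)

Lemma measurable_normpow A g (r : R) :
  measurable_fun A g -> measurable_fun A (fun x => `|g x| `^ r).
Proof.
move=> mg; apply: (measurableT_comp (measurable_poweR r)).
exact: measurableT_comp.
Qed.

Lemma Lnorm_on_ge0 A g (r : R) : 0 <= Lnorm_on mu r%:E A g.
Proof. exact: poweR_ge0. Qed.

Lemma Lnorm_on_poweR A g (r : R) : (0 < r)%R ->
  (Lnorm_on mu r%:E A g) `^ r = \int[mu]_(x in A) (`|g x| `^ r).
Proof.
move=> r0; rewrite /Lnorm_on -poweRrM mulVf ?gt_eqF// poweRe1//.
by apply: integral_ge0 => x _; exact: poweR_ge0.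
Qed.

Lemma le_poweR (r : R) (x y : \bar R) : (0 <= r)%R -> 0 <= x -> x <= y ->
  x `^ r <= y `^ r.
Proof.
move=> r0 x0 xy; apply: gt0_ler_poweR => //; rewrite in_itv/= leey ?andbT//.
exact: le_trans xy.
Qed.

Lemma lee_poweR2 (r : R) (x y : \bar R) : (0 < r)%R -> 0 <= x -> 0 <= y ->
  (x `^ r <= y `^ r) = (x <= y).
Proof.
move=> r0 x0 y0; apply/idP/idP => [|xy]; last exact: le_poweR (ltW r0) x0 xy.
move=> h; have rr : (r * r^-1 = 1)%R by rewrite mulfV// gt_eqF.
rewrite -(poweRe1 x0) -(poweRe1 y0) -rr !poweRrM.
by apply: le_poweR h; rewrite ?poweR_ge0 ?invr_ge0 ?ltW.
Qed.

Lemma Lnorm_on_fin_le A g (r : R) c : (0 < r)%R -> 0 <= c ->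
  (Lnorm_on mu r%:E A g <= c) = (\int[mu]_(x in A) (`|g x| `^ r) <= c `^ r).
Proof.
by move=> r0 c0; rewrite -(@lee_poweR2 r)// ?Lnorm_on_ge0// Lnorm_on_poweR.
Qed.

(** The infimum of the almost-everywhere bounds is itself such a bound: the bounds c + 1/(m+1) fail
    only on countably many null sets. *)
Lemma Lnorm_on_infty_le A g c : 0 <= c ->
  Lnorm_on mu +oo A g <= c <-> {ae mu, forall x, A x -> `|g x| <= c}.
Proof.
move=> c0; split; last by move=> h; exact: ereal_inf_lbound.
case: c c0 => [c|_ _|//]; last by apply: nearW => x _; rewrite leey.
rewrite lee_fin => c0 h.
have : {ae mu, forall x, forall m : nat, A x -> `|g x| <= (c + m.+1%:R^-1)%:E}.
  apply: ae_foralln => m.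
  have : Lnorm_on mu +oo A g < (c + m.+1%:R^-1)%:E.
    by rewrite (le_lt_trans h)// lte_fin ltrDl invr_gt0.
  move=> /ereal_inf_lt[y /= yS ylt].
  by apply: filterS yS => x yx Ax; rewrite (le_trans (yx Ax))// ltW.
apply: filterS => x hx Ax; apply/lee_addgt0Pr => e e0.
rewrite -EFinD.
have [m me] : exists m : nat, (m.+1%:R^-1 < e)%R.
  by have := near_infty_natSinv_lt (PosNum e0); case=> m _ /(_ m) /= h0; exists m; exact: h0.
by rewrite (le_trans (hx m Ax))// lee_fin lerD2l ltW.
Qed.

Lemma Lnorm_on_subset (q : \bar R) A B g : measurable A -> measurable B ->
  measurable_fun B g -> A `<=` B -> 0 <= q ->
  Lnorm_on mu q A g <= Lnorm_on mu q B g.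
Proof.
move=> mA mB mg AB; case: q => [r| |//].
  rewrite lee_fin => r0 /=; apply: le_poweR; rewrite ?invr_ge0//.
    by apply: integral_ge0 => *; exact: poweR_ge0.
  apply: ge0_subset_integral => //; first exact: measurable_normpow.
  by move=> *; exact: poweR_ge0.
move=> _ /=; apply: ereal_inf_le_tmp => y /=; apply: filterS => x h Ax.
by apply: h; exact: AB.
Qed.

(** Monotone convergence along [F], with [N] absorbing what the union misses. The sets [F m] may
    stick out of [A], so that bounds known only on larger sets can be used. *)
Lemma ge0_integral_le_bigcup (A D N : set T) (F : (set T)^nat) g c :
  measurable A -> measurable D -> measurable N -> mu N = 0 ->
  (forall m, measurable (F m)) -> nondecreasing_seq F ->
  (forall m, F m `<=` D) -> A `<=` D ->
  A `<=` \bigcup_m F m `|` N ->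
  measurable_fun D g -> (forall x, 0 <= g x) ->
  (forall m, \int[mu]_(x in F m) g x <= c) -> \int[mu]_(x in A) g x <= c.
Proof.
move=> mA mD mN N0 mF ndF FD AD AFN mg g0 hc.
rewrite (ge0_negligible_integral mN mA)//; last exact: measurable_funS mg.
have mU : measurable (\bigcup_m F m) by exact: bigcup_measurable.
have UD : \bigcup_m F m `<=` D by move=> x [m _ /FD].
apply: (@le_trans _ _ (\int[mu]_(x in \bigcup_m F m) g x)).
  apply: ge0_subset_integral => //; first exact: measurableD.
    exact: measurable_funS mg.
  by move=> x [/AFN[]].
have cv := ge0_nondecreasing_set_cvg_integral (mu := mu) ndF mF
  (fun m => measurable_funS mD (FD m) mg) (fun _ _ _ => g0 _).
rewrite -(cvg_lim _ cv)//; apply: lime_le; first by apply/cvg_ex; eexists; exact: cv.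
exact: nearW.
Qed.

Lemma Lnorm_on_le_bigcup (q : \bar R) (A D N : set T) (F : (set T)^nat) g c :
  0 < q -> 0 <= c ->
  measurable A -> measurable D -> measurable N -> mu N = 0 ->
  (forall m, measurable (F m)) -> nondecreasing_seq F ->
  (forall m, F m `<=` D) -> A `<=` D ->
  A `<=` \bigcup_m F m `|` N -> measurable_fun D g ->
  (forall m, Lnorm_on mu q (F m) g <= c) -> Lnorm_on mu q A g <= c.
Proof.
move=> q0 c0 mA mD mN N0 mF ndF FD AD AFN mg; case: q q0 => [r| |//].
  rewrite lte_fin => r0 h; rewrite Lnorm_on_fin_le//.
  apply: (@ge0_integral_le_bigcup A D N F) => //.
  - exact: measurable_normpow.
  - by move=> x; exact: poweR_ge0.
  - by move=> m; rewrite -Lnorm_on_fin_le.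
move=> _ h; apply/Lnorm_on_infty_le => //.
have : {ae mu, forall x, forall m : nat, F m x -> `|g x| <= c}.
  by apply: ae_foralln => m; apply/Lnorm_on_infty_le.
have : {ae mu, forall x, ~ N x}.
  by exists N; split => // x /= /contrapT.
apply: filterS2 => x nN hx /AFN[[m _ Fm]|//]; exact: hx Fm.
Qed.

(* A radial set [rho in I] is exhausted by the sublevel sets below [sup I], up to
   one level set. *)
Lemma Lnorm_on_le_radial (q : \bar R) D (rho : T -> R) (I : set R) g c :
  0 < q -> 0 <= c -> measurable D -> measurable_fun setT rho ->
  (forall t, mu (D `&` [set x | rho x = t]) = 0) ->
  measurable (D `&` (rho @^-1` I)) ->
  measurable_fun D g ->
  (forall a' a, I a -> (a' < a)%R ->
     Lnorm_on mu q (D `&` [set x | (rho x < a')%R]) g <= c) ->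
  Lnorm_on mu q (D `&` (rho @^-1` I)) g <= c.
Proof.
move=> q0 c0 mD mrho null mA mg h.
have mlt t : measurable (D `&` [set x | (rho x < t)%R]).
  apply: measurableI => //; rewrite -[X in measurable X]setTI.
  have -> : [set x | (rho x < t)%R] = rho @^-1` `]-oo, t[%classic.
    by apply/seteqP; split=> x /=; rewrite in_itv.
  exact: mrho.
have meq t : measurable (D `&` [set x | rho x = t]).
  apply: measurableI => //; rewrite -[X in measurable X]setTI.
  exact: (mrho _ [set t]).
have [I0|/set0P Inz] := eqVneq I set0.
  apply: (@Lnorm_on_le_bigcup q _ D set0 (fun=> set0)) => //.
  - by move=> _; exact: sub0set.
  - by rewrite I0 => x [].
  - move=> _; case: q q0 {h} => [r| |//] r0 /=.
      by rewrite integral_set0 poweR0r// invr_eq0 gt_eqF.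
    by apply/Lnorm_on_infty_le => //; apply: nearW.
have [ubI|nubI] := pselect (has_ubound I); last first.
  apply: (@Lnorm_on_le_bigcup q _ D set0 (fun m => D `&` [set x | (rho x < m%:R)%R])) => //.
  - move=> m n mn; apply/subsetPset => x [Dx /= xm]; split => //=.
    by rewrite (lt_le_trans xm)// ler_nat.
  - move=> x [Dx _]; left; exists (Num.bound `|rho x|%R) => //; split=> //=.
    by rewrite (le_lt_trans (ler_norm _))// archi_boundP.
  - move=> m; have [a Ia ma] : exists2 a, I a & (m%:R < a)%R.
      apply: contrapT => H; apply: nubI; exists m%:R => y Iy.
      by rewrite leNgt; apply/negP => my; apply: H; exists y.
    exact: h Ia ma.
have supI : has_sup I by [].
apply: (@Lnorm_on_le_bigcup q _ D (D `&` [set x | rho x = sup I])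
  (fun m => D `&` [set x | (rho x < sup I - m.+1%:R^-1)%R])) => //.
- move=> m n mn; apply/subsetPset => x [Dx /= xm]; split => //=.
  by rewrite (lt_le_trans xm)// lerD2l lerN2 lef_pV2 ?posrE// ler_nat.
- move=> x [Dx /= Ix]; have := ub_le_sup ubI Ix.
  rewrite le_eqVlt => /predU1P[->|lt]; [by right|left].
  have e0 : (0 < sup I - rho x)%R by rewrite subr_gt0.
  have := near_infty_natSinv_lt (PosNum e0); case=> m _ /(_ m) /= h0.
  exists m => //; split => //=.
  by rewrite ltrBrDr addrC -ltrBrDr; exact: h0.
- move=> m; have m0 : (0 < m.+1%:R^-1 :> R)%R by rewrite invr_gt0.
  have [a Ia ma] := sup_adherent m0 supI.
  exact: h Ia ma.
Qed.

End LnormOn.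

(** * Lebesgue measure on R^n *)

Section LebesgueRn.
Context (R : realType) (n : nat).
Implicit Types (x a b : RnB R n).

Lemma measurable_box a b : measurable (box a b : set (RnB R n)).
Proof. by apply: sub_sigma_algebra; exists a, b. Qed.

(** The half-space where coordinate i is at least c is the union of boxes whose i-th side starts at
    c and whose other sides grow. *)
Lemma measurable_coord (i : 'I_n) :
  measurable_fun setT (fun x : RnB R n => x ord0 i : R).
Proof.
apply: (measurability _ (RGenCInfty.measurableE R)).
move=> _ [_ [c ->] <-]; rewrite setTI.
have -> : (fun x : RnB R n => x ord0 i : R) @^-1` `[c, +oo[%classic =
  \bigcup_m (box (\row_j (if j == i then c else - m%:R)%R) (\row_j m%:R)).
  apply/seteqP; split => [x /=|x [m _ /= /(_ i)]].
    rewrite in_itv/= andbT => cx.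
    pose m := Num.bound (\sum_j `|x ord0 j|)%R.
    have hm j : (`|x ord0 j| < m%:R)%R.
      apply: (@le_lt_trans _ _ (\sum_j `|x ord0 j|)%R); last first.
        by rewrite archi_boundP// sumr_ge0.
      by rewrite (bigD1 j)//= lerDl sumr_ge0.
    exists m => // j /=; rewrite !mxE.
    have := hm j; rewrite ltr_norml => /andP[h1 h2]; rewrite h2 andbT.
    by case: eqP => [->//|_]; exact: ltW.
  by rewrite !mxE eqxx in_itv/= andbT => /andP[].
by apply: bigcup_measurable => m _; exact: measurable_box.
Qed.

Lemma measurable_enorm : measurable_fun setT (@enorm R n : RnB R n -> R).
Proof.
have -> : (@enorm R n : RnB R n -> R) =
    (fun x => (\sum_i x ord0 i ^+ 2) `^ 2^-1)%R.
  by apply/funext => x; rewrite /enorm powR12_sqrt// sumr_ge0// => i _; rewrite sqr_ge0.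
apply: (measurableT_comp (measurable_powR _)).
by apply: measurable_sum => i; apply: measurable_funX; exact: measurable_coord.
Qed.

Lemma enorm_ge0 x : (0 <= enorm x)%R. Proof. exact: sqrtr_ge0. Qed.

Lemma enormZ (s : R) x : (0 <= s)%R -> enorm (s *: x)%R = (s * enorm x)%R.
Proof.
move=> s0; rewrite /enorm -[in RHS](ger0_norm s0) -sqrtr_sqr -sqrtrM ?sqr_ge0//.
by rewrite mulr_sumr; congr Num.sqrt; apply: eq_bigr => i _; rewrite mxE exprMn.
Qed.

Lemma measurable_radial (I : set R) : measurable (I : set (measurableTypeR R)) ->
  measurable ((@enorm R n : RnB R n -> R) @^-1` I).
Proof. by move=> mI; rewrite -[X in measurable X]setTI; exact: measurable_enorm. Qed.

Lemma measurable_oball (r : R) : measurable (@oball R n r).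
Proof.
have -> : @oball R n r = (@enorm R n : RnB R n -> R) @^-1` `]-oo, r[%classic.
  by apply/seteqP; split => x /=; rewrite in_itv.
exact: measurable_radial.
Qed.

Variable lam : {measure set (RnB R n) -> \bar R}.
Hypothesis n0 : (0 < n)%N.
Hypothesis leb : is_lebesgue_Rn lam.

Lemma lebesgue_box_lty a b : lam (box a b) < +oo.
Proof.
have [h|h] := pselect (forall i, (a ord0 i <= b ord0 i)%R).
  by rewrite leb// ltry.
suff -> : box a b = set0 by rewrite measure0.
apply/seteqP; split => // x /= hx; apply: h => i.
by have /andP[/le_trans h1 /ltW /h1] := hx i.
Qed.

Lemma lebesgue_oball_lty r : lam (@oball R n r) < +oo.
Proof.
apply: (@le_lt_trans _ _ (lam (box (const_mx (- r)%R) (const_mx r)))); last first.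
  exact: lebesgue_box_lty.
apply: le_measure; rewrite ?inE; [exact: measurable_oball|exact: measurable_box|].
move=> x /= xr i; rewrite !mxE.
suff : (`|x ord0 i| < r)%R by rewrite ltr_norml => /andP[/ltW -> ->].
apply: le_lt_trans xr; rewrite -sqrtr_sqr ler_sqrt ?sumr_ge0//; last first.
  by move=> j _; rewrite sqr_ge0.
by rewrite (bigD1 i)//= lerDl sumr_ge0// => j _; rewrite sqr_ge0.
Qed.

Let scale (s : R) (x : RnB R n) : RnB R n := (s *: (x : 'rV[R]_n))%R.

Lemma scale_box (s : R) a b : (0 < s)%R ->
  scale s @^-1` (box a b) = box (s^-1 *: a)%R (s^-1 *: b)%R.
Proof.
move=> s0; apply/seteqP; split => x /= h i; have := h i; rewrite !mxE.
  by rewrite ler_pdivrMl// ltr_pdivlMl.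
by rewrite ler_pdivrMl// ltr_pdivlMl.
Qed.

Lemma measurable_scale (s : R) : (0 < s)%R -> measurable_fun setT (scale s).
Proof.
move=> s0; apply: (@measurability _ _ (RnB R n) (RnB R n) setT (scale s) (@boxes R n)) => //.
move=> _ [_ [a [b ->]] <-]; rewrite setTI scale_box//; exact: measurable_box.
Qed.

(** The pushforward of [lam] under scaling and its multiple by s^{-n} agree on boxes, a family
    stable under intersection that exhausts the space by sets of finite measure; hence they are
    equal. *)
Lemma lebesgue_scale (s : R) A : (0 < s)%R -> measurable A ->
  lam (scale s @^-1` A) = (s ^- n)%:E * lam A.
Proof.
move=> s0 mA.
have sn0 : (0 <= s ^- n)%R by rewrite invr_ge0 exprn_ge0// ltW.
pose m2 := mscale (NngNum sn0) lam.
pose m1 : {measure set (RnB R n) -> \bar R} :=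
  measure_function_pushforward__canonical__measure_function_Measure lam
    (measurable_scale s0).
have : m1 A = m2 A; last by [].
apply: (@measure_unique _ _ (RnB R n) (@boxes R n)
  (fun k => box (const_mx (- k%:R)%R) (const_mx k%:R))) => //.
- move=> _ _ [a [b ->]] [a' [b' ->]].
  exists (\row_i Num.max (a ord0 i) (a' ord0 i))%R,
         (\row_i Num.min (b ord0 i) (b' ord0 i))%R.
  apply/seteqP; split => x /=.
    move=> [h1 h2] i; rewrite !mxE ge_max lt_min.
    have /andP[e1 e2] := h1 i; have /andP[e3 e4] := h2 i.
    by apply/andP; split; apply/andP.
  by move=> h; split=> i; have := h i; rewrite !mxE ge_max lt_min => /andP[/andP[e1 e2] /andP[e3 e4]]; apply/andP.
- by move=> k; eexists _, _.
- apply/seteqP; split => // x _.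
  pose m := Num.bound (\sum_j `|x ord0 j|)%R.
  exists m => // j /=; rewrite !mxE.
  have : (`|x ord0 j| < m%:R)%R.
    apply: (@le_lt_trans _ _ (\sum_j `|x ord0 j|)%R); last first.
      by rewrite archi_boundP// sumr_ge0.
    by rewrite (bigD1 j)//= lerDl sumr_ge0.
  by rewrite ltr_norml => /andP[/ltW -> ->].
- move=> _ [a [b ->]]; 
  suff : lam (box (s^-1 *: a)%R (s^-1 *: b)%R) = (s ^- n)%:E * lam (box a b).
    by rewrite -scale_box.
  have [h|h] := pselect (forall i, (a ord0 i <= b ord0 i)%R).
    rewrite !leb//; last by move=> i; rewrite !mxE ler_pM2l ?invr_gt0.
    rewrite -EFinM; congr EFin.
    under eq_bigr do rewrite !mxE -mulrBr.
    by rewrite big_split/= prodr_const card_ord exprVn.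
  suff E (c d : RnB R n) : (exists i, (d ord0 i < c ord0 i)%R) -> lam (box c d) = 0.
    have [i abi] : exists i, (b ord0 i < a ord0 i)%R.
      by apply: contrapT => H; apply: h => i; rewrite leNgt; apply/negP => ?; apply: H; exists i.
    rewrite E; last by exists i; rewrite !mxE ltr_pM2l ?invr_gt0.
    by rewrite E ?mule0//; exists i.
  move=> [i di]; suff -> : box c d = set0 by rewrite measure0.
  apply/seteqP; split => // x /= /(_ i) /andP[h1 h2].
  by have := lt_trans (le_lt_trans h1 h2) di; rewrite ltxx.
- move=> k; suff : lam (scale s @^-1` (box (const_mx (- k%:R)%R) (const_mx k%:R))) < +oo by [].
  by rewrite scale_box//; exact: lebesgue_box_lty.
Qed.

Lemma lebesgue_oballE (s : R) : (0 < s)%R ->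
  lam (@oball R n s) = (s ^+ n)%:E * lam (@oball R n 1).
Proof.
move=> s0; have := lebesgue_scale s0 (measurable_oball s).
have -> : scale s @^-1` (@oball R n s) = @oball R n 1.
  apply/seteqP; split => x; rewrite /preimage /oball /mkset.
    by rewrite [enorm (scale s x)]enormZ ?ltW// gtr_pMr.
  by rewrite [enorm (scale s x)]enormZ ?ltW// gtr_pMr.
move=> ->; rewrite muleA -EFinM divff ?mul1e// expf_eq0 ?gt_eqF//.
by rewrite andbF.
Qed.

(** By scaling, one null ball would make all balls null, among them that of radius n+1, which
    contains the unit box of volume 1. *)
Lemma lebesgue_oball_gt0 (s : R) : (0 < s)%R -> 0 < lam (@oball R n s).
Proof.
move=> s0; rewrite lt_neqAle measure_ge0 andbT eq_sym; apply/eqP => B0.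
have b1 : lam (@oball R n 1) = 0.
  move: B0; rewrite lebesgue_oballE// => /eqP; rewrite mule_eq0 eqe expf_eq0.
  by rewrite (gt_eqF s0) andbF/= => /eqP.
have : lam (box (const_mx 0%R : RnB R n) (const_mx 1%R)) = 1.
  rewrite leb; last by move=> i; rewrite !mxE.
  by rewrite big1// => i _; rewrite !mxE subr0.
suff -> : lam (box (const_mx 0%R : RnB R n) (const_mx 1%R)) = 0.
  by move=> /eqP; rewrite eqe eq_sym oner_eq0.
have n1 : (0 < n.+1%:R :> R)%R by [].
apply: (@subset_measure0 _ _ _ lam _ (@oball R n n.+1%:R)).
- exact: measurable_box.
- exact: measurable_oball.
- move=> x /= hx; apply: (@le_lt_trans _ _ n%:R); last by rewrite ltr_nat.
  rewrite -[leRHS]ger0_norm// -sqrtr_sqr /enorm ler_sqrt ?sqr_ge0//.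
  apply: (@le_trans _ _ n%:R).
    rewrite -[X in (_ <= X%:R)%R](card_ord n) -sumr_const; apply: ler_sum => i _.
    have /andP[] := hx i; rewrite !mxE => h1 /ltW h2.
    by rewrite expr_le1.
  by rewrite -natrX ler_nat -{1}(expn1 n) leq_pexp2l.
- by have := lebesgue_oballE n1; rewrite b1 mule0.
Qed.

(** The volume of a ball is c r^n, continuous in r, and the sphere of radius r lies in B(0,s) minus
    B(0,r) for every s > r. *)
Lemma lebesgue_sphere (r : R) : lam [set x | enorm x = r] = 0.
Proof.
have mS : measurable ([set x | enorm x = r] : set (RnB R n)).
  exact: (measurable_radial (I := [set r])).
have [r0|r0] := ltP r 0%R.
  rewrite (_ : [set _ | _] = set0) ?measure0//; apply/seteqP; split => // x /= xr.
  by have := enorm_ge0 x; rewrite xr leNgt r0.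
have : lam (@oball R n 1) \is a fin_num.
  by rewrite ge0_fin_numE// lebesgue_oball_lty.
move/fineK => cE; set c := fine _ in cE.
have c0 : (0 <= c)%R by rewrite fine_ge0.
have lr : lam (@oball R n r) = (r ^+ n * c)%:E.
  have [rp|] := ltP 0%R r; first by rewrite lebesgue_oballE// -cE EFinM.
  move=> rn; have /eqP rE : r == 0%R by rewrite eq_le rn.
  rewrite rE expr0n gtn_eqF//= mul0r.
  rewrite (_ : oball _ = set0) ?measure0//; apply/seteqP; split => // x /=.
  by rewrite /oball/= ltNge enorm_ge0.
have H s : (r < s)%R -> lam [set x | enorm x = r] <= (s ^+ n * c - r ^+ n * c)%:E.
  move=> rs; have s0 : (0 < s)%R by exact: le_lt_trans rs.
  rewrite EFinB leeBrDr// -lr -measureU//; last 2 first.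
  - exact: measurable_oball.
  - by apply/seteqP; split => // x [/= xr]; rewrite /oball/= xr ltxx.
  rewrite EFinM cE -lebesgue_oballE//; apply: le_measure; rewrite ?inE//.
  - by apply: measurableU => //; exact: measurable_oball.
  - exact: measurable_oball.
  - move=> x [/= xr|xr]; first by rewrite /oball/= xr.
    exact: lt_trans xr rs.
apply/eqP; rewrite eq_le measure_ge0 andbT; apply/lee_addgt0Pr => e e0.
rewrite add0e.
have cont : (fun s : R => (s ^+ n * c - r ^+ n * c)%R) @ r --> (r ^+ n * c - r ^+ n * c)%R.
  apply: cvgB; last exact: cvg_cst.
  by apply: cvgM; [exact: exprn_continuous|exact: cvg_cst].
rewrite subrr in cont.
have /(_ _ _ e0) := cvgr0_norm_lt _ cont.
rewrite -nbhs_nearE => /nbhs_ballP[d /= d0 hd].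
have := H (r + d / 2)%R; rewrite ltrDl divr_gt0// => /(_ isT) /le_trans; apply.
rewrite lee_fin (le_trans (ler_norm _))// ltW//; apply: hd.
rewrite /ball/= opprD addrA subrr add0r normrN gtr0_norm ?divr_gt0//.
by rewrite ltr_pdivrMr// ltr_pMr// ltr1n.
Qed.

End LebesgueRn.

(** * Inequalities and duality for L^p norms *)

Section LnormReal.
Context d (T : measurableType d) (R : realType).
Variable mu : {measure set T -> \bar R}.
Implicit Types (A D : set T) (F H : T -> R).

Lemma powR_le (r a b : R) : (0 <= r)%R -> (0 <= a)%R -> (a <= b)%R ->
  (a `^ r <= b `^ r)%R.
Proof.
by move=> r0 a0 ab; apply: ge0_ler_powR; rewrite ?nnegrE//; exact: le_trans ab.
Qed.

Definition conj_ext (p : R) : \bar R := if (1 < p)%R then (conj_exp p)%:E else +oo.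

Lemma conj_exp_gt1 (p : R) : (1 < p)%R -> (1 < conj_exp p)%R.
Proof. by move=> p1; rewrite /conj_exp ltr_pdivlMr ?subr_gt0// mul1r gtrBl. Qed.

Lemma conj_exp_inv (p : R) : (1 < p)%R -> (p^-1 + (conj_exp p)^-1 = 1)%R.
Proof.
move=> p1; have p0 : p != 0%R by rewrite gt_eqF// (lt_trans _ p1).
by rewrite /conj_exp invf_div mulrBl mul1r divff// addrC subrK.
Qed.

Lemma conj_ext_gt0 (p : R) : (1 <= p)%R -> 0 < conj_ext p.
Proof.
move=> p1; rewrite /conj_ext; case: ifPn => // p1'.
by rewrite lte_fin (lt_trans _ (conj_exp_gt1 p1')).
Qed.

Lemma Lnorm_indicE A F (r : R) : (0 < r)%R ->
  'N[mu]_r%:E [EFin \o (fun x => F x * \1_A x)%R] = Lnorm_on mu r%:E A (EFin \o F).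
Proof.
move=> r0; rewrite unlock /Lnorm_on; congr (_ `^ _).
rewrite [RHS]integral_mkcond; apply: eq_integral => x _ /=.
rewrite /patch indicE; case: ifPn => xA; first by rewrite mulr1.
by rewrite mulr0 normr0 powR0// gt_eqF.
Qed.

Lemma measurable_mul_indic A F : measurable A -> measurable_fun setT F ->
  measurable_fun setT (fun x => F x * \1_A x)%R.
Proof. by move=> mA mF; apply: measurable_funM => //; exact: measurable_indic. Qed.

(** The norm of [F] enters through a real bound c >= 0, because for p = 1 it is -oo when [A] is
    null. For p > 1 this is Hoelder with both functions cut off to [A]; for p = 1 it is a pointwise
    bound. *)
Lemma hoelder_on (p c : R) A F H : (1 <= p)%R -> (0 <= c)%R ->
  measurable A -> measurable_fun setT F -> measurable_fun setT H ->
  Lnorm_on mu (conj_ext p) A (EFin \o F) <= c%:E ->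
  \int[mu]_(x in A) (`|F x * H x|%R)%:E <= c%:E * Lnorm_on mu p%:E A (EFin \o H).
Proof.
move=> p1 c0 mA mF mH; rewrite /conj_ext; case: ifPn => [p1' hF|].
  have p0 : (0 < p)%R by rewrite (lt_trans _ p1').
  have q0 : (0 < conj_exp p)%R by rewrite (lt_trans _ (conj_exp_gt1 p1')).
  have := @hoelder _ _ _ mu _ _ (conj_exp p) p
    (measurable_mul_indic mA mF) (measurable_mul_indic mA mH) q0 p0.
  rewrite addrC conj_exp_inv// !Lnorm_indicE// => /(_ erefl) h.
  apply: (@le_trans _ _ (Lnorm_on mu (conj_exp p)%:E A (EFin \o F)
    * Lnorm_on mu p%:E A (EFin \o H))); last first.
    by apply: lee_wpmul2r => //; exact: Lnorm_on_ge0.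
  apply: le_trans h; rewrite Lnorm1 integral_mkcond le_eqVlt; apply/orP; left; apply/eqP.
  apply: eq_integral => x _ /=; rewrite /patch indicE; case: ifPn => xA.
    by rewrite !mulr1.
  by rewrite !mulr0 normr0.
rewrite -leNgt => p1'; have -> : p = 1%R by apply/eqP; rewrite eq_le p1 p1'.
move=> /Lnorm_on_infty_le; rewrite lee_fin => /(_ c0) hF.
rewrite /Lnorm_on invr1 poweRe1; last by apply: integral_ge0 => *; exact: poweR_ge0.
under [in leRHS]eq_integral do rewrite poweRe1 ?abse_ge0//.
rewrite -ge0_integralZl_EFin//; last first.
  by apply: measurableT_comp => //; apply/measurable_EFinP; exact: measurable_funTS.
apply: ae_ge0_le_integral => //.
- by apply/measurable_EFinP; apply: measurableT_comp => //;
    apply: measurable_funM; exact: measurable_funTS.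
- by move=> x _; rewrite mule_ge0.
- apply: measurable_funeM; apply: measurableT_comp => //; apply/measurable_EFinP.
  exact: measurable_funTS.
- apply: filterS hF => x h Ax; have := h Ax.
  by rewrite /= !lee_fin normrM => h'; apply: ler_wpM2r.
Qed.

Lemma Lnorm_on_minkowski (p : R) A F H : (1 <= p)%R ->
  measurable A -> measurable_fun setT F -> measurable_fun setT H ->
  Lnorm_on mu p%:E A (EFin \o (F \+ H)%R) <=
  Lnorm_on mu p%:E A (EFin \o F) + Lnorm_on mu p%:E A (EFin \o H).
Proof.
move=> p1 mA mF mH; have p0 : (0 < p)%R by rewrite (lt_le_trans _ p1).
have := minkowski_EFin mu (measurable_mul_indic mA mF) (measurable_mul_indic mA mH) p1.
rewrite !Lnorm_indicE//; apply: le_trans; rewrite -Lnorm_indicE//.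
by under [in leRHS]eq_Lnorm do rewrite /= -mulrDl.
Qed.

Lemma Lnorm_onZ_le (p b k : R) A F : (1 <= p)%R -> (0 <= b)%R -> (0 <= k)%R ->
  measurable A -> measurable_fun setT F ->
  Lnorm_on mu p%:E A (EFin \o F) <= k%:E ->
  Lnorm_on mu p%:E A (EFin \o (fun x => b * F x)%R) <= (b * k)%:E.
Proof.
move=> p1 b0 k0 mA mF; have p0 : (0 < p)%R by rewrite (lt_le_trans _ p1).
rewrite !Lnorm_on_fin_le// ?lee_fin ?mulr_ge0// => h.
under eq_integral => x _.
  rewrite /= normrM (ger0_norm b0) powRM// EFinM. over.
rewrite ge0_integralZl_EFin ?powR_ge0//.
- by rewrite EFinM poweRM ?lee_fin//; apply: lee_wpmul2l => //; rewrite lee_fin powR_ge0.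
- have := @measurable_normpow _ T R A (EFin \o F) p; apply.
  by apply/measurable_EFinP; exact: measurable_funTS.
Qed.

Lemma Lnorm_on_sum_le (p : R) A (m : nat) (b k : nat -> R) (h : nat -> T -> R) :
  (1 <= p)%R -> (forall i, 0 <= b i)%R -> (forall i, 0 <= k i)%R ->
  measurable A -> (forall i, measurable_fun setT (h i)) ->
  (forall i, (i < m)%N -> Lnorm_on mu p%:E A (EFin \o h i) <= (k i)%:E) ->
  Lnorm_on mu p%:E A (EFin \o (fun x => \sum_(i < m) b i * h i x)%R) <=
    (\sum_(i < m) b i * k i)%:E.
Proof.
move=> p1 b0 k0 mA mh hk; have p0 : (0 < p)%R by rewrite (lt_le_trans _ p1).
elim: m hk => [|m IH] hk.
  rewrite big_ord0 Lnorm_on_fin_le// poweR0r ?gt_eqF//.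
  rewrite integral0_eq// => x _ /=.
  by rewrite big_ord0 normr0 powR0// gt_eqF.
rewrite [X in _ <= X%:E]big_ord_recr EFinD.
have -> : (fun x => \sum_(i < m.+1) b i * h i x)%R =
    ((fun x => \sum_(i < m) b i * h i x)%R \+ (fun x => b m * h m x)%R)%R.
  by apply/funext => x; rewrite big_ord_recr.
apply: le_trans (Lnorm_on_minkowski _ _ _ _) _ => //.
- by apply: measurable_sum => i; apply: measurable_funM => //.
- by apply: measurable_funM.
apply: leeD; first by apply: IH => i im; apply: hk; rewrite ltnW.
by apply: Lnorm_onZ_le => //; apply: hk.
Qed.

Lemma measurable_normgt A F (c : R) : measurable A -> measurable_fun setT F ->
  measurable (A `&` [set x | (c < `|F x|)%R]).
Proof.
move=> mA mF; apply: measurableI => //; rewrite -[X in measurable X]setTI.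
have -> : [set x | (c < `|F x|)%R] = (fun x => `|F x|)%R @^-1` `]c, +oo[%classic.
  by apply/seteqP; split=> x /=; rewrite in_itv/= andbT.
by apply: (measurableT_comp _ mF).
Qed.

(** Converse of Hoelder: any value below the dual norm is reached by a nonnegative function of norm
    at most 1 supported in [A]. *)
Lemma Lnorm_on_dual (p c : R) A F : (1 <= p)%R -> (0 <= c)%R -> measurable A ->
  mu A < +oo -> measurable_fun setT F ->
  c%:E < Lnorm_on mu (conj_ext p) A (EFin \o F) ->
  exists h : T -> R, [/\ measurable_fun setT h, forall x, (0 <= h x)%R,
    forall x, ~ A x -> h x = 0%R,
    Lnorm_on mu p%:E setT (EFin \o h) <= 1 &
    c%:E <= \int[mu]_x (`|F x * h x|%R)%:E].
Proof.
move=> p1 c0 mA finA mF; rewrite /conj_ext.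
have p0 : (0 < p)%R by rewrite (lt_le_trans _ p1).
case: ifPn => [p1' hF|].
  have q1 := conj_exp_gt1 p1'; set q := conj_exp p in q1 hF *.
  have q0 : (0 < q)%R by rewrite (lt_trans _ q1).
  (* Truncation to |F| <= m: since [A] has finite measure, the norm over [E m] is finite, and it
     exceeds c for large m. *)
  pose E (m : nat) := A `\` (A `&` [set x | (m%:R < `|F x|)%R]).
  have mE m : measurable (E m).
    by apply: measurableD => //; exact: measurable_normgt.
  have EA m : E m `<=` A by move=> x [].
  have EF m x : E m x -> (`|F x| <= m%:R)%R.
    by move=> [Ax nx]; rewrite leNgt; apply/negP => h; apply: nx.
  have mFA B : measurable B -> measurable_fun B (EFin \o F).
    by move=> mB; apply/measurable_EFinP; exact: measurable_funTS.
  have [m hm] : exists m, c%:E < Lnorm_on mu q%:E (E m) (EFin \o F).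
    apply: contrapT => hn; move: hF; rewrite ltNge => /negP; apply.
    apply: (@Lnorm_on_le_bigcup _ _ _ mu q%:E A A set0 E) => //.
    - move=> i j ij; apply/subsetPset => x Ex; split; first exact: EA Ex.
      move=> [_ /=]; rewrite ltNge (le_trans (EF _ _ Ex))//.
      by rewrite ler_nat.
    - move=> x Ax; left; exists (Num.bound `|F x|%R) => //; split => // -[_ /=].
      by rewrite ltNge ltW// archi_boundP.
    - exact: mFA.
    - by move=> m; rewrite leNgt; apply/negP => h; apply: hn; exists m.
  pose Je := \int[mu]_(x in E m) (`|(F x)%:E| `^ q).
  have Jlty : Je < +oo.
    apply: (@le_lt_trans _ _ (\int[mu]_(x in E m) (m%:R `^ q)%:E)).
      apply: ge0_le_integral => //.
      - by move=> x _; rewrite poweR_ge0.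
      - by apply: measurable_normpow; exact: mFA.
      - move=> x Ex; rewrite /= lee_fin; apply: powR_le (ltW q0) (normr_ge0 _) _.
        exact: EF.
    rewrite (_ : \int[mu]_(x in E m) _ = (m%:R `^ q)%:E * mu (E m)); last exact: integral_cst.
    apply: lte_mul_pinfty; rewrite ?lee_fin ?powR_ge0//.
    apply: le_lt_trans finA; apply: le_measure; rewrite ?inE//.
  have J0 : 0 <= Je by apply: integral_ge0 => x _; exact: poweR_ge0.
  have : Je \is a fin_num by rewrite ge0_fin_numE.
  move/fineK; set J := fine Je => JE.
  have NJ : Lnorm_on mu q%:E (E m) (EFin \o F) = (J `^ q^-1)%:E.
    by rewrite /Lnorm_on -/Je -JE poweR_EFin.
  have J00 : (0 < J)%R.
    rewrite lt_neqAle eq_sym -lee_fin JE J0 andbT; apply/eqP => J00.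
    by move: hm; rewrite NJ J00 powR0 ?invr_eq0 ?gt_eqF// lte_fin ltNge c0.
  have qp : ((q - 1) * p = q)%R.
    rewrite /q /conj_exp; field.
    by rewrite subr_eq0 gt_eqF.
  have mh : measurable_fun setT (fun x => (`|F x| `^ (q - 1)) * \1_(E m) x : R)%R.
    apply: measurable_mul_indic => //.
    by apply: (measurableT_comp (measurable_powR _)); exact: measurableT_comp.
  (* The equality case of Hoelder on [E m], normalized in L^p through (q-1)p = q. *)
  exists (fun x => J `^ (- p^-1) * (`|F x| `^ (q - 1) * \1_(E m) x))%R; split.
  - exact: measurable_funM.
  - by move=> x; rewrite !mulr_ge0 ?powR_ge0.
  - by move=> x nA; rewrite indicE memNset ?mulr0 ?mulr0// => /EA.
  - rewrite -[X in _ <= X]/(1%:E) Lnorm_on_fin_le ?lee_fin// poweR1r.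
    have -> : \int[mu]_x (`|(EFin \o (fun x => J `^ (- p^-1) * (`|F x| `^ (q - 1)
        * \1_(E m) x))%R) x| `^ p) =
      \int[mu]_(x in E m) ((J^-1)%:E * (`|(F x)%:E| `^ q)).
      rewrite [RHS]integral_mkcond; apply: eq_integral => x _ /=.
      rewrite /patch indicE; case: ifPn => xE; last first.
        by rewrite !mulr0 normr0 powR0// gt_eqF.
      rewrite mulr1 ger0_norm ?mulr_ge0 ?powR_ge0// powRM ?powR_ge0//.
      by rewrite -!powRrM qp mulNr mulVf ?gt_eqF// powR_inv1 ?ltW// EFinM.
    rewrite ge0_integralZl_EFin//; last 3 first.
    - by move=> x _; exact: poweR_ge0.
    - by apply: measurable_normpow; exact: mFA.
    - by rewrite invr_ge0 ltW.
    by rewrite -/Je -JE -EFinM mulVf ?gt_eqF.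
  - have -> : \int[mu]_x (`|F x * (J `^ (- p^-1) * (`|F x| `^ (q - 1)
        * \1_(E m) x))|%R)%:E =
      \int[mu]_(x in E m) ((J `^ (- p^-1))%:E * (`|(F x)%:E| `^ q)).
      rewrite [RHS]integral_mkcond; apply: eq_integral => x _ /=.
      rewrite /patch indicE; case: ifPn => xE; last first.
        by rewrite !mulr0 normr0.
      rewrite mulr1 normrM [X in (_ * X)%R]ger0_norm ?mulr_ge0 ?powR_ge0//.
      by rewrite mulrCA mulr_powRB1// EFinM.
    rewrite ge0_integralZl_EFin//; last 3 first.
    - by move=> x _; exact: poweR_ge0.
    - by apply: measurable_normpow; exact: mFA.
    - by rewrite powR_ge0.
    rewrite -/Je -JE -EFinM -[X in (_ * X)%R]powRr1 ?ltW// -powRD; last first.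
      by apply/implyP => _; rewrite gt_eqF.
    by rewrite -(conj_exp_inv p1') addrA addNr add0r -/q -NJ.
rewrite -leNgt => p1'; have -> : p = 1%R by apply/eqP; rewrite eq_le p1 p1'.
(* For p = 1 the test function is the normalized indicator of {|F| > c}, which has positive measure
   as c is below the essential supremum. *)
move=> hF; pose E := A `&` [set x | (c < `|F x|)%R].
have mE : measurable E by exact: measurable_normgt.
have muE0 : 0 < mu E.
  rewrite lt_neqAle measure_ge0 andbT eq_sym; apply/eqP => E0.
  move: hF; rewrite ltNge => /negP; apply; apply/Lnorm_on_infty_le => //.
  exists E; split => // x /= /not_implyP[Ax]; rewrite lee_fin => /negP.
  by rewrite -ltNge.
have Elty : mu E < +oo.
  by apply: le_lt_trans finA; apply: le_measure; rewrite ?inE// => x [].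
have : mu E \is a fin_num by rewrite ge0_fin_numE// ltW.
move/fineK; set e := fine _ => eE.
have e0 : (0 < e)%R by rewrite -lte_fin eE.
exists (fun x => e^-1 * \1_E x)%R; split.
- by apply: measurable_funM => //; exact: measurable_indic.
- by move=> x; rewrite mulr_ge0// invr_ge0 ltW.
- by move=> x nA; rewrite indicE memNset ?mulr0// => -[].
- rewrite /Lnorm_on invr1 poweRe1; last by apply: integral_ge0 => *; exact: poweR_ge0.
  have -> : \int[mu]_x (`|(EFin \o (fun x => e^-1 * \1_E x)%R) x| `^ 1) =
      \int[mu]_(x in E) (e^-1)%:E.
    rewrite [RHS]integral_mkcond; apply: eq_integral => x _ /=.
    rewrite /patch indicE powRr1//; case: ifPn => xE; last by rewrite mulr0 normr0.
    by rewrite mulr1 ger0_norm// invr_ge0 ltW.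
  rewrite (_ : \int[mu]_(x in E) _ = (e^-1)%:E * mu E); last exact: integral_cst.
  by rewrite -eE -EFinM mulVf ?gt_eqF.
- have -> : \int[mu]_x (`|F x * (e^-1 * \1_E x)|%R)%:E =
      \int[mu]_(x in E) ((e^-1)%:E * `|(F x)%:E|).
    rewrite [RHS]integral_mkcond; apply: eq_integral => x _ /=.
    rewrite /patch indicE; case: ifPn => xE; last by rewrite !mulr0 normr0.
    by rewrite mulr1 normrM mulrC [X in (X * _)%R]ger0_norm// invr_ge0 ltW.
  apply: (@le_trans _ _ (\int[mu]_(x in E) (e^-1 * c)%:E)).
    rewrite (_ : \int[mu]_(x in E) _ = (e^-1 * c)%:E * mu E); last exact: integral_cst.
    by rewrite -eE -EFinM mulrAC mulVf ?gt_eqF// mul1r.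
  apply: ge0_le_integral => //.
  - by move=> x _; rewrite lee_fin mulr_ge0// invr_ge0 ltW.
  - apply: measurable_funeM; apply: measurableT_comp => //; apply/measurable_EFinP.
    exact: measurable_funTS.
  - by move=> x [_ /= cF]; rewrite lee_fin ler_wpM2l ?invr_ge0 ?ltW.
Qed.

End LnormReal.

(** * The weight function W *)

Section WeightNorm.
Context (R : realType) (theta : \bar R) (omega : R -> R).
Hypothesis theta0 : 0 < theta.
Hypothesis hom : cOmega theta omega.

Local Notation mu := (lebR R : {measure set (measurableTypeR R) -> \bar R}).
Local Notation D0 := (`]0%R, +oo[%classic : set (measurableTypeR R)).
Local Notation om := (EFin \o omega : measurableTypeR R -> \bar R).

Fact Wn_key : unit. Proof. by []. Qed.
(* Sealed, since otherwise unification tries to compare the underlying integrals. *)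
Definition Wn (t : R) : R := locked_with Wn_key (fine (wnorm theta omega t)).
Local Notation W := Wn.

Lemma WnE (t : R) : W t = fine (wnorm theta omega t).
Proof. by rewrite /Wn unlock. Qed.

Lemma measurable_D0 : measurable D0. Proof. exact: measurable_itv. Qed.

Lemma measurable_om : measurable_fun D0 om.
Proof. by apply/measurable_EFinP; case: hom. Qed.

Lemma itv0E (t : R) : `]0%R, t[%classic = D0 `&` [set x : R | (x < t)%R].
Proof.
apply/seteqP; split => x /=; rewrite !in_itv/= andbT.
  by move=> /andP[-> ->].
by move=> [-> ->].
Qed.

Lemma wnormE (t : R) : (0 < t)%R -> wnorm theta omega t = (W t)%:E.
Proof.
move=> t0; have [_ [_ /(_ _ t0)/andP[h1 h2]]] := hom.
by rewrite WnE fineK// gt0_fin_numE.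
Qed.

Lemma W_gt0 (t : R) : (0 < t)%R -> (0 < W t)%R.
Proof. by move=> t0; have [_ [_ /(_ _ t0)]] := hom; rewrite wnormE// lte_fin => /andP[]. Qed.

Lemma W_le0 (t : R) : (t <= 0)%R -> W t = 0%R.
Proof.
move=> t0; rewrite WnE /wnorm.
have -> : `]0%R, t[%classic = set0 :> set (measurableTypeR R).
  apply/seteqP; split => // x /=; rewrite in_itv/= => /andP[h1 h2].
  by have := lt_le_trans (lt_trans h1 h2) t0; rewrite ltxx.
case: theta theta0 => [r| |//] r0 /=.
  by rewrite integral_set0 poweR0r// invr_eq0 gt_eqF.
(* For infinite theta the norm over the empty interval is -oo, which [fine] sends to 0. *)
rewrite (_ : [set _ | _] = setT) ?ereal_infT//.
by apply/seteqP; split => // y _ /=; exact: nearW.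
Qed.

Lemma W_ge0 (t : R) : (0 <= W t)%R.
Proof. by have [/W_le0 ->|/W_gt0/ltW] := leP t 0%R. Qed.

Lemma W_nd : {homo W : s t / (s <= t)%R}.
Proof.
move=> s t st; have [s0|s0] := leP s 0%R; first by rewrite W_le0// W_ge0.
have t0 := lt_le_trans s0 st.
rewrite -lee_fin -!wnormE//; apply: Lnorm_on_subset => //.
- apply: (measurable_funS measurable_D0 _ measurable_om) => x /=.
  by rewrite !in_itv/= andbT => /andP[].
- by move=> x /=; rewrite !in_itv/= => /andP[-> /lt_le_trans ->].
- exact: ltW.
Qed.

Lemma measurable_W : measurable_fun setT (W : measurableTypeR R -> measurableTypeR R).
Proof. exact: nondecreasing_measurable measurableT W_nd. Qed.

(** The case of [Lnorm_on_le_radial] where the radius is the identity of the half-line and level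
    sets are single points. Left continuity of W and its limit at infinity are both instances. *)
Lemma wnorm_le_radial (I : set R) (c : R) : (0 <= c)%R ->
  measurable (D0 `&` I) ->
  (forall a' a, I a -> (0 < a')%R -> (a' < a)%R -> (W a' <= c)%R) ->
  Lnorm_on mu theta (D0 `&` I) om <= c%:E.
Proof.
move=> c0 mI h.
apply: (@Lnorm_on_le_radial _ (measurableTypeR R) R mu theta D0 (fun x => x) I) => //.
- move=> t; apply: (@subset_measure0 _ _ _ mu _ [set t]); last exact: lebesgue_measure_set1.
  + by apply: measurableI => //; exact: measurable_set1.
  + exact: measurable_set1.
  + by move=> x [].
- exact: measurable_om.
- move=> a' a Ia a'a; rewrite -itv0E.
  have [a'0|a'0] := ltP 0%R a'.
    by rewrite (_ : Lnorm_on _ _ _ _ = (W a')%:E) ?lee_fin ?(h a' a)// -wnormE.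
  have -> : `]0%R, a'[%classic = set0 :> set (measurableTypeR R).
    apply/seteqP; split => // x /=; rewrite in_itv/= => /andP[h1 h2].
    by have := lt_le_trans (lt_trans h1 h2) a'0; rewrite ltxx.
  case: theta theta0 => [r| |//] r0 /=.
    by rewrite integral_set0 poweR0r// invr_eq0 gt_eqF.
  by apply: ereal_inf_lbound => /=; exact: nearW.
Qed.

(** Left continuity: the interval (0,e) is the increasing union of the (0,t) with t < e. *)
Lemma W_left (e c : R) : (0 < e)%R -> (0 <= c)%R ->
  (forall t, (0 < t)%R -> (t < e)%R -> (W t <= c)%R) -> (W e <= c)%R.
Proof.
move=> e0 c0 h; rewrite -lee_fin -wnormE// /wnorm itv0E.
apply: wnorm_le_radial => //.
- by rewrite -itv0E; exact: measurable_itv.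
- move=> a' a /= ae a'0 a'a; apply: h => //; exact: lt_trans ae.
Qed.

(** Left continuity read backwards: {W > l} has no smallest point, so every point of it lies
    strictly above its infimum. *)
Lemma W_gt_left (l a : R) : (0 < a)%R -> (0 <= l)%R -> (l < W a)%R ->
  exists a0, [/\ (0 < a0)%R, (a0 < a)%R & (l < W a0)%R].
Proof.
move=> a0 l0 lW; apply: contrapT => hn; move: lW; rewrite ltNge => /negP; apply.
apply: W_left => // t t0 ta; rewrite leNgt; apply/negP => lt.
by apply: hn; exists t.
Qed.

Lemma W_le_inf (t : R) : (0 < t)%R -> (W t)%:E <= wnorm_inf theta omega.
Proof.
move=> t0; rewrite -wnormE//; apply: Lnorm_on_subset => //.
- exact: measurable_om.
- by move=> x /=; rewrite !in_itv/= andbT => /andP[].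
- exact: ltW.
Qed.

Lemma Winf_le (c : R) : (0 <= c)%R -> (forall t, (0 < t)%R -> (W t <= c)%R) ->
  wnorm_inf theta omega <= c%:E.
Proof.
move=> c0 h; rewrite /wnorm_inf -[X in Lnorm_on _ _ X _](setIT D0).
apply: wnorm_le_radial => //; first by rewrite setIT.
by move=> a' a _ a'0 _; exact: h.
Qed.

Lemma Winf_gt (c : R) : (0 <= c)%R -> c%:E < wnorm_inf theta omega ->
  exists2 t, (0 < t)%R & (c < W t)%R.
Proof.
move=> c0 h; apply: contrapT => hn; move: h; rewrite ltNge => /negP; apply.
apply: Winf_le => // t t0; rewrite leNgt; apply/negP => ct; apply: hn.
by exists t.
Qed.

Definition Wle (l : R) : set (measurableTypeR R) := D0 `&` [set t : R | (W t <= l)%R].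

Lemma measurable_Wset (J : set R) : measurable (J : set (measurableTypeR R)) ->
  measurable (D0 `&` (W @^-1` J)).
Proof.
move=> mJ; apply: measurableI => //; rewrite -[X in measurable X]setTI.
exact: measurable_W.
Qed.

Lemma measurable_Wle (l : R) : measurable (Wle l).
Proof.
rewrite /Wle; have -> : [set t : R | (W t <= l)%R] = W @^-1` `]-oo, l]%classic.
  by apply/seteqP; split => x /=; rewrite in_itv.
by apply: measurable_Wset; exact: measurable_itv.
Qed.

(** The sublevel set is exhausted by intervals (0,t) with W(t) <= l. For infinite theta this says
    that omega <= l almost everywhere where W <= l. *)
Lemma wnorm_Wle (l : R) : (0 <= l)%R -> Lnorm_on mu theta (Wle l) om <= l%:E.
Proof.
move=> l0; apply: wnorm_le_radial => //; first exact: measurable_Wle.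
by move=> a' a /= al a'0 /ltW /W_nd /le_trans; apply.
Qed.

(** By left continuity the supremum of {W <= l} still belongs to it. *)
Lemma W_lastpoint (l t0 t1 : R) : (0 < t0)%R -> (W t0 <= l)%R ->
  (l < W t1)%R -> exists e : R, [/\ (t0 <= e)%R, (W e <= l)%R &
    forall t, (e < t)%R -> (l < W t)%R].
Proof.
move=> t00 Wt0 Wt1; pose S := [set t : R | (W t <= l)%R].
have ubS : ubound S t1.
  move=> t /= Wt; rewrite leNgt; apply/negP => /ltW /W_nd.
  by move=> /le_trans /(_ Wt); rewrite leNgt Wt1.
have supS : has_sup S by split; [exists t0|exists t1].
have e0 : (t0 <= sup S)%R by apply: ub_le_sup => //; case: supS.
exists (sup S); split => //.
- apply: W_left; first exact: lt_le_trans e0.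
    by rewrite (le_trans (W_ge0 t0)).
  move=> t _ te; have te' : (0 < sup S - t)%R by rewrite subr_gt0.
  have [s /= Ws] := sup_adherent te' supS.
  by rewrite opprB addrCA subrr addr0 => /ltW /W_nd /le_trans; apply.
- move=> t et; rewrite ltNge; apply/negP => Wt.
  have : (t <= sup S)%R by apply: ub_le_sup => //; case: supS.
  by rewrite leNgt et.
Qed.

End WeightNorm.

Lemma le_of_eq (R : realType) (x y : \bar R) : x = y -> x <= y.
Proof. by move=> ->. Qed.

(** * Mass of omega^theta on the sublevels of W, for finite theta *)

Section WeightNormFinite.
Context (R : realType) (r : R) (omega : R -> R).
Hypothesis r0 : (0 < r)%R.
Hypothesis hom : cOmega r%:E omega.

Local Notation mu := (lebR R : {measure set (measurableTypeR R) -> \bar R}).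
Local Notation D0 := (`]0%R, +oo[%classic : set (measurableTypeR R)).
Local Notation W := (Wn r%:E omega).
Local Notation g := (fun s : measurableTypeR R => `|(omega s)%:E| `^ r).

Let r0e : 0 < r%:E. Proof. by rewrite lte_fin. Qed.

Lemma measurable_omr : measurable_fun D0 g.
Proof. exact: measurable_normpow (measurable_om hom). Qed.

Lemma W_powE (t : R) : (0 < t)%R -> (W t `^ r)%:E = \int[mu]_(s in `]0%R, t[) g s.
Proof. by move=> t0; rewrite -poweR_EFin -wnormE// Lnorm_on_poweR. Qed.

Lemma int_Wle_le (l : R) : (0 <= l)%R -> \int[mu]_(s in Wle r%:E omega l) g s <= (l `^ r)%:E.
Proof.
move=> l0; rewrite -poweR_EFin.
rewrite (_ : (\int[mu]_(s in Wle r%:E omega l) g s <= _) =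
  (Lnorm_on mu r%:E (Wle r%:E omega l) (EFin \o omega) <= l%:E)).
  exact: wnorm_Wle.
by rewrite Lnorm_on_fin_le// lee_fin.
Qed.

(* Continuity of the integral: no mass is lost at the last point of [W <= l]. *)
Lemma int_Wle_ge (l t1 : R) : (0 < l)%R -> (l < W t1)%R ->
  (l `^ r)%:E <= \int[mu]_(s in Wle r%:E omega l) g s.
Proof.
move=> l0 Wt1.
have t10 : (0 < t1)%R.
  by rewrite ltNge; apply/negP => /W_le0 E; move: Wt1; rewrite E// ltNge ltW.
have [a [a0 aW aW']] : exists a : R, [/\ (0 <= a)%R,
    (forall t, (t <= a)%R -> (W t <= l)%R) & forall t, (a < t)%R -> (l < W t)%R].
  have [[t0 t00 Wt0]|hn] := pselect (exists2 t0, (0 < t0)%R & (W t0 <= l)%R).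
    have [e [te We he]] := W_lastpoint r0e hom t00 Wt0 Wt1.
    exists e; split => //; first by rewrite ltW// (lt_le_trans t00).
    by move=> t tle; rewrite (le_trans _ We)// W_nd.
  exists 0%R; split => //.
    by move=> t tle; rewrite W_le0// ltW.
  by move=> t t0; rewrite ltNge; apply/negP => Wt; apply: hn; exists t.
have mS (A : set (measurableTypeR R)) : A `<=` D0 -> measurable_fun A g.
  by move=> AD; apply: (measurable_funS (@measurable_D0 R) AD measurable_omr).
have pg x : 0 <= g x by exact: poweR_ge0.
have [b1 b1E] : exists b1, b1 = (a + 1)%R by exists (a + 1)%R.
have [e eE] : exists e : nat -> R, forall m, e m = (a + m.+1%:R^-1)%R.
  by exists (fun m => a + m.+1%:R^-1)%R.
pose F (m : nat) := `[e m, b1[%classic : set (measurableTypeR R).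
pose U := `]a, b1[%classic : set (measurableTypeR R).
pose V (b : R) := `]0%R, b[%classic : set (measurableTypeR R).
have ae m : (a < e m)%R by rewrite eE ltrDl invr_gt0.
have eb m : (e m <= b1)%R.
  by rewrite eE b1E lerD2l invf_le1// ?ler1n// ltr0n.
have UD : U `<=` D0.
  by move=> x; rewrite /U /= !in_itv/= andbT => /andP[/(le_lt_trans a0)].
have VD b : V b `<=` D0 by move=> x; rewrite /V /= !in_itv/= andbT => /andP[].
have FU m : F m `<=` U.
  move=> x; rewrite /F /U /= !in_itv/= => /andP[h ->]; rewrite andbT.
  by rewrite (lt_le_trans _ h).
have a1 : (0 < b1)%R by rewrite b1E ltr_wpDl.
have WV b : (0 < b)%R -> (W b `^ r)%:E = \int[mu]_(s in V b) g s by exact: W_powE.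
(* Since W already exceeds l at [e m], the interval from [e m] to [b1] carries at most W(b1)^r -
   l^r. The same then holds for the whole of (a, b1), and at least l^r is left for {W <= l}. *)
have FV m : \int[mu]_(s in F m) g s + (l `^ r)%:E <= (W b1 `^ r)%:E.
  have am : (0 < e m)%R by exact: le_lt_trans (ae m).
  have lV : (l `^ r)%:E <= \int[mu]_(s in V (e m)) g s.
    apply: le_trans (le_of_eq (WV _ am)).
    by rewrite lee_fin; apply: powR_le; [exact: ltW|exact: ltW|rewrite ltW// aW'].
  apply: le_trans (leeD2l _ lV) _.
  have FVE : \int[mu]_(s in F m `|` V (e m)) g s =
      \int[mu]_(s in F m) g s + \int[mu]_(s in V (e m)) g s.
    apply: ge0_integral_setU; [exact: measurable_itv|exact: measurable_itv| | |].
    - by apply: mS => x [/FU/UD|/VD].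
    - by move=> *; exact: pg.
    - apply/disj_setPS => x [/=]; rewrite /F /V/= !in_itv/= => /andP[h1 _] /andP[_].
      by rewrite ltNge h1.
  apply: le_trans (le_of_eq (esym FVE)) _.
  apply: le_trans (le_of_eq (esym (WV _ a1))).
  apply: ge0_subset_integral; [by apply: measurableU; exact: measurable_itv|exact: measurable_itv|exact: mS|by []|].
  move=> x [/= |]; rewrite /F /V/= !in_itv/= => /andP[h1 h2].
    by rewrite h2 andbT (lt_le_trans am h1).
  by rewrite h1 (lt_le_trans h2).
have UV : \int[mu]_(s in U) g s <= (W b1 `^ r)%:E - (l `^ r)%:E.
  apply: (@ge0_integral_le_bigcup _ _ _ mu U U set0 F); rewrite ?measure0//.
  - exact: measurable_itv.
  - exact: measurable_itv.
  - by move=> m; exact: measurable_itv.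
  - move=> i j ij; apply/subsetPset => x; rewrite /F/= !in_itv/= => /andP[h ->].
    by rewrite andbT (le_trans _ h)// !eE lerD2l lef_pV2 ?posrE// ler_nat.
  - move=> x; rewrite /U/= in_itv/= => /andP[ax x1]; left.
    have e0 : (0 < x - a)%R by rewrite subr_gt0.
    have := near_infty_natSinv_lt (PosNum e0); case=> m _ /(_ m) /= h0.
    exists m => //; rewrite /F/= in_itv/= x1 andbT eE -lerBrDl.
    by apply: ltW; exact: h0.
  - exact: mS.
  - by move=> m; rewrite leeBrDr.
have mWl : measurable (Wle r%:E omega l) by exact: measurable_Wle.
have key : (W b1 `^ r)%:E <=
    \int[mu]_(s in Wle r%:E omega l) g s + \int[mu]_(s in U) g s.
  apply: le_trans (le_of_eq (WV _ a1)) _.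
  have WUE : \int[mu]_(s in Wle r%:E omega l `|` U) g s =
      \int[mu]_(s in Wle r%:E omega l) g s + \int[mu]_(s in U) g s.
    apply: ge0_integral_setU; [exact: measurable_Wle|exact: measurable_itv| |by move=> *; exact: pg|].
    - by apply: mS => x [[]|/UD].
    - apply/disj_setPS => x [[_ /= Wx]]; rewrite /U/= in_itv/= => /andP[/aW'].
      by rewrite ltNge Wx.
  apply: le_trans (le_of_eq WUE).
  apply: ge0_subset_integral; [exact: measurable_itv|apply: measurableU => //; exact: measurable_itv| |by []|].
    by apply: mS => x [[]|/UD].
  move=> x; rewrite /V /= in_itv/= => /andP[x0 xa].
  have [ax|xa'] := ltP a x; [right|left].
    by rewrite /U/= in_itv/= ax.
  by split; rewrite /= ?in_itv/= ?x0//; exact: aW.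
have := le_trans key (leeD2l _ UV).
case: (\int[mu]_(s in Wle r%:E omega l) g s) => [z| |].
- by rewrite -EFinB -EFinD !lee_fin => h; lra.
- by move=> _; rewrite leey.
- by rewrite -EFinB addNye leeNy_eq.
Qed.

End WeightNormFinite.

Lemma conj_eexp_gt0 (R : realType) (theta : \bar R) : 1 < theta -> (0 < conj_eexp theta)%R.
Proof.
case: theta => [r| |//] /=; last by [].
rewrite -[1]/(1%:E) lte_fin => r1.
by rewrite divr_gt0 ?subr_gt0// (lt_trans _ r1).
Qed.

Lemma powRN_anti (R : realType) (r x y : R) : (0 <= r)%R -> (0 < x)%R -> (x <= y)%R ->
  (y `^ (- r) <= x `^ (- r))%R.
Proof.
move=> r0 x0 xy; have y0 := lt_le_trans x0 xy.
rewrite !powRN lef_pV2 ?posrE ?powR_gt0//.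
by apply: powR_le => //; exact: ltW.
Qed.

(** * Stieltjes mass of the levels of W *)

Section StieltjesLevels.
Context (R : realType) (theta : \bar R) (omega : R -> R).
Variable nu : {measure set (measurableTypeR R) -> \bar R}.
Hypothesis theta1 : 1 < theta.
Hypothesis hom : cOmega theta omega.
Hypothesis LS : is_LS_of_minus_phi theta omega nu.

Local Notation D0 := (`]0%R, +oo[%classic : set (measurableTypeR R)).
Local Notation W := (Wn theta omega).
Local Notation th' := (conj_eexp theta).

Let theta0 : 0 < theta. Proof. exact: lt_trans theta1. Qed.
Let th0 : (0 < th')%R. Proof. exact: conj_eexp_gt0. Qed.

Lemma wnorm_plusE (t : R) :
  wnorm_plus theta omega t = inf [set W s | s in `]t, +oo[%classic].
Proof.
rewrite /wnorm_plus (_ : (fun s => fine (wnorm theta omega s)) = W); last first.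
  by apply/funext => s; rewrite WnE.
apply/cvg_lim => //.
have := @nondecreasing_at_right_cvgr R W t +oo%O; apply => //.
- by move=> x y _ _ /(W_nd theta0 hom).
- by exists 0%R => _ [s _ <-]; exact: W_ge0 theta0 hom _.
Qed.

Lemma wnorm_plus_le (t s : R) : (t < s)%R -> (wnorm_plus theta omega t <= W s)%R.
Proof.
move=> ts; rewrite wnorm_plusE; apply: ge_inf.
  by exists 0%R => _ [u _ <-]; exact: W_ge0 theta0 hom _.
by exists s => //=; rewrite in_itv/= andbT.
Qed.

Lemma wnorm_plus_ge (t c : R) : (forall s, (t < s)%R -> (c <= W s)%R) ->
  (c <= wnorm_plus theta omega t)%R.
Proof.
move=> h; rewrite wnorm_plusE; apply: lb_le_inf.
  by exists (W (t + 1)%R), (t + 1)%R => //=; rewrite in_itv/= andbT ltrDl.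
by move=> _ [s /= + <-]; rewrite in_itv/= andbT => /h.
Qed.

Lemma phi_le (t l : R) : (0 < l)%R -> (forall s, (t < s)%R -> (l <= W s)%R) ->
  (phi theta omega t <= l `^ (- th'))%R.
Proof. by move=> l0 h; apply: powRN_anti => //; [exact: ltW|exact: wnorm_plus_ge]. Qed.

Lemma nu_itv_le (a b l : R) : (0 < a)%R -> (0 < l)%R -> (l <= W a)%R ->
  nu `]a, b]%classic <= (l `^ (- th'))%:E.
Proof.
move=> a0 l0 lW; have [ab|ba] := leP a b.
  rewrite LS// lee_fin.
  apply: (@le_trans _ _ (phi theta omega a)); first by rewrite gerBl powR_ge0.
  by apply: phi_le => // s /ltW /(W_nd theta0 hom); exact: le_trans.
rewrite (_ : `]a, b]%classic = set0) ?measure0 ?lee_fin ?powR_ge0//.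
by rewrite set_itv_ge// bnd_simp -leNgt ltW.
Qed.

Definition Wlevel (l l' : R) : set (measurableTypeR R) :=
  D0 `&` (W @^-1` `]l, l']%classic).

Lemma measurable_Wlevel (l l' : R) : measurable (Wlevel l l').
Proof. by apply: (measurable_Wset theta0 hom); exact: measurable_itv. Qed.

(** The level does not contain its infimum, by left continuity, so it is covered by intervals ]inf +
    1/(m+1), m] with W >= l at the left end. Their mass is at most phi there, however far they reach
    beyond l'. *)
Lemma nu_Wlevel_le (l l' : R) : (0 < l)%R -> nu (Wlevel l l') <= (l `^ (- th'))%:E.
Proof.
move=> l0; set A := Wlevel l l'.
have mA : measurable A by exact: measurable_Wlevel.
have [A0|/set0P [t0 At0]] := eqVneq A set0.
  by rewrite A0 measure0 lee_fin powR_ge0.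
have lbA : lbound A 0%R by move=> x [/=]; rewrite in_itv/= andbT => /ltW.
have infA : has_inf A by split; [exists t0|exists 0%R].
pose F m := `](inf A + m.+1%:R^-1)%R, m%:R]%classic : set (measurableTypeR R).
have i0 : (0 <= inf A)%R by apply: lb_le_inf => //; exists t0.
have h : \int[nu]_(x in A) cst 1 x <= (l `^ (- th'))%:E.
  apply: (@ge0_integral_le_bigcup _ _ _ nu A D0 set0 F); rewrite ?measure0//.
  - by move=> m; exact: measurable_itv.
  - move=> i j ij; apply/subsetPset => x; rewrite /F/= !in_itv/= => /andP[h1 h2].
    rewrite (le_trans h2) ?ler_nat// andbT (le_lt_trans _ h1)// lerD2l.
    by rewrite lef_pV2 ?posrE// ler_nat.
  - move=> m x; rewrite /F/= !in_itv/= andbT => /andP[h1 _].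
    by rewrite (le_lt_trans _ h1)// addr_ge0.
  - by move=> x [].
  - move=> x Ax; left.
    have ix : (inf A < x)%R.
      have [x0 /=] := Ax; rewrite in_itv/= => /andP[lWx Wxl'].
      have xp : (0 < x)%R by move: x0; rewrite /= in_itv/= andbT.
      have [a1 [a10 a1x lWa]] := W_gt_left theta0 hom xp (ltW l0) lWx.
      apply: (le_lt_trans _ a1x); apply: ge_inf; first by exists 0%R.
      split; rewrite /= ?in_itv/= ?a10//= lWa/=.
      by rewrite (le_trans _ Wxl')// (W_nd theta0 hom)// ltW.
    have e0 : (0 < x - inf A)%R by rewrite subr_gt0.
    have := near_infty_natSinv_lt (PosNum e0); case=> m _ hm.
    exists (maxn m (Num.bound x)) => //; rewrite /F/= in_itv/=; apply/andP; split.
      by rewrite -ltrBrDl; exact: (hm _ (leq_maxl _ _)).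
    have xp : (0 <= x)%R by exact: le_trans (ltW ix).
    by rewrite ltW// (lt_le_trans (archi_boundP xp))// ler_nat leq_maxr.
  - move=> m; rewrite integral_cst//; last exact: measurable_itv.
    rewrite mul1e; apply: nu_itv_le => //; first by rewrite ltr_wpDl.
    have e0 : (0 < m.+1%:R^-1 :> R)%R by rewrite invr_gt0.
    have [i [i1 /=]] := inf_adherent e0 infA; rewrite in_itv/= => /andP[lWi _] ii.
    by rewrite ltW// (lt_le_trans lWi)// (W_nd theta0 hom)// ltW.
by move: h; rewrite integral_cst// mul1e.
Qed.

(** Take for e the last point with W <= 4l: then W(e+) >= 4l. The second point [a1] secures W(a+) <=
    2l, which W(a) <= 2l alone would not, as W may jump just after a. *)
Lemma nu_Wlevel_ge (l a a1 t1 : R) : (0 < l)%R -> (l < W a)%R -> (a < a1)%R ->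
  (W a1 <= 2 * l)%R -> (4 * l < W t1)%R ->
  exists e : R, `]a, e]%classic `<=` Wlevel l (4 * l) /\
    ((2 * l) `^ (- th') - (4 * l) `^ (- th'))%:E <= nu `]a, e]%classic.
Proof.
move=> l0 lWa aa1 Wa1 Wt1.
have ap : (0 < a)%R.
  rewrite ltNge; apply/negP => /(W_le0 omega theta0) E; move: lWa; rewrite E ltNge.
  by rewrite ltW.
have a1p := lt_trans ap aa1.
have Wa14 : (W a1 <= 4 * l)%R by rewrite (le_trans Wa1)// ler_wpM2r ?ler_nat// ltW.
have [e [a1e We he]] := W_lastpoint theta0 hom a1p Wa14 Wt1.
exists e; split.
  move=> x /=; rewrite in_itv/= => /andP[ax xe]; split.
    by rewrite /= in_itv/= andbT (lt_trans ap).
  rewrite /= in_itv/= (lt_le_trans lWa) ?(W_nd theta0 hom) ?(ltW ax)//=.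
  by rewrite (le_trans _ We)// (W_nd theta0 hom).
rewrite LS//; last by rewrite (le_trans (ltW aa1)).
rewrite lee_fin lerB//.
  apply: powRN_anti => //; first exact: ltW.
    by apply: (lt_le_trans l0); apply: wnorm_plus_ge => s /ltW /(W_nd theta0 hom); apply: le_trans; exact: ltW.
  exact: le_trans (wnorm_plus_le aa1) Wa1.
by apply: phi_le => [|s /he/ltW//]; rewrite mulr_gt0.
Qed.

End StieltjesLevels.

(** * Dyadic ladders *)

Section Ladder.
Context d (T : measurableType d) (R : realType).
Variable mu : {measure set T -> \bar R}.

(** A free base and a natural index replace dyadic levels indexed by the integers. *)
Definition ladder (l : R) (i : nat) : R := (l * 2 ^+ i)%R.

Lemma ladderS (l : R) i : ladder l i.+1 = (2 * ladder l i)%R.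
Proof. by rewrite /ladder exprS mulrCA. Qed.

Lemma ladder_gt0 (l : R) i : (0 < l)%R -> (0 < ladder l i)%R.
Proof. by move=> l0; rewrite mulr_gt0// exprn_gt0. Qed.

Lemma ladder_nd (l : R) i j : (0 < l)%R -> (i <= j)%N -> (ladder l i <= ladder l j)%R.
Proof.
move=> l0 ij; apply: ler_wpM2l; first exact: ltW.
by rewrite ler_weXn2l// ler1n.
Qed.

Definition level (D : set T) (w : T -> R) (l l' : R) : set T :=
  D `&` (w @^-1` `]l, l']%classic).

Lemma measurable_level (D : set T) (w : T -> R) (l l' : R) :
  measurable D -> measurable_fun setT w -> measurable (level D w l l').
Proof.
move=> mD mw; apply: measurableI => //; rewrite -[X in measurable X]setTI.
by apply: mw => //; exact: measurable_itv.
Qed.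

Lemma integral_ladder (D : set T) (w : T -> R) (g : T -> \bar R) (l : R) (m : nat) :
  (0 < l)%R -> measurable D -> measurable_fun setT w -> measurable_fun D g ->
  (forall x, 0 <= g x) ->
  \sum_(i < m) \int[mu]_(x in level D w (ladder l i) (ladder l i.+1)) g x =
  \int[mu]_(x in level D w (ladder l 0) (ladder l m)) g x.
Proof.
move=> l0 mD mw mg g0; elim: m => [|m IH].
  rewrite big_ord0 (_ : level _ _ _ _ = set0) ?integral_set0//.
  apply/seteqP; split => // x [_ /=]; rewrite in_itv/= => /andP[h1 h2].
  by have := lt_le_trans h1 h2; rewrite ltxx.
rewrite big_ord_recr/= IH.
have UE : level D w (ladder l 0) (ladder l m.+1) = level D w (ladder l 0) (ladder l m)
    `|` level D w (ladder l m) (ladder l m.+1).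
  apply/seteqP; split => x.
    move=> [Dx /=]; rewrite in_itv/= => /andP[h1 h2].
    have [h|h] := leP (w x) (ladder l m); [left|right]; split => //=;
      by rewrite in_itv/= ?h1 ?h2 ?h.
  move=> [[Dx /=]|[Dx /=]]; rewrite in_itv/= => /andP[h1 h2]; split => //=; rewrite in_itv/=.
    by rewrite h1/= (le_trans h2)// ladder_nd.
  by rewrite h2 andbT (le_lt_trans _ h1)// ladder_nd.
rewrite UE; apply: esym; apply: ge0_integral_setU.
- exact: measurable_level.
- exact: measurable_level.
- by apply: (measurable_funS mD) => // x [[]|[]].
- by move=> x _.
- apply/disj_setPS => x [[_ /=]]; rewrite in_itv/= => /andP[_ h1] [_ /=].
  by rewrite in_itv/= => /andP[/lt_le_trans/(_ h1)]; rewrite ltxx.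
Qed.

(** Passage from finite ladders to the whole domain: bounds uniform in base and length survive the
    limit, since levels exhaust {w > 0}. *)
Lemma integral_le_ladder (D N : set T) (w : T -> R) (g : T -> \bar R) (c : \bar R) :
  measurable D -> measurable N -> mu N = 0 -> measurable_fun setT w ->
  measurable_fun D g -> (forall x, 0 <= g x) ->
  (forall x, D x -> ~ N x -> (0 < w x)%R) ->
  (forall l m, (0 < l)%R ->
    \sum_(i < m) \int[mu]_(x in level D w (ladder l i) (ladder l i.+1)) g x <= c) ->
  \int[mu]_(x in D) g x <= c.
Proof.
move=> mD mN N0 mw mg g0 w0 h.
pose F (m : nat) := level D w (2 ^- m)%R (2 ^+ m)%R.
apply: (@ge0_integral_le_bigcup _ _ _ mu D D N F) => //.
- by move=> m; exact: measurable_level.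
- move=> i j ij; apply/subsetPset => x [Dx /=]; rewrite in_itv/= => /andP[h1 h2].
  split => //=; rewrite in_itv/= (le_trans h2) ?ler_weXn2l ?ler1n// andbT.
  by rewrite (le_lt_trans _ h1)// lef_pV2 ?posrE ?exprn_gt0// ler_weXn2l// ler1n.
- by move=> m x [].
- move=> x Dx; have [Nx|nN] := pselect (N x); [by right|left].
  have wx := w0 _ Dx nN.
  pose k := maxn (Num.bound (w x)) (Num.bound (w x)^-1).
  have k2 : (k%:R < 2 ^+ k :> R)%R by rewrite -natrX ltr_nat ltn_expl.
  have h1 : (w x < 2 ^+ k)%R.
    rewrite (lt_trans _ k2)// (lt_le_trans (archi_boundP (ltW wx)))//.
    by rewrite ler_nat leq_maxl.
  have h2 : ((w x)^-1 < 2 ^+ k)%R.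
    rewrite (lt_trans _ k2)// (@lt_le_trans _ _ (Num.bound (w x)^-1)%:R)//.
      by rewrite archi_boundP// invr_ge0 ltW.
    by rewrite ler_nat leq_maxr.
  exists k => //; split => //=; rewrite in_itv/= (ltW h1) andbT.
  by rewrite -[ltRHS]invrK ltf_pV2 ?posrE ?exprn_gt0 ?invr_gt0.
(* Base 2^{-m} and 2m rungs reach from 2^{-m} to 2^m. *)
- move=> m; have l0 : (0 < 2 ^- m :> R)%R by rewrite invr_gt0 exprn_gt0.
  have := h _ (m + m)%N l0; rewrite integral_ladder// /F.
  rewrite {1}/ladder expr0 mulr1 /ladder exprD mulrA mulVf ?mul1r//.
Qed.

End Ladder.

(** * Finite sequences *)

Section Sequences.
Context (R : realType).
Local Open Scope ring_scope.

(** The embedding of l^r in l^1: each y_i is at most K^{1/r}, so y_i = y_i^r y_i^{1-r} <= y_i^r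
    K^{1/r-1}. *)
Lemma sum_le_of_sum_powR (r K : R) (m : nat) (y : nat -> R) :
  0 < r -> r <= 1 -> (forall i, 0 <= y i) ->
  \sum_(i < m) y i `^ r <= K -> \sum_(i < m) y i <= K `^ r^-1.
Proof.
move=> r0 r1 y0 yK.
have K0 : 0 <= K by apply: le_trans yK; apply: sumr_ge0 => i _; exact: powR_ge0.
have yi (i : 'I_m) : y i <= K `^ r^-1.
  have h : y i `^ r <= K.
    apply: le_trans yK; rewrite (bigD1 i)//= lerDl sumr_ge0// => j _.
    exact: powR_ge0.
  rewrite -[leLHS](powRr1 (y0 i)) -(mulfV (lt0r_neq0 r0)) powRrM.
  by apply: powR_le => //; rewrite ?invr_ge0 ?powR_ge0 ?ltW.
have [K00|K00] := eqVneq K 0.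
  rewrite big1 ?powR_ge0// => i _; apply/eqP; rewrite eq_le y0 andbT.
  by have := yi i; rewrite K00 powR0// invr_eq0 gt_eqF.
have Kp : 0 < K by rewrite lt_neqAle eq_sym K00.
have -> : K `^ r^-1 = K * K `^ (r^-1 - 1).
  by rewrite mulr_powRB1// ?invr_gt0.
apply: (@le_trans _ _ (\sum_(i < m) (y i `^ r * K `^ (r^-1 - 1)))); last first.
  by rewrite -mulr_suml ler_wpM2r// powR_ge0.
apply: ler_sum => i _.
have [yi0|yi0] := eqVneq (y i) 0; first by rewrite yi0 mulr_ge0 ?powR_ge0.
rewrite [leLHS](_ : y i = y i `^ r * y i `^ (1 - r)); last first.
  by rewrite -powRD ?(addrC r) ?subrK ?powRr1// yi0 implybT.
apply: ler_wpM2l; first exact: powR_ge0.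
have -> : K `^ (r^-1 - 1) = (K `^ r^-1) `^ (1 - r).
  by rewrite -powRrM mulrBr mulr1 mulVf ?gt_eqF.
by apply: powR_le => //; rewrite subr_ge0.
Qed.

(** Hoelder for sums up to the constant: Young's inequality is applied to x_i / rho and y_i. If rho
    = 0 all x_i vanish. *)
Lemma sum_mul_young (r s C K rho : R) (m : nat) (x y : nat -> R) :
  0 < r -> 0 < s -> r^-1 + s^-1 = 1 -> 0 <= rho ->
  (forall i, 0 <= x i) -> (forall i, 0 <= y i) ->
  \sum_(i < m) x i `^ s <= C * rho `^ s -> \sum_(i < m) y i `^ r <= K ->
  \sum_(i < m) x i * y i <= (C / s + K / r) * rho.
Proof.
move=> r0 s0 rs rho0 x0 y0 xC yK.
have [r00|rn0] := eqVneq rho 0.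
  rewrite r00 mulr0 big1// => i _.
  move: xC; rewrite r00 powR0 ?gt_eqF// mulr0 => xC.
  have : x i `^ s <= 0.
    apply: le_trans xC; rewrite (bigD1 i)//= lerDl sumr_ge0// => j _.
    exact: powR_ge0.
  move=> h; have /eqP : x i `^ s == 0 by rewrite eq_le h powR_ge0.
  by move=> /powR_eq0_eq0 ->; rewrite mul0r.
have rp : 0 < rho by rewrite lt_neqAle eq_sym rn0.
apply: (@le_trans _ _ (\sum_(i < m) rho * ((x i / rho) `^ s / s + y i `^ r / r))).
  apply: ler_sum => i _.
  have -> : x i * y i = rho * ((x i / rho) * y i) by field.
  apply: ler_wpM2l => //; apply: conjugate_powR => //.
    by rewrite divr_ge0.
  by rewrite addrC.
rewrite -mulr_sumr mulrC ler_wpM2r// big_split/= -!mulr_suml lerD//.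
  apply: ler_wpM2r; first by rewrite invr_ge0 ltW.
  under eq_bigr do rewrite powRM ?invr_ge0//.
  rewrite -mulr_suml -powR_inv1// -powRrM mulN1r powRN.
  by rewrite ler_pdivrMr// powR_gt0.
by apply: ler_wpM2r => //; rewrite invr_ge0 ltW.
Qed.

(** The rungs are disjoint, so at most one contains w. This limits how often the exceptional term is
    charged. *)
Lemma sum_between_le1 (l w : R) (m : nat) : 0 < l ->
  \sum_(i < m) ((ladder l i < w <= ladder l i.+1)%R%:R : R) <= 1.
Proof.
move=> l0; suff : \sum_(i < m) ((ladder l i < w <= ladder l i.+1)%R%:R : R)
    <= (w <= ladder l m)%R%:R.
  by move=> /le_trans; apply; rewrite lern1 leq_b1.
elim: m => [|m IH]; first by rewrite big_ord0.
rewrite big_ord_recr/=; apply: le_trans (lerD IH (lexx _)) _.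
have := @ladder_nd R l m m.+1 l0 (leqnSn m).
have [h|h] := leP w (ladder l m) => h2 /=; first by rewrite addr0 (le_trans h h2).
by rewrite add0r.
Qed.

(* The smallest majorant of [a] that decreases at most by the factor [q] at each
   step is still controlled in every power mean. *)
Lemma slow_majorant (q s : R) (m : nat) (a : nat -> R) :
  0 < q -> 0 < s -> q `^ s = 2^-1 -> (forall i, 0 <= a i) ->
  exists at' : nat -> R, [/\ forall i, 0 <= at' i,
    forall i, (i < m)%N -> a i <= at' i,
    forall i, q * at' i.+1 <= at' i &
    \sum_(i < m) at' i `^ s + at' 0%N `^ s <= 2 * \sum_(i < m) a i `^ s].
Proof.
move=> q0 s0 qs; elim: m a => [|m IH] a a0.
  exists (fun=> 0); split => //; first by move=> i; rewrite mulr0.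
  by rewrite !big_ord0 powR0 ?gt_eqF// addr0 mulr0.
have [b [b0 ab bq bs]] := IH (fun i => a i.+1) (fun i => a0 i.+1).
pose c := Num.max (a 0%N) (q * b 0%N).
exists (fun i => if i is j.+1 then b j else c); split.
- by case=> // ; rewrite le_max a0.
- by case=> [_|i im]; [rewrite le_max lexx|exact: ab].
- by case=> [|i]; [rewrite le_max lexx orbT|exact: bq].
- rewrite big_ord_recl/= [in leRHS]big_ord_recl/=.
  (* The new head c enters the claim twice, and 2 c^s <= 2 a_0^s + b_0^s. The last term is the extra
     head term of the induction hypothesis, which is why the claim carries it. *)
  have cs : c `^ s <= a 0%N `^ s + b 0%N `^ s / 2.
    rewrite /c; have [_|_] := leP (a 0%N) (q * b 0%N).
      by rewrite powRM ?(ltW q0)// qs mulrC lerDr powR_ge0.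
    by rewrite lerDl divr_ge0 ?powR_ge0.
  have -> : \sum_(i < m) a (bump 0 i) `^ s = \sum_(i < m) a i.+1 `^ s by [].
  move: bs cs; set A := \sum_(i < m) a _ `^ s; set B := \sum_(i < m) _; lra.
Qed.

(** Downward induction on j: b_j + b_{j+1}/(1-q) <= b_j/(1-q) because b_{j+1} <= q b_j. *)
Lemma geometric_tail (q : R) (m : nat) (b : nat -> R) : 0 < q -> q < 1 ->
  (forall i, 0 <= b i) -> (forall i, b i.+1 <= q * b i) ->
  forall j, \sum_(i < m) b i * (j <= i)%N%:R <= b j / (1 - q).
Proof.
move=> q0 q1 b0 bq; have q1' : 0 < 1 - q by rewrite subr_gt0.
suff H k j : (m <= j + k)%N -> \sum_(i < m) b i * (j <= i)%N%:R <= b j / (1 - q).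
  by move=> j; apply: (H m); rewrite leq_addl.
elim: k j => [|k IH] j mj.
  rewrite big1 ?divr_ge0 ?(ltW q1')// => i _.
  by rewrite addn0 in mj; rewrite leqNgt (leq_trans (ltn_ord i) mj) mulr0.
apply: (@le_trans _ _ (b j + \sum_(i < m) b i * (j.+1 <= i)%N%:R)).
  have [jm|jm] := ltnP j m; last first.
    rewrite big1 ?addr_ge0// ?sumr_ge0// => i _; rewrite ?mulr_ge0//.
    by rewrite leqNgt (leq_trans (ltn_ord i) jm) mulr0.
  rewrite (bigD1 (Ordinal jm))//= leqnn mulr1 lerD2l.
  rewrite [leRHS](bigD1 (Ordinal jm))//= ltnn mulr0 add0r.
  apply: ler_sum => i ij; rewrite ler_wpM2l// ler_nat.
  by rewrite [(j <= i)%N]leq_eqVlt; move: ij; rewrite -val_eqE/= eq_sym => /negbTE ->.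
have /IH h : (m <= j.+1 + k)%N by rewrite addSnnS.
apply: le_trans (lerD (lexx _) h) _.
rewrite -[X in X + _](mulfK (lt0r_neq0 q1')) -mulrDl.
apply: ler_wpM2r; first by rewrite invr_ge0 ltW.
by have := bq j; lra.
Qed.

End Sequences.

(** Preimages of rays under a monotone function are intervals. *)
Lemma monotone_measurable (R : realType) (D : set (measurableTypeR R))
    (f : measurableTypeR R -> \bar R) : measurable D ->
  ({homo f : s t / (s <= t)%R >-> s <= t} \/ {homo f : s t / (s <= t)%R >-> t <= s}) ->
  measurable_fun D f.
Proof.
move=> mD hf _; apply: (measurability _ (ErealGenOInfty.measurableE R)) => //.
move=> _ [_ [y ->] <-]; apply: measurableI => //.
apply: is_interval_measurable => s t /=; rewrite !in_itv/= !andbT => fs ft z.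
move=> /andP[sz zt]; case: hf => hf.
  by rewrite in_itv/= andbT (lt_le_trans fs)// hf.
by rewrite in_itv/= andbT (lt_le_trans ft)// hf.
Qed.

(** * Discretized norms *)

Section Discretization.
Context (R : realType) (n : nat) (p : R) (theta : \bar R) (omega : R -> R).
Variable lam : {measure set (RnB R n) -> \bar R}.
Hypothesis n0 : (0 < n)%N.
Hypothesis leb : is_lebesgue_Rn lam.
Hypothesis p1 : (1 <= p)%R.
Hypothesis theta0 : 0 < theta.
Hypothesis hom : cOmega theta omega.

Local Notation mu := (lebR R : {measure set (measurableTypeR R) -> \bar R}).
Local Notation D0 := (`]0%R, +oo[%classic : set (measurableTypeR R)).
Local Notation W := (Wn theta omega).
Implicit Types (F H : RnB R n -> R).

Definition tailnorm H (r : R) : \bar R := Lnorm_on lam p%:E (~` @oball R n r) (EFin \o H).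

Definition Xn H : \bar R :=
  Lnorm_on mu theta D0 (fun r => (omega r)%:E * tailnorm H r).

Definition ballnorm F (t : R) : \bar R := Lnorm_on lam (conj_ext p) (@oball R n t) (EFin \o F).

Definition Wx (x : RnB R n) : R := W (enorm x).

Let p0 : (0 < p)%R. Proof. exact: lt_le_trans p1. Qed.
Let q0 : 0 < conj_ext p. Proof. exact: conj_ext_gt0. Qed.

Lemma measurable_Wx : measurable_fun setT Wx.
Proof. exact: (measurableT_comp (measurable_W theta0 hom) (@measurable_enorm R n)). Qed.

Lemma measurable_EFin A F : measurable A -> measurable_fun setT F ->
  measurable_fun A (EFin \o F).
Proof. by move=> mA mF; apply/measurable_EFinP; exact: measurable_funTS. Qed.

Lemma oball_subset (s t : R) : (s <= t)%R -> @oball R n s `<=` @oball R n t.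
Proof. by move=> st x /= xs; exact: lt_le_trans xs st. Qed.

Lemma ballnorm_nd F : measurable_fun setT F ->
  {homo ballnorm F : s t / (s <= t)%R >-> s <= t}.
Proof.
move=> mF s t st; apply: Lnorm_on_subset; [exact: measurable_oball|
  exact: measurable_oball|apply: measurable_EFin mF; exact: measurable_oball|
  exact: oball_subset|exact: ltW].
Qed.

(** For p = 1 a negative essential supremum would force the ball to be null. *)
Lemma ballnorm_gt0_ge0 F (t : R) : measurable_fun setT F -> (0 < t)%R -> 0 <= ballnorm F t.
Proof.
move=> mF t0; rewrite /ballnorm /conj_ext; case: ifPn => _; first exact: Lnorm_on_ge0.
rewrite leNgt; apply/negP => /ereal_inf_lt[y /= hy y0].
have := lebesgue_oball_gt0 n0 leb t0; rewrite lt_neqAle eq_sym => /andP[/eqP + _]; apply.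
apply/negligibleP; first exact: measurable_oball.
move: hy => [Z [mZ Z0 hZ]]; exists Z; split => // x Bx; apply: hZ => /= h.
have := h Bx; rewrite leNgt => /negP; apply; apply: (lt_le_trans y0).
by rewrite lee_fin.
Qed.

Lemma tailnorm_ge0 H r : 0 <= tailnorm H r.
Proof. exact: Lnorm_on_ge0. Qed.

Lemma tailnorm_ni H : measurable_fun setT H ->
  {homo tailnorm H : s t / (s <= t)%R >-> t <= s}.
Proof.
move=> mH s t st; apply: Lnorm_on_subset; [apply: measurableC; exact: measurable_oball|
  apply: measurableC; exact: measurable_oball|
  apply: measurable_EFin mH; apply: measurableC; exact: measurable_oball| |].
  by apply: subsetC; exact: oball_subset.
by rewrite lee_fin ltW.
Qed.

Lemma measurable_omtail H : measurable_fun setT H ->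
  measurable_fun D0 (fun r => (omega r)%:E * tailnorm H r).
Proof.
move=> mH; apply: emeasurable_funM; first exact: (measurable_om hom).
apply: monotone_measurable; [exact: measurable_D0|right; exact: tailnorm_ni].
Qed.

Definition upper_set (l : R) : set (RnB R n) := [set x | (l < Wx x)%R].

Lemma measurable_upper_set l : measurable (upper_set l).
Proof.
rewrite (_ : upper_set l = Wx @^-1` `]l, +oo[%classic); last first.
  by apply/seteqP; split => x /=; rewrite in_itv/= andbT.
by rewrite -[X in measurable X]setTI; apply: measurable_Wx => //; exact: measurable_itv.
Qed.

(** At l = 2^i this is the quantity gamma_i of the overview. *)
Definition upnorm H l := Lnorm_on lam p%:E (upper_set l) (EFin \o H).

Lemma upnorm0 H l : (forall t, (0 < t)%R -> (W t <= l)%R) -> (0 <= l)%R -> upnorm H l = 0.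
Proof.
move=> h l0; rewrite /upnorm (_ : upper_set l = set0).
  by rewrite /= integral_set0 poweR0r// invr_eq0 gt_eqF.
apply/seteqP; split => // x /=; rewrite /upper_set/= ltNge => /negP; apply.
have [e0|e0] := ltP 0%R (enorm x); first exact: h.
by rewrite /Wx (W_le0 omega theta0).
Qed.

Lemma Wx_gt0 x l : (0 <= l)%R -> (l < Wx x)%R -> (0 < enorm x)%R.
Proof.
move=> l0 h; rewrite ltNge; apply/negP => /(W_le0 omega theta0) E.
by move: h; rewrite /Wx E ltNge l0.
Qed.

(** If the tail norm at r exceeded 1/l, so would those at all s < r; then omega <= l almost
    everywhere on (0,r) and W(r) <= l. Hence the tail norm is at most 1/l wherever W > l, and r
    decreases to the infimum of that set, which is not attained. *)
Lemma upnorm_le_infty H l : theta = +oo -> measurable_fun setT H -> Xn H <= 1 ->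
  (0 < l)%R -> upnorm H l <= (l^-1)%:E.
Proof.
move=> thE mH; rewrite /Xn thE => /Lnorm_on_infty_le => /(_ lee01) hX l0.
have G r : (l < W r)%R -> tailnorm H r <= (l^-1)%:E.
  move=> lW; rewrite leNgt; apply/negP => hG.
  have r0 : (0 < r)%R.
    rewrite ltNge; apply/negP => /(W_le0 omega theta0) E.
    by move: lW; rewrite E ltNge ltW.
  move: lW; rewrite ltNge => /negP; apply; rewrite -lee_fin -(wnormE hom)// thE.
  apply/Lnorm_on_infty_le; first by rewrite lee_fin ltW.
  apply: filterS hX => s hs /=; rewrite in_itv/= => /andP[s0 sr].
  have /hs : D0 s by rewrite /= in_itv/= s0.
  have om0 : (0 <= omega s)%R by have [_ [h _]] := hom; exact: h.
  rewrite gee0_abs ?mule_ge0 ?tailnorm_ge0// => h1.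
  rewrite ger0_norm// lee_fin -(mul1r l) -ler_pdivrMr//.
  rewrite -lee_fin EFinM; apply: le_trans h1; apply: lee_wpmul2l => //.
  by apply: (le_trans (ltW hG)); apply: tailnorm_ni => //; exact: ltW.
have [hn|hn] := pselect (exists t, (l < W t)%R); last first.
  rewrite upnorm0 ?lee_fin ?invr_ge0 ?(ltW l0)// => t _.
  by rewrite leNgt; apply/negP => lt; apply: hn; exists t.
pose S := [set t : R | (l < W t)%R].
have lbS : lbound S 0%R.
  move=> t lW; rewrite leNgt; apply/negP => /ltW /(W_le0 omega theta0) E.
  by move: lW; rewrite /S/= E ltNge (ltW l0).
have infS : has_inf S by split; [exact: hn|exists 0%R].
pose B m := ~` @oball R n (inf S + m.+1%:R^-1)%R.
apply: (@Lnorm_on_le_bigcup _ _ _ lam p%:E (upper_set l) setT set0 B) => //.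
- by rewrite lee_fin invr_ge0 ltW.
- exact: measurable_upper_set.
- by move=> m; apply: measurableC; exact: measurable_oball.
- move=> i j ij; apply/subsetPset; apply: subsetC; apply: oball_subset.
  by rewrite lerD2l lef_pV2 ?posrE// ler_nat.
- move=> x /= lW; left.
  have xp := Wx_gt0 (ltW l0) lW.
  have [a0 [a00 a0x lWa]] := W_gt_left theta0 hom xp (ltW l0) lW.
  have ax : (inf S < enorm x)%R.
    by apply: (le_lt_trans _ a0x); apply: ge_inf => //; exists 0%R.
  have e0 : (0 < enorm x - inf S)%R by rewrite subr_gt0.
  have := near_infty_natSinv_lt (PosNum e0); case=> m _ hm.
  exists m => //=; rewrite /B /oball/=; apply/negP; rewrite -leNgt -lerBrDl.
  by apply: ltW; exact: (hm m (leqnn m)).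
- exact: measurable_EFin.
- move=> m; apply: G.
  have e0 : (0 < m.+1%:R^-1 :> R)%R by rewrite invr_gt0.
  have [i lWi ii] := inf_adherent e0 infS.
  by apply: (lt_le_trans lWi); apply: (W_nd theta0 hom); exact: ltW.
Qed.

(** If W exceeds l somewhere, omega^r has mass at least l^r - (l/2)^r on {l/2 < W <= l}. For t
    there, the upper set lies outside B(0,t), so the tail norm at t is at least [upnorm H l]. *)
Lemma upnorm_level_fin H r l : theta = r%:E -> measurable_fun setT H -> (0 < l)%R ->
  (l `^ r * (1 - 2 `^ (- r)))%R%:E * upnorm H l `^ r <=
  \int[mu]_(t in level D0 W (l / 2) l) (`|(omega t)%:E * tailnorm H t| `^ r).
Proof.
move=> thE mH l0; have r0 : (0 < r)%R by rewrite -lte_fin -thE.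
have hom' : cOmega r%:E omega by rewrite -thE.
have [[t1 lW]|hn] := pselect (exists t, (l < W t)%R); last first.
  rewrite upnorm0 ?(ltW l0)//; last first.
    by move=> t _; rewrite leNgt; apply/negP => lt; apply: hn; exists t.
  rewrite poweR0r ?gt_eqF// mule0; apply: integral_ge0 => t _; exact: poweR_ge0.
pose g := (fun s : measurableTypeR R => `|(omega s)%:E| `^ r).
have mL : measurable (level D0 W (l / 2) l).
  by apply: measurable_level; [exact: measurable_D0|exact: (measurable_W theta0 hom)].
have mg : measurable_fun D0 g by exact: (measurable_omr hom').
have mgS A : A `<=` D0 -> measurable_fun A g.
  by move=> AD; apply: (measurable_funS (@measurable_D0 R) AD mg).
have LD : level D0 W (l / 2) l `<=` D0 by move=> x [].
have l20 : (0 < l / 2)%R by rewrite divr_gt0.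
have hl : (l `^ r * (1 - 2 `^ (- r)))%R%:E <= \int[mu]_(s in level D0 W (l / 2) l) g s.
  have lW' : (l < Wn r%:E omega t1)%R by rewrite -thE.
  have h1 := int_Wle_ge r0 hom' l0 lW'.
  have h2 := int_Wle_le r0 hom' (ltW l20).
  have h3 : \int[mu]_(s in Wle r%:E omega l) g s <=
    \int[mu]_(s in Wle r%:E omega (l / 2)%R) g s +
    \int[mu]_(s in level D0 W (l / 2) l) g s.
    have UE : \int[mu]_(s in Wle r%:E omega (l / 2)%R `|` level D0 W (l / 2) l) g s =
      \int[mu]_(s in Wle r%:E omega (l / 2)%R) g s +
      \int[mu]_(s in level D0 W (l / 2) l) g s.
      apply: ge0_integral_setU => //.
      - by apply: measurable_Wle => //; rewrite -thE.
      - by apply: mgS => x [[]|[]].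
      - by move=> *; exact: poweR_ge0.
      - apply/disj_setPS => x [[_ /= Wx1]] [_ /=]; rewrite in_itv/= thE.
        by rewrite ltNge Wx1.
    apply: le_trans (le_of_eq UE); apply: ge0_subset_integral.
    - by apply: measurable_Wle => //; rewrite -thE.
    - by apply: measurableU => //; apply: measurable_Wle => //; rewrite -thE.
    - by apply: mgS => x [[]|[]].
    - by move=> *; exact: poweR_ge0.
    - move=> x [x0 /= Wxl]; have [h|h] := leP (W x) (l / 2)%R; [left|right].
        by split => //=; rewrite -thE.
      by split => //=; rewrite in_itv/= h thE.
  have := le_trans h1 (le_trans h3 (leeD2r _ h2)).
  have -> : (l `^ r * (1 - 2 `^ (- r)) = l `^ r - (l / 2) `^ r)%R.
    rewrite powRM ?(ltW l0) ?invr_ge0// mulrBr mulr1.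
    by rewrite -[(2^-1)%R]powR_inv1// -powRrM mulN1r.
  by rewrite EFinB leeBlDl.
apply: (@le_trans _ _ (upnorm H l `^ r * \int[mu]_(s in level D0 W (l / 2) l) g s)).
  by rewrite muleC; apply: lee_wpmul2l; first exact: poweR_ge0.
rewrite -ge0_integralZl//; last 3 first.
- exact: mgS.
- by move=> *; exact: poweR_ge0.
- exact: poweR_ge0.
apply: ge0_le_integral => //.
- by move=> *; rewrite mule_ge0 ?poweR_ge0.
- by apply: emeasurable_funM => //; exact: mgS.
- apply: measurable_normpow; apply: (measurable_funS (@measurable_D0 R) LD).
  exact: measurable_omtail.
- move=> t [t0 /=]; rewrite in_itv/= => /andP[_ Wt].
  rewrite abseM poweRM ?abse_ge0// muleC; apply: lee_wpmul2l; first exact: poweR_ge0.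
  apply: le_poweR; [exact: ltW|exact: Lnorm_on_ge0|].
  rewrite gee0_abs ?tailnorm_ge0//; apply: Lnorm_on_subset.
  + exact: measurable_upper_set.
  + by apply: measurableC; exact: measurable_oball.
  + by apply: measurable_EFin => //; apply: measurableC; exact: measurable_oball.
  + move=> x /= lx; rewrite /oball/= => xt; move: lx; rewrite /upper_set/= ltNge => /negP; apply.
    by apply: le_trans Wt; apply: (W_nd theta0 hom); exact: ltW.
  + by rewrite lee_fin ltW.
Qed.

(** What a norm at most 1 in X yields for y_i = 2^i gamma_i: an l^theta bound, whose constant is the
    inverse of the mass factor in [upnorm_level_fin]. *)
Definition level_bound (y : nat -> R) : Prop :=
  (forall r, theta = r%:E -> forall m : nat,
     \sum_(i < m) y i `^ r <= (1 - 2 `^ (- r))^-1)%R /\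
  (theta = +oo -> forall i, (y i <= 1)%R).

Lemma upnorm_seq H l : measurable_fun setT H -> Xn H <= 1 -> (0 < l)%R ->
  exists y : nat -> R, [/\ forall i, (0 <= y i)%R,
    forall i, upnorm H (ladder l i) <= (y i / ladder l i)%:E & level_bound y].
Proof.
move=> mH hX l0; have lp i := ladder_gt0 i l0.
have [thE|/eqP thn] := eqVneq theta +oo.
  exists (fun=> 1%R); split => //; last by split => // r; rewrite thE.
  by move=> i; rewrite mul1r; apply: upnorm_le_infty.
have [r thE] : exists r, theta = r%:E.
  by case: theta theta0 thn => [r| |//] _ // _; exists r.
have r0 : (0 < r)%R by rewrite -lte_fin -thE.
pose c : R := (1 - 2 `^ (- r))%R.
have c0 : (0 < c)%R.
  rewrite subr_gt0 powRN invf_lt1 ?powR_gt0//.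
  have : (1 `^ r < 2 `^ r :> R)%R by rewrite gt0_ltr_powR ?nnegrE// ltr1n.
  by rewrite powR1.
(* The value at level [ladder l i] is paid for by the rung just below it, so the disjoint rungs are
   those of the ladder with base l/2. *)
have sumle m : \sum_(i < m) (ladder l i `^ r * c)%R%:E * upnorm H (ladder l i) `^ r <= 1.
  have l20 : (0 < l / 2)%R by rewrite divr_gt0.
  have E i : ladder (l / 2) i.+1 = ladder l i.
    by rewrite ladderS /ladder mulrA mulrCA divff ?mulr1.
  pose g t := `|(omega t)%:E * tailnorm H t| `^ r.
  have mg : measurable_fun D0 g by apply: measurable_normpow; exact: measurable_omtail.
  apply: (@le_trans _ _ (\sum_(i < m) \int[mu]_(t in level D0 W (ladder (l / 2) i) (ladder (l / 2) i.+1)) g t)).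
    apply: lee_sum => i _; rewrite E.
    have -> : ladder (l / 2) i = (ladder l i / 2)%R by rewrite /ladder mulrAC.
    exact: upnorm_level_fin.
  rewrite (@integral_ladder _ _ _ mu D0 W g (l / 2)%R m l20 (@measurable_D0 R)
    (measurable_W theta0 hom) mg (fun x => poweR_ge0 _ _)).
  apply: (@le_trans _ _ (\int[mu]_(t in D0) g t)).
    apply: ge0_subset_integral => //.
    + by apply: measurable_level; [exact: measurable_D0|exact: (measurable_W theta0 hom)].
    + by move=> *; exact: poweR_ge0.
    + by move=> x [].
  by move: hX; rewrite /Xn thE -[X in _ <= X]/(1%:E) Lnorm_on_fin_le// poweR1r.
have term_le m (i : 'I_m) : (ladder l i `^ r * c)%R%:E * upnorm H (ladder l i) `^ r <= 1.
  apply: le_trans (sumle m); rewrite (bigD1 i)//= leeDl// sume_ge0// => j _.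
  by rewrite mule_ge0 ?poweR_ge0// lee_fin mulr_ge0 ?powR_ge0 ?(ltW c0).
have fin i : upnorm H (ladder l i) \is a fin_num.
  rewrite ge0_fin_numE; last exact: Lnorm_on_ge0.
  apply: (@lty_poweRy _ _ r); first by rewrite gt_eqF.
  rewrite ltey; apply/eqP => E; have := @term_le i.+1 ord_max; rewrite /= E.
  by rewrite gt0_muley ?lte_fin ?mulr_gt0 ?powR_gt0.
have up0 i : 0 <= upnorm H (ladder l i) by exact: Lnorm_on_ge0.
exists (fun i => ladder l i * fine (upnorm H (ladder l i)))%R; split.
- by move=> i; rewrite mulr_ge0 ?fine_ge0// ltW.
- by move=> i; rewrite mulrAC divff ?mul1r ?fineK// gt_eqF.
- split => [r'|]; last by rewrite thE.
  rewrite thE => -[<-] m; rewrite -/c -[leRHS]mul1r ler_pdivlMr// mulr_suml.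
  rewrite -lee_fin -sumEFin; apply: le_trans (sumle m); apply: lee_sum => i _.
  rewrite powRM ?fine_ge0// ?(ltW (lp _))// -{2}(fineK (fin i)) poweR_EFin -EFinM.
  by rewrite lee_fin mulrAC.
Qed.

(** The layer may contain its largest radius, whose sphere no smaller ball covers; that sphere is
    null. The strict inequality a' < a is what later gives room for a Stieltjes interval. *)
Lemma Nq_level_le F (l l' c : R) : (0 < l)%R -> (0 <= c)%R -> measurable_fun setT F ->
  (forall a' a, (l < W a)%R -> (W a <= l')%R -> (a' < a)%R -> ballnorm F a' <= c%:E) ->
  Lnorm_on lam (conj_ext p) (level setT Wx l l') (EFin \o F) <= c%:E.
Proof.
move=> l0 c0 mF h.
have -> : level setT Wx l l' = setT `&` (@enorm R n @^-1` (W @^-1` `]l, l']%classic)) by [].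
apply: Lnorm_on_le_radial => //.
- exact: measurable_enorm.
- by move=> t; rewrite setTI; exact: lebesgue_sphere.
- by apply: measurable_level => //; exact: measurable_Wx.
- exact: measurable_EFin.
- by move=> a' a /=; rewrite in_itv/= setTI => /andP[h1 h2] aa; exact: h aa.
Qed.

(** Common frame of both upper bounds: Hoelder on each layer turns the pairing into the sum of x_i
    y_i, the powers of 2 cancelling. What remains is to choose the weights x for the function
    [F]. *)
Lemma pairing_le_levels F H (c : R) : measurable_fun setT F -> measurable_fun setT H ->
  Xn H <= 1 ->
  (forall l (m : nat) y, (0 < l)%R -> (forall i, 0 <= y i)%R -> level_bound y ->
    exists x : nat -> R, [/\ forall i, (0 <= x i)%R,
      forall i, Lnorm_on lam (conj_ext p) (level setT Wx (ladder l i) (ladder l i.+1))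
        (EFin \o F) <= (ladder l i * x i)%:E &
      (\sum_(i < m) x i * y i <= c)%R]) ->
  \int[lam]_x (`|F x * H x|%R)%:E <= c%:E.
Proof.
move=> mF mH hX h.
apply: (@integral_le_ladder _ _ _ lam setT [set x | enorm x = 0%R] Wx) => //.
- exact: (measurable_radial (I := [set 0%R])).
- exact: lebesgue_sphere.
- exact: measurable_Wx.
- by apply/measurable_EFinP; apply: measurableT_comp => //; exact: measurable_funM.
- move=> x _ /= x0; apply: (W_gt0 hom); rewrite lt_neqAle enorm_ge0 andbT eq_sym.
  by apply/eqP.
- move=> l m l0; have [y [y0 yl yb]] := upnorm_seq mH hX l0.
  have [x [x0 xl xy]] := h l m y l0 y0 yb.
  apply: (@le_trans _ _ (\sum_(i < m) (x i * y i)%:E)); last by rewrite sumEFin lee_fin.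
  apply: lee_sum => i _.
  have mA : measurable (level setT Wx (ladder l i) (ladder l i.+1)).
    by apply: measurable_level => //; exact: measurable_Wx.
  apply: le_trans (hoelder_on p1 _ mA mF mH (xl i)) _.
    by rewrite mulr_ge0// ltW// ladder_gt0.
  apply: (@le_trans _ _ ((ladder l i * x i)%:E * (y i / ladder l i)%:E)).
    apply: lee_wpmul2l; first by rewrite lee_fin mulr_ge0// ltW// ladder_gt0.
    apply: le_trans (yl i); apply: Lnorm_on_subset => //.
    + exact: measurable_upper_set.
    + by apply: measurable_EFin => //; exact: measurable_upper_set.
    + by move=> z [_ /=]; rewrite in_itv/= => /andP[].
    + by rewrite lee_fin ltW.
  rewrite -EFinM lee_fin; have := ladder_gt0 i l0; set L := ladder l i => L0.
  rewrite (_ : (L * x i * (y i / L) = x i * y i)%R)//.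
  by field; rewrite gt_eqF.
Qed.

End Discretization.

(** * Upper bounds *)

Section UpperBounds.
Context (R : realType) (n : nat) (p : R) (theta : \bar R) (omega : R -> R).
Variable lam : {measure set (RnB R n) -> \bar R}.
Hypothesis n0 : (0 < n)%N.
Hypothesis leb : is_lebesgue_Rn lam.
Hypothesis p1 : (1 <= p)%R.
Hypothesis theta0 : 0 < theta.
Hypothesis hom : cOmega theta omega.

Local Notation D0 := (`]0%R, +oo[%classic : set (measurableTypeR R)).
Local Notation W := (Wn theta omega).
Local Notation N := (ballnorm p lam).
Local Notation X := (Xn p theta omega lam).
Implicit Types (F H : RnB R n -> R).

Lemma W_gt0_pos (l a : R) : (0 <= l)%R -> (l < W a)%R -> (0 < a)%R.
Proof.
move=> l0 h; rewrite ltNge; apply/negP => /(W_le0 omega theta0) E.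
by move: h; rewrite E ltNge l0.
Qed.

Lemma one_sub_2powRN_gt0 (r : R) : (0 < r)%R -> (0 < 1 - 2 `^ (- r))%R.
Proof.
move=> r0; rewrite subr_gt0 powRN invf_lt1 ?powR_gt0//.
have : (1 `^ r < 2 `^ r :> R)%R by rewrite gt0_ltr_powR ?nnegrE// ltr1n.
by rewrite powR1.
Qed.

(** The weights are constant: on a layer W is at most twice its lower level, whence 2S. The y_i are
    summable since theta <= 1. *)
Lemma pairing_le_sup : theta <= 1 -> exists C : R, (0 < C)%R /\
  forall F H (S : R), measurable_fun setT F -> measurable_fun setT H -> (0 <= S)%R ->
    (forall t, (0 < t)%R -> N F t <= (S * W t)%:E) -> X H <= 1 ->
    \int[lam]_x (`|F x * H x|%R)%:E <= (C * S)%:E.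
Proof.
move=> th1; have [r thE] : exists r, theta = r%:E.
  by case: theta theta0 th1 => [r| |//] _ // _; exists r.
have r0 : (0 < r)%R by rewrite -lte_fin -thE.
have r1 : (r <= 1)%R by rewrite -lee_fin -thE.
pose K : R := ((1 - 2 `^ (- r))^-1 `^ r^-1)%R.
have K0 : (0 < K)%R by rewrite powR_gt0// invr_gt0 one_sub_2powRN_gt0.
exists (2 * K)%R; split; first by rewrite mulr_gt0.
move=> F H S mF mH S0 hS hX.
apply: (pairing_le_levels n0 leb p1 theta0 hom mF mH hX) => l m y l0 y0 [yr _].
exists (fun=> 2 * S)%R; split => //; first by move=> _; rewrite mulr_ge0.
- move=> i; have L0 := ladder_gt0 i l0.
  apply: (Nq_level_le n0 leb p1 theta0 hom) => //.
    by rewrite !mulr_ge0// ltW.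
  move=> a' a la aL aa; have a0 := W_gt0_pos (ltW L0) la.
  apply: le_trans (ballnorm_nd lam p1 mF (ltW aa)) _.
  apply: le_trans (hS _ a0) _; rewrite lee_fin mulrCA mulrA mulrC ladderS in aL *.
  by apply: ler_wpM2r.
- rewrite -mulr_sumr (_ : (2 * K * S = 2 * S * K)%R); last by rewrite mulrAC.
  apply: ler_wpM2l; first by rewrite mulr_ge0.
  exact: (sum_le_of_sum_powR r0 r1 y0 (yr _ thE m)).
Qed.

End UpperBounds.

(** * Upper bound by the Stieltjes integral, theta > 1 *)

Section UpperStieltjes.
Context (R : realType) (n : nat) (p : R) (theta : \bar R) (omega : R -> R).
Variable lam : {measure set (RnB R n) -> \bar R}.
Variable nu : {measure set (measurableTypeR R) -> \bar R}.
Hypothesis n0 : (0 < n)%N.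
Hypothesis leb : is_lebesgue_Rn lam.
Hypothesis p1 : (1 <= p)%R.
Hypothesis theta1 : 1 < theta.
Hypothesis hom : cOmega theta omega.
Hypothesis LS : is_LS_of_minus_phi theta omega nu.

Local Notation D0 := (`]0%R, +oo[%classic : set (measurableTypeR R)).
Local Notation W := (Wn theta omega).
Local Notation N := (ballnorm p lam).
Local Notation X := (Xn p theta omega lam).
Local Notation s := (conj_eexp theta).
Implicit Types (F H : RnB R n -> R).

Let theta0 : 0 < theta. Proof. exact: lt_trans theta1. Qed.
Let s0 : (0 < s)%R. Proof. exact: conj_eexp_gt0. Qed.

(** Inverse of the mass guaranteed by [nu_Wlevel_ge] at l = 1. *)
Definition stieltjes_const : R := (2 `^ (- s) - 4 `^ (- s))^-1%R.

Lemma stieltjes_const_gt0 : (0 < stieltjes_const)%R.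
Proof.
rewrite invr_gt0 subr_gt0 !powRN ltf_pV2 ?posrE ?powR_gt0//.
by rewrite gt0_ltr_powR ?nnegrE// ltr_nat.
Qed.

Lemma measurable_ballnorm_pow F : measurable_fun setT F ->
  measurable_fun D0 (fun t => N F t `^ s).
Proof.
move=> mF; apply: (measurableT_comp (measurable_poweR s)).
apply: monotone_measurable; [exact: measurable_D0|left; exact: ballnorm_nd].
Qed.

Lemma ladder_ladder (l : R) i j : ladder (ladder l i) j = ladder l (i + j).
Proof. by rewrite /ladder exprD mulrA. Qed.

(** A double rung splits into a rung of the ladder and one of the ladder with base 2l; each family
    is disjoint. *)
Lemma sum_two_levels_le (g : measurableTypeR R -> \bar R) (l : R) (m : nat) (c : \bar R) :
  (0 < l)%R -> measurable_fun D0 g -> (forall x, 0 <= g x) ->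
  \int[nu]_(t in D0) g t <= c ->
  \sum_(i < m) \int[nu]_(t in level D0 W (ladder l i) (4 * ladder l i)%R) g t <= c + c.
Proof.
move=> l0 mg g0 hc.
have mD := @measurable_D0 R; have mW := measurable_W theta0 hom.
have one l' : (0 < l')%R ->
    \sum_(i < m) \int[nu]_(t in level D0 W (ladder l' i) (ladder l' i.+1)) g t <= c.
  move=> l'0; rewrite integral_ladder//; apply: le_trans hc.
  apply: ge0_subset_integral => //; first exact: measurable_level.
  by move=> x [].
apply: (@le_trans _ _ (\sum_(i < m) (
    \int[nu]_(t in level D0 W (ladder l i) (ladder l i.+1)) g t +
    \int[nu]_(t in level D0 W (ladder (2 * l) i) (ladder (2 * l) i.+1)) g t))).
  apply: lee_sum => i _; have L0 := ladder_gt0 i l0.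
  have := @integral_ladder _ _ _ nu D0 W g _ 2 L0 mD mW mg g0.
  rewrite !big_ord_recr big_ord0/= ?add0e ?add0r !ladder_ladder addn0 addn1 addn2.
  rewrite !ladderS mulrA -natrM /=.
  have -> : ladder (2 * l) i = (2 * ladder l i)%R by rewrite /ladder mulrA.
  by rewrite mulrA -natrM => ->.
rewrite big_split/=; apply: leeD; apply: one => //.
by rewrite mulr_gt0.
Qed.

Lemma sum_between2_le (l w : R) (m : nat) : (0 < l)%R ->
  (\sum_(i < m) ((ladder l i < w <= 4 * ladder l i)%R%:R : R) <= 2)%R.
Proof.
move=> l0; apply: (@le_trans _ _ (\sum_(i < m)
   ((ladder l i < w <= ladder l i.+1)%R%:R + (ladder (2 * l) i < w <= ladder (2 * l) i.+1)%R%:R))%R).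
  apply: ler_sum => i _; rewrite !ladderS.
  have -> : ladder (2 * l) i = (2 * ladder l i)%R by rewrite /ladder mulrA.
  rewrite mulrA -natrM /=.
  have [h1|h1] := ltP (ladder l i) w => /=; last by rewrite addr_ge0.
  have [h2|h2] := leP w (4 * ladder l i)%R => /=; last by rewrite addr_ge0.
  by have [h3|h3] := leP w (2 * ladder l i)%R => /=; rewrite ?h2 ?addr0 ?add0r ?lerDl.
have l20 : (0 < 2 * l)%R by rewrite mulr_gt0.
rewrite big_split/=; apply: le_trans (lerD (sum_between_le1 w m l0) (sum_between_le1 w m l20)) _.
by lra.
Qed.

(** The ball norm is nondecreasing, so on ]b,e] it is at least its value at b, and [nu_Wlevel_ge]
    bounds the mass of that interval from below. *)
Lemma ballnorm_le_level F (l a' a t1 j : R) : measurable_fun setT F -> (0 < l)%R ->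
  (l < W a)%R -> (W a <= 2 * l)%R -> (a' < a)%R -> (4 * l < W t1)%R ->
  \int[nu]_(t in level D0 W l (4 * l)%R) (N F t `^ s) <= j%:E -> (0 <= j)%R ->
  N F a' `^ s <= (l `^ s * (stieltjes_const * j))%R%:E.
Proof.
move=> mF l0 la al aa lt1 hj j0.
have ap : (0 < a)%R by exact: W_gt0_pos (ltW l0) la.
have [a0 [a00 a0a la0]] := W_gt_left theta0 hom ap (ltW l0) la.
(* The radius a' may lie below the level. It is raised to b, where W > l, and b < a still gives
   W(b+) <= W(a) <= 2l. *)
pose b := Num.max a' a0.
have ba : (b < a)%R by rewrite gt_max aa.
have b0 : (0 < b)%R by rewrite lt_max a00 orbT.
have lb : (l < W b)%R.
  by apply: (lt_le_trans la0); apply: (W_nd theta0 hom); rewrite le_max lexx orbT.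
have [e [sub hnu]] := nu_Wlevel_ge theta1 hom LS l0 lb ba al lt1.
have Nb0 : 0 <= N F b by apply: ballnorm_gt0_ge0.
have mg := measurable_ballnorm_pow mF.
have mI : measurable (`]b, e]%classic : set (measurableTypeR R)) by exact: measurable_itv.
have ID : `]b, e]%classic `<=` D0 by move=> x /sub[].
have mgI : measurable_fun (`]b, e]%classic : set (measurableTypeR R)) (fun t => N F t `^ s).
  exact: (measurable_funS (@measurable_D0 R) ID mg).
have key : N F b `^ s * ((2 * l) `^ (- s) - (4 * l) `^ (- s))%R%:E <= j%:E.
  apply: le_trans hj; apply: (@le_trans _ _ (N F b `^ s * nu `]b, e]%classic)).
    by apply: lee_wpmul2l => //; exact: poweR_ge0.
  have -> : N F b `^ s * nu `]b, e]%classic = \int[nu]_(t in `]b, e]%classic) cst (N F b `^ s) t.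
    by rewrite integral_cst.
  apply: (@le_trans _ _ (\int[nu]_(t in `]b, e]%classic) (N F t `^ s))).
    apply: ge0_le_integral => //.
    - by move=> *; exact: poweR_ge0.
    - move=> t /=; rewrite in_itv/= => /andP[bt _].
      by apply: le_poweR; [exact: ltW|by []|apply: ballnorm_nd => //; exact: ltW].
  apply: ge0_subset_integral => //.
  - by apply: measurable_level; [exact: measurable_D0|exact: (measurable_W theta0 hom)].
  - by apply: (measurable_funS (@measurable_D0 R) _ mg) => x [].
  - by move=> *; exact: poweR_ge0.
have cE : ((2 * l) `^ (- s) - (4 * l) `^ (- s) = (l `^ s * stieltjes_const)^-1)%R.
  rewrite /stieltjes_const invfM invrK mulrBr -!powRN mulrC.
  by rewrite !powRM ?(ltW l0)// [in RHS]mulrC [(2 `^ _ * _)%R]mulrC; congr (_ - _)%R; rewrite mulrC.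
have c0 : (0 < l `^ s * stieltjes_const)%R by rewrite mulr_gt0 ?powR_gt0 ?stieltjes_const_gt0.
apply: (@le_trans _ _ (N F b `^ s)).
  (* For a' <= 0 the ball is empty and its norm is 0, or -oo if p = 1; either way its power is 0. *)
  have [a'0|a'0] := leP a' 0%R; last first.
    apply: le_poweR; [exact: ltW|exact: ballnorm_gt0_ge0|].
    by apply: ballnorm_nd => //; rewrite le_max lexx.
  have -> : N F a' `^ s = 0; last exact: poweR_ge0.
  rewrite /ballnorm (_ : oball a' = set0); last first.
    apply/seteqP; split => // x /=; rewrite /oball/= ltNge => /negP; apply.
    exact: le_trans a'0 (enorm_ge0 _).
  rewrite /conj_ext; case: ifPn => [p1'|_] /=.
    have q0 : (0 < conj_exp p)%R by rewrite (lt_trans _ (conj_exp_gt1 p1')).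
    by rewrite integral_set0 poweR0r ?invr_eq0 ?gt_eqF// poweR0r// gt_eqF.
  rewrite (_ : [set _ | _] = setT) ?ereal_infT ?poweRNyr ?gt_eqF//.
  by apply/seteqP; split => // y _ /=; exact: nearW.
by move: key; rewrite cE lee_pdivrMr// -EFinM mulrC mulrA.
Qed.

(** The two factors 2 are the twofold overlap of double rungs and the number of exceptional rungs,
    each of which costs (4 rho)^s. *)
Definition weights_const : R := (2 * stieltjes_const + 2 * 4 `^ s)%R.

Lemma weights_const_gt0 : (0 < weights_const)%R.
Proof. by rewrite addr_gt0// mulr_gt0// ?powR_gt0// stieltjes_const_gt0. Qed.

Lemma level_weights F (rho l : R) (m : nat) : measurable_fun setT F -> (0 <= rho)%R ->
  (0 < l)%R ->
  \int[nu]_(t in D0) (N F t `^ s) <= (rho `^ s)%:E ->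
  (forall w, wnorm_inf theta omega = w%:E ->
     forall t, (0 < t)%R -> N F t <= (rho * w)%:E) ->
  exists x : nat -> R, [/\ forall i, (0 <= x i)%R,
    forall i, Lnorm_on lam (conj_ext p)
      (level setT (Wx theta omega (n := n)) (ladder l i) (ladder l i.+1))
      (EFin \o F) <= (ladder l i * x i)%:E &
    (\sum_(i < m) x i `^ s <= weights_const * rho `^ s)%R].
Proof.
move=> mF rho0 l0 hJ hM; pose K2 := stieltjes_const; have K20 : (0 < K2)%R := stieltjes_const_gt0.
pose J i := \int[nu]_(t in level D0 W (ladder l i) (4 * ladder l i)%R) (N F t `^ s).
have mg := measurable_ballnorm_pow mF.
have J0 i : 0 <= J i by apply: integral_ge0 => *; exact: poweR_ge0.
have Jle i : J i <= (rho `^ s)%:E.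
  apply: le_trans hJ; apply: ge0_subset_integral => //.
  - by apply: measurable_level; [exact: measurable_D0|exact: (measurable_W theta0 hom)].
  - by move=> *; exact: poweR_ge0.
  - by move=> x [].
have JE i : (fine (J i))%:E = J i.
  by rewrite fineK// ge0_fin_numE// (le_lt_trans (Jle i))// ltry.
(* Marks the exceptional rungs, where the total norm of omega lies in (l_i, 4 l_i]. There are at
   most two, and none if that norm is infinite. *)
pose b i : R := if wnorm_inf theta omega is w%:E
  then ((ladder l i < w <= 4 * ladder l i)%R%:R) else 0%R.
have b0 i : (0 <= b i)%R by rewrite /b; case: (wnorm_inf theta omega).
have bsum : (\sum_(i < m) b i <= 2)%R.
  rewrite /b; case: (wnorm_inf theta omega) => [w| |]; first exact: sum_between2_le.
    by rewrite big1.
  by rewrite big1.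
(* The s-th power of the weight; adding both contributions avoids choosing between the two cases. *)
pose z i := (K2 * fine (J i) + b i * (4 * rho) `^ s)%R.
have z0 i : (0 <= z i)%R.
  by rewrite addr_ge0// mulr_ge0 ?powR_ge0 ?fine_ge0// ltW.
pose x i := (z i `^ s^-1)%R.
have xs i : (x i `^ s = z i)%R by rewrite /x -powRrM mulVf ?gt_eqF// powRr1.
have x0 i : (0 <= x i)%R by exact: powR_ge0.
have xsum : (\sum_(i < m) x i `^ s <= weights_const * rho `^ s)%R.
  under eq_bigr do rewrite xs.
  have -> : (\sum_(i < m) z i = K2 * (\sum_(i < m) fine (J i)) + (\sum_(i < m) b i) * (4 * rho) `^ s)%R.
    by rewrite /z big_split/= -mulr_sumr -mulr_suml.
  have -> : (weights_const * rho `^ s = K2 * (2 * rho `^ s) + 2 * (4 `^ s * rho `^ s))%R.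
    by rewrite /weights_const /K2; ring.
  apply: lerD.
    apply: ler_wpM2l; first exact: ltW.
    rewrite -lee_fin -sumEFin; under eq_bigr do rewrite JE.
    apply: le_trans (sum_two_levels_le m l0 mg _ hJ) _; first by move=> *; exact: poweR_ge0.
    by rewrite -EFinD lee_fin; lra.
  rewrite powRM//; apply: ler_wpM2r => //.
  by rewrite mulr_ge0 ?powR_ge0.
exists x; split => //.
- move=> i; set L := ladder l i; have L0 : (0 < L)%R by exact: ladder_gt0.
  apply: (Nq_level_le n0 leb p1 theta0 hom) => //; first by rewrite mulr_ge0// ltW.
  move=> a' a la aL aa; rewrite ladderS -/L in aL.
  have ap : (0 < a)%R by exact: W_gt0_pos (ltW L0) la.
  (* Either W exceeds 4L and the Stieltjes mass is available, or the total norm w is at most 4L. In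
     the latter case w > L since the level is occupied, and the bound rho w <= L (4 rho) applies. *)
  have [h4|h4] := ltP (4 * L)%:E (wnorm_inf theta omega).
    have [t1 _ lt1] : exists2 t, (0 < t)%R & (4 * L < W t)%R.
      by apply: (Winf_gt theta0 hom) => //; rewrite mulr_ge0// ltW.
    have [N0|N0] := leP (N F a') 0.
      by apply: (le_trans N0); rewrite lee_fin mulr_ge0// ltW.
    rewrite -(@lee_poweR2 _ s)//; last 2 first.
    + exact: ltW.
    + by rewrite lee_fin mulr_ge0// ltW.
    have J' : \int[nu]_(t in level D0 W L (4 * L)%R) (N F t `^ s) <= (fine (J i))%:E.
      by rewrite JE.
    apply: le_trans (ballnorm_le_level mF L0 la aL aa lt1 J' _) _; first exact: fine_ge0.
    rewrite poweR_EFin lee_fin powRM ?(ltW L0)// xs; apply: ler_wpM2l; first exact: powR_ge0.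
    by rewrite /z lerDl mulr_ge0// powR_ge0.
  have [w wE] : exists w, wnorm_inf theta omega = w%:E.
    have := W_le_inf theta0 hom ap; move: h4.
    by case: (wnorm_inf theta omega) => [w| |]//; exists w.
  apply: le_trans (ballnorm_nd lam p1 mF (ltW aa)) _.
  apply: le_trans (hM _ wE _ ap) _; rewrite lee_fin.
  have w4 : (w <= 4 * L)%R by rewrite -lee_fin -wE.
  have Lw : (L < w)%R.
    by rewrite (lt_le_trans la)// -lee_fin -wE; exact: (W_le_inf theta0 hom).
  have bi : b i = 1%R by rewrite /b wE -/L Lw w4.
  have x4 : (4 * rho <= x i)%R.
    have r4 : (0 <= 4 * rho)%R by rewrite mulr_ge0.
    rewrite [leLHS](_ : _ = ((4 * rho) `^ s) `^ s^-1)%R; last first.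
      by rewrite -powRrM mulfV ?gt_eqF// powRr1.
    apply: powR_le; [by rewrite invr_ge0 ltW|exact: powR_ge0|].
    by rewrite /z bi mul1r lerDr mulr_ge0 ?fine_ge0// ltW.
  apply: (@le_trans _ _ (rho * (4 * L))%R); first exact: ler_wpM2l.
  by rewrite mulrCA mulrA mulrC ler_wpM2l// ltW.
Qed.

(** For finite theta, x in l^{theta'} is paired with y in l^theta by Young; for infinite theta,
    theta' = 1 and y_i <= 1. *)
Lemma pairing_le_stieltjes : exists C : R, (0 < C)%R /\
  forall F H (rho : R), measurable_fun setT F -> measurable_fun setT H -> (0 <= rho)%R ->
    \int[nu]_(t in D0) (N F t `^ s) <= (rho `^ s)%:E ->
    (forall w, wnorm_inf theta omega = w%:E ->
       forall t, (0 < t)%R -> N F t <= (rho * w)%:E) -> X H <= 1 ->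
    \int[lam]_x (`|F x * H x|%R)%:E <= (C * rho)%:E.
Proof.
have C10 := weights_const_gt0.
have [[r thE]|thE] : (exists r, theta = r%:E) \/ theta = +oo.
  by case: theta theta1 => [r| |//] _; [left; exists r|right].
- have r1 : (1 < r)%R by rewrite -lte_fin -thE.
  have r0 : (0 < r)%R by rewrite (lt_trans _ r1).
  exists (weights_const / s + (1 - 2 `^ (- r))^-1 / r)%R; split.
    by rewrite addr_gt0// divr_gt0// invr_gt0 one_sub_2powRN_gt0.
  move=> F H rho mF mH rho0 hJ hM hX.
  apply: (pairing_le_levels n0 leb p1 theta0 hom mF mH hX) => l m y l0 y0 [yr _].
  have [x [x0 xl xs]] := level_weights m mF rho0 l0 hJ hM.
  exists x; split => //; apply: sum_mul_young xs (yr _ thE m) => //.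
  by rewrite thE; exact: conj_exp_inv.
- exists weights_const; split => // F H rho mF mH rho0 hJ hM hX.
  apply: (pairing_le_levels n0 leb p1 theta0 hom mF mH hX) => l m y l0 y0 [_ yi].
  have [x [x0 xl xs]] := level_weights m mF rho0 l0 hJ hM.
  exists x; split => //; move: xs; rewrite thE /= powRr1//; apply: le_trans.
  apply: ler_sum => i _; rewrite powRr1// -[leRHS]mulr1.
  by apply: ler_wpM2l => //; exact: yi.
Qed.

End UpperStieltjes.

(** Fits [Lnorm_on_dual], which only reaches real values strictly below a norm that may be
    infinite. *)
Lemma lee_fin_lt (R : realType) (a b : \bar R) : 0 <= a ->
  (forall c : R, (0 <= c)%R -> c%:E < b -> c%:E <= a) -> b <= a.
Proof.
move=> a0 h; rewrite leNgt; apply/negP => ab.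
case: a a0 ab h => [a| |//]; last by move=> _; rewrite ltNge leey.
rewrite lee_fin => a0; case: b => [b| |//].
  rewrite lte_fin => ab h; have c0 : (0 <= (a + b) / 2)%R by lra.
  have cb : ((a + b) / 2 < b)%R by lra.
  by have := h _ c0; rewrite lte_fin lee_fin => /(_ cb); lra.
move=> _ h; have c0 : (0 <= a + 1)%R by lra.
by have := h _ c0 (ltry _); rewrite lee_fin; lra.
Qed.

(** * Lower bounds *)

Section LowerBounds.
Context (R : realType) (n : nat) (p : R) (theta : \bar R) (omega : R -> R).
Variable lam : {measure set (RnB R n) -> \bar R}.
Hypothesis n0 : (0 < n)%N.
Hypothesis leb : is_lebesgue_Rn lam.
Hypothesis p1 : (1 <= p)%R.
Hypothesis theta0 : 0 < theta.
Hypothesis hom : cOmega theta omega.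

Local Notation mu := (lebR R : {measure set (measurableTypeR R) -> \bar R}).
Local Notation D0 := (`]0%R, +oo[%classic : set (measurableTypeR R)).
Local Notation W := (Wn theta omega).
Local Notation N := (ballnorm p lam).
Local Notation G := (tailnorm p lam).
Local Notation X := (Xn p theta omega lam).
Implicit Types (F H h : RnB R n -> R).

Let p0 : (0 < p)%R. Proof. exact: lt_le_trans p1. Qed.

(** A bound C on the associate norm after removal of the weight; finiteness of the tails is part of
    membership in X. *)
Definition pairing_bound F (C : R) : Prop :=
  forall H, measurable_fun setT H -> (forall t, (0 < t)%R -> G H t < +oo) ->
    X H <= 1 -> \int[lam]_x (`|F x * H x|%R)%:E <= C%:E.

Lemma tailnorm_le H r : measurable_fun setT H ->
  G H r <= Lnorm_on lam p%:E setT (EFin \o H).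
Proof.
move=> mH; apply: Lnorm_on_subset => //.
- by apply: measurableC; exact: measurable_oball.
- exact: measurable_EFin.
- by rewrite lee_fin ltW.
Qed.

Lemma tailnorm_supp H (t r : R) : (forall x, ~ oball t x -> H x = 0%R) ->
  (t <= r)%R -> G H r <= 0.
Proof.
move=> h tr; rewrite Lnorm_on_fin_le// poweR0r ?gt_eqF// integral0_eq// => x xr /=.
rewrite h ?normr0 ?powR0 ?gt_eqF//; apply: contra_not xr; exact: oball_subset.
Qed.

Lemma ladder_find (l w : R) (m : nat) : (ladder l 0 < w)%R -> (w <= ladder l m)%R ->
  exists j, [/\ (j < m)%N, (ladder l j < w)%R & (w <= ladder l j.+1)%R].
Proof.
move=> l0w; elim: m => [|m IH]; first by rewrite leNgt l0w.
have [h _|h h'] := leP w (ladder l m); last by exists m.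
by have [j [jm h1 h2]] := IH h; exists j; split => //; rewrite ltnS ltnW.
Qed.

(** * Norm in X of functions whose tails are dominated by a step function of W *)

Section Step.
Variables (H : RnB R n -> R) (l : R) (m : nat) (B : nat -> R).
Hypothesis mH : measurable_fun setT H.
Hypothesis l0 : (0 < l)%R.
Hypothesis B0 : forall j, (0 <= B j)%R.
Hypothesis hlow : forall r, (0 < r)%R -> (W r <= ladder l 0)%R -> G H r <= (B 0%N)%:E.
Hypothesis hmid : forall j r, (j < m)%N -> (ladder l j < W r)%R ->
  (W r <= ladder l j.+1)%R -> G H r <= (B j)%:E.
Hypothesis hhigh : forall r, (ladder l m < W r)%R -> G H r <= 0.

(** On {W <= L} omega is almost everywhere at most L, so a rung contributes at most its upper level
    times B_j. *)
Lemma Xn_step_infty : theta = +oo -> (ladder l 0 * B 0%N <= 1)%R ->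
  (forall j, (j < m)%N -> ladder l j.+1 * B j <= 1)%R -> X H <= 1.
Proof.
move=> thE h0 hj; rewrite /Xn thE; apply/Lnorm_on_infty_le => //.
have : {ae mu, forall s, forall j : nat, Wle theta omega (ladder l j) s ->
    `|(omega s)%:E| <= (ladder l j)%:E}.
  apply: ae_foralln => j; have L0 := ladder_gt0 j l0.
  have := wnorm_Wle theta0 hom (ltW L0); rewrite [X in Lnorm_on _ X]thE.
  by move/Lnorm_on_infty_le; apply; rewrite lee_fin ltW.
apply: filterS => s hs Ds; have s0 : (0 < s)%R by move: Ds; rewrite /= in_itv/= andbT.
have key j b : (0 <= b)%R -> (W s <= ladder l j)%R -> G H s <= b%:E ->
    (ladder l j * b <= 1)%R -> `|(omega s)%:E * G H s| <= 1.
  move=> b0 Ws Gs hb; rewrite abseM; apply: (@le_trans _ _ ((ladder l j)%:E * b%:E)).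
    apply: lee_pmul => //; first by apply: hs; split.
    by rewrite gee0_abs ?tailnorm_ge0.
  by rewrite -EFinM lee_fin.
have [h1|h1] := leP (W s) (ladder l 0); first exact: (key 0%N (B 0%N)) (hlow s0 h1) h0.
have [h2|h2] := leP (W s) (ladder l m).
  have [j [jm lj jl]] := ladder_find h1 h2.
  exact: (key j.+1 (B j)) (hmid jm lj jl) (hj _ jm).
have -> : G H s = 0 by apply/eqP; rewrite eq_le hhigh// tailnorm_ge0.
by rewrite mule0 abse0.
Qed.

(** The half-line splits into {W <= l_0}, the rungs, and {W > l_m} where the tail vanishes; omega^r
    has mass at most L^r on any part of {W <= L}. *)
Lemma Xn_step_fin r : theta = r%:E ->
  (ladder l 0 `^ r * B 0%N `^ r + \sum_(j < m) ladder l j.+1 `^ r * B j `^ r <= 1)%R ->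
  X H <= 1.
Proof.
move=> thE hB; have r0 : (0 < r)%R by rewrite -lte_fin -thE.
have hom' : cOmega r%:E omega by rewrite -thE.
rewrite /Xn thE -[X in _ <= X]/(1%:E) Lnorm_on_fin_le// poweR1r.
pose g (s : measurableTypeR R) := `|(omega s)%:E * G H s| `^ r.
have g0 s : 0 <= g s by exact: poweR_ge0.
have mD := @measurable_D0 R; have mW := measurable_W theta0 hom.
have mg : measurable_fun D0 g := measurable_normpow r (measurable_omtail lam p1 hom mH).
have mgS A : A `<=` D0 -> measurable_fun A g by move=> AD; exact: (measurable_funS mD AD mg).
have piece (A : set (measurableTypeR R)) (L b : R) : measurable A -> (0 <= L)%R -> (0 <= b)%R ->
    A `<=` Wle theta omega L -> (forall s, A s -> G H s <= b%:E) ->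
    \int[mu]_(s in A) g s <= (L `^ r * b `^ r)%:E.
  move=> mA L0 b0 AW Ab.
  have AD : A `<=` D0 by move=> s /AW[].
  have mo : measurable_fun D0 (fun s => `|(omega s)%:E| `^ r) by exact: (measurable_omr hom').
  have moA : measurable_fun A (fun s => `|(omega s)%:E| `^ r).
    exact: (measurable_funS mD AD mo).
  apply: (@le_trans _ _ (\int[mu]_(s in A) ((b `^ r)%:E * (`|(omega s)%:E| `^ r)))).
    apply: ge0_le_integral => //.
    - exact: mgS.
    - by apply: emeasurable_funM.
    - move=> s As; rewrite /g abseM poweRM ?abse_ge0// muleC.
      apply: lee_wpmul2r; first exact: poweR_ge0.
      rewrite -poweR_EFin; apply: le_poweR; [exact: ltW|exact: abse_ge0|].
      by rewrite gee0_abs ?tailnorm_ge0//; exact: Ab.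
  rewrite ge0_integralZl_EFin ?powR_ge0//; last by move=> *; exact: poweR_ge0.
  rewrite mulrC EFinM; apply: lee_wpmul2l; first by rewrite lee_fin powR_ge0.
  apply: (@le_trans _ _ (\int[mu]_(s in Wle r%:E omega L) (`|(omega s)%:E| `^ r))).
    apply: ge0_subset_integral => //.
    - by apply: measurable_Wle => //; rewrite -thE.
    - by apply: (measurable_funS mD _ mo) => s [].
    - by move=> *; exact: poweR_ge0.
    - by rewrite -thE.
  exact: int_Wle_le.
have mlow : measurable (Wle theta omega (ladder l 0)) by exact: measurable_Wle.
have mmid : measurable (level D0 W (ladder l 0) (ladder l m)) by exact: measurable_level.
pose top := D0 `&` (W @^-1` `]ladder l m, +oo[%classic).
have mtop : measurable top by apply: (measurable_Wset theta0 hom); exact: measurable_itv.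
have DE : D0 = (Wle theta omega (ladder l 0) `|` level D0 W (ladder l 0) (ladder l m)) `|` top.
  apply/seteqP; split => s; last by move=> [[[]|[]]|[]].
  move=> Ds; have [h1|h1] := leP (W s) (ladder l 0); first by left; left.
  have [h2|h2] := leP (W s) (ladder l m); [left; right|right]; split => //=;
    by rewrite in_itv/= ?h1 ?h2.
have E1 : \int[mu]_(s in D0) g s =
    \int[mu]_(s in Wle theta omega (ladder l 0) `|` level D0 W (ladder l 0) (ladder l m)) g s +
    \int[mu]_(s in top) g s.
  rewrite [in LHS]DE; apply: ge0_integral_setU => //; first exact: measurableU.
  - by apply: mgS; rewrite -DE.
  - apply/disj_setPS => s [hs [_ hm]].
    have {hm} : (ladder l m < W s)%R by move: hm; rewrite /= in_itv/= andbT.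
    case: hs => [[_ /= h]|[_ /=]].
      by rewrite ltNge (le_trans h)// ladder_nd.
    by rewrite in_itv/= => /andP[_ h]; rewrite ltNge h.
have E2 : \int[mu]_(s in Wle theta omega (ladder l 0) `|` level D0 W (ladder l 0) (ladder l m)) g s =
    \int[mu]_(s in Wle theta omega (ladder l 0)) g s +
    \int[mu]_(s in level D0 W (ladder l 0) (ladder l m)) g s.
  apply: ge0_integral_setU => //.
  - by apply: mgS => s [[]|[]].
  - apply/disj_setPS => s [[_ /= h] [_ /=]]; rewrite in_itv/= => /andP[h' _].
    by move: h'; rewrite ltNge h.
have E3 : \int[mu]_(s in top) g s = 0.
  apply: integral0_eq => s [Ds /=]; rewrite in_itv/= andbT => h.
  have G0 : G H s = 0 by apply/eqP; rewrite eq_le hhigh// tailnorm_ge0.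
  by rewrite /g G0 mule0 abse0 poweR0r// gt_eqF.
apply: (@le_trans _ _ (ladder l 0 `^ r * B 0%N `^ r
    + \sum_(j < m) ladder l j.+1 `^ r * B j `^ r)%:E); last by rewrite lee_fin.
apply: le_trans (le_of_eq E1) _; rewrite E3 adde0; apply: le_trans (le_of_eq E2) _.
rewrite EFinD; apply: leeD.
  apply: piece => //; first by rewrite ltW// ladder_gt0.
  by move=> s [/= Ds h]; apply: hlow => //; move: Ds; rewrite in_itv/= andbT.
rewrite -(@integral_ladder _ _ _ mu D0 W g l m l0 mD mW mg g0) -sumEFin.
apply: lee_sum => j _; apply: piece => //.
- exact: measurable_level.
- by rewrite ltW// ladder_gt0.
- by move=> s [Ds /=]; rewrite in_itv/= => /andP[_ h]; split.
- by move=> s [Ds /=]; rewrite in_itv/= => /andP[h h']; exact: hmid.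
Qed.

End Step.

(** A dual function h on B(0,t), divided by W(t), has norm at most 1 in X: its tails are at most
    1/W(t) and vanish once W exceeds W(t). This is the step criterion with no rungs. *)
Lemma ballnorm_le_pairing F (C : R) : measurable_fun setT F -> (0 <= C)%R ->
  pairing_bound F C -> forall t, (0 < t)%R -> N F t <= (C * W t)%:E.
Proof.
move=> mF C0 hC t t0; have W0 := W_gt0 hom t0.
apply: lee_fin_lt; first by rewrite lee_fin mulr_ge0// ltW.
move=> c c0 hc.
have [h [mh h0 hs h1 hF]] := Lnorm_on_dual p1 c0 (@measurable_oball R n t)
  (lebesgue_oball_lty leb t) mF hc.
pose H x := ((W t)^-1 * h x)%R.
have mH : measurable_fun setT H by apply: measurable_funM.
have i0 : (0 <= (W t)^-1)%R by rewrite invr_ge0 ltW.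
have GH r : G H r <= ((W t)^-1)%:E.
  apply: le_trans (tailnorm_le r mH) _.
  by have := Lnorm_onZ_le p1 i0 ler01 (@measurableT _ (RnB R n)) mh h1; rewrite mulr1.
have L0 : ladder (W t) 0 = W t by rewrite /ladder expr0 mulr1.
have hhigh r : (ladder (W t) 0 < W r)%R -> G H r <= 0.
  rewrite L0 => Wtr; apply: (@tailnorm_supp _ t).
    by move=> x /hs; rewrite /H => ->; rewrite mulr0.
  by rewrite leNgt; apply/negP => /ltW /(W_nd theta0 hom); rewrite leNgt Wtr.
have XH : X H <= 1.
  have [[r thE]|thE] : (exists r, theta = r%:E) \/ theta = +oo.
    by case: theta theta0 => [r| |//] _; [left; exists r|right].
    have r0 : (0 < r)%R by rewrite -lte_fin -thE.
    apply: (@Xn_step_fin H (W t) 0%N (fun=> (W t)^-1%R) mH W0 _ _ _ _ r thE) => //.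
    rewrite big_ord0 addr0 L0 -powRM ?(ltW W0)// mulfV ?gt_eqF//.
    by rewrite powR1.
  apply: (@Xn_step_infty H (W t) 0%N (fun=> (W t)^-1%R) W0 _ _ _ _ thE) => //.
  by rewrite L0 mulfV ?gt_eqF.
have := hC H mH (fun u _ => le_lt_trans (GH u) (ltry _)) XH.
have -> : \int[lam]_x (`|F x * H x|%R)%:E = ((W t)^-1)%:E * \int[lam]_x (`|F x * h x|%R)%:E.
  rewrite -ge0_integralZl_EFin//.
    by apply: eq_integral => x _; rewrite -EFinM /H mulrCA normrM (ger0_norm i0).
  by apply/measurable_EFinP; apply: measurableT_comp => //; exact: measurable_funM.
move=> hle; have := le_trans (lee_wpmul2l (_ : 0 <= ((W t)^-1)%:E) hF) hle.
rewrite lee_fin i0 => /(_ isT); rewrite -EFinM !lee_fin.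
by rewrite mulrC ler_pdivrMr.
Qed.

End LowerBounds.

(** * Lower bound by the Stieltjes integral, theta > 1 *)

Section LowerStieltjes.
Context (R : realType) (n : nat) (p : R) (theta : \bar R) (omega : R -> R).
Variable lam : {measure set (RnB R n) -> \bar R}.
Variable nu : {measure set (measurableTypeR R) -> \bar R}.
Hypothesis n0 : (0 < n)%N.
Hypothesis leb : is_lebesgue_Rn lam.
Hypothesis p1 : (1 <= p)%R.
Hypothesis theta1 : 1 < theta.
Hypothesis hom : cOmega theta omega.
Hypothesis LS : is_LS_of_minus_phi theta omega nu.

Local Notation D0 := (`]0%R, +oo[%classic : set (measurableTypeR R)).
Local Notation W := (Wn theta omega).
Local Notation N := (ballnorm p lam).
Local Notation G := (tailnorm p lam).
Local Notation X := (Xn p theta omega lam).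
Local Notation s := (conj_eexp theta).
Implicit Types (F H : RnB R n -> R).

Let theta0 : 0 < theta. Proof. exact: lt_trans theta1. Qed.
Let s0 : (0 < s)%R. Proof. exact: conj_eexp_gt0. Qed.

Lemma conj_eexp_ge1 : (1 <= s)%R.
Proof.
case: theta theta1 => [r| |//] /=; last by [].
by rewrite lte_fin => r1; rewrite ltW//; exact: conj_exp_gt1.
Qed.

Section TestFunction.
Variables (F : RnB R n -> R) (C l : R) (m : nat) (v : nat -> R) (h : nat -> RnB R n -> R).
Hypothesis mF : measurable_fun setT F.
Hypothesis C0 : (0 <= C)%R.
Hypothesis hC : pairing_bound p theta omega lam F C.
Hypothesis l0 : (0 < l)%R.
Hypothesis v0 : forall i, (0 <= v i)%R.
Hypothesis mh : forall i, measurable_fun setT (h i).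
Hypothesis h0 : forall i x, (0 <= h i x)%R.
Hypothesis h1 : forall i, Lnorm_on lam p%:E setT (EFin \o h i) <= 1.
Hypothesis hhigh : forall i r, (ladder l i.+1 < W r)%R -> G (h i) r <= 0.
Hypothesis hv : forall i, (v i)%:E <= \int[lam]_x (`|F x * h i x|%R)%:E.

Let H (b : nat -> R) x := (\sum_(i < m) b i * h i x)%R.

Let mH b : measurable_fun setT (H b).
Proof. by apply: measurable_sum => i; apply: measurable_funM. Qed.

Let k r i : R := (W r <= ladder l i.+1)%R%:R.

Lemma tailnorm_comb_le (b : nat -> R) r : (forall i, 0 <= b i)%R ->
  G (H b) r <= (\sum_(i < m) b i * k r i)%:E.
Proof.
move=> b0; apply: Lnorm_on_sum_le => //.
  by apply: measurableC; exact: measurable_oball.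
move=> i _; rewrite /k; have [Wr|Wr] := leP (W r) (ladder l i.+1); last first.
  by apply: (le_trans (hhigh Wr)); rewrite lee_fin.
exact: le_trans (tailnorm_le lam p1 r (mh i)) (h1 i).
Qed.

(** The tails of h_i vanish beyond W = l_{i+1}, so past level l_j only the terms with i >= j
    survive. *)
Lemma tailnorm_comb_tail (b : nat -> R) r j : (forall i, 0 <= b i)%R -> (ladder l j < W r)%R ->
  G (H b) r <= (\sum_(i < m) b i * (j <= i)%N%:R)%:E.
Proof.
move=> b0 jr; apply: le_trans (tailnorm_comb_le r b0) _; rewrite lee_fin.
apply: ler_sum => i _; apply: ler_wpM2l => //; rewrite ler_nat /k.
have [Wr|//] := leP (W r) (ladder l i.+1).
suff : (j < i.+1)%N by rewrite ltnS => ->.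
rewrite ltnNge; apply/negP => ij; move: jr; rewrite ltNge (le_trans Wr)//.
exact: ladder_nd.
Qed.

Lemma pairing_comb (b : nat -> R) : (forall i, 0 <= b i)%R ->
  (\sum_(i < m) b i * v i)%:E <= \int[lam]_x (`|F x * H b x|%R)%:E.
Proof.
move=> b0.
have -> : \int[lam]_x (`|F x * H b x|%R)%:E =
    \int[lam]_x (\sum_(i < m) (b i * `|F x * h i x|)%:E).
  apply: eq_integral => x _; rewrite sumEFin; congr EFin.
  have Hx0 : (0 <= H b x)%R by apply: sumr_ge0 => i _; exact: mulr_ge0.
  rewrite normrM [X in (_ * X)%R](ger0_norm Hx0) /H.
  by rewrite mulr_sumr; apply: eq_bigr => i _; rewrite normrM (ger0_norm (h0 _ _)) mulrCA.
have mFh i : measurable_fun setT (fun x => `|F x * h i x|%R).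
  by apply: measurableT_comp => //; exact: measurable_funM.
rewrite ge0_integral_sum//; last 2 first.
- by move=> i; apply/measurable_EFinP; apply: measurable_funM.
- by move=> i x _; rewrite lee_fin mulr_ge0.
rewrite -sumEFin; apply: lee_sum => i _.
under eq_integral do rewrite EFinM.
rewrite ge0_integralZl_EFin//; last exact/measurable_EFinP.
by rewrite EFinM; apply: lee_wpmul2l; rewrite ?lee_fin.
Qed.

Let q : R := 2 `^ (- s^-1).

Let q0 : (0 < q)%R. Proof. exact: powR_gt0. Qed.

Let qs : (q `^ s = 2^-1)%R.
Proof. by rewrite /q -powRrM mulNr mulVf ?gt_eqF// powR_inv1. Qed.

Let q1 : (q < 1)%R.
Proof.
rewrite /q powRN invf_lt1 ?powR_gt0//.
have si : (0 < s^-1)%R by rewrite invr_gt0.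
have : (1 `^ s^-1 < 2 `^ s^-1 :> R)%R by rewrite gt0_ltr_powR ?nnegrE// ltr1n.
by rewrite powR1.
Qed.

Let Kb : R := (1 - q)^-1%R.

Let Kb0 : (0 < Kb)%R. Proof. by rewrite invr_gt0 subr_gt0. Qed.

(** Geometric decay sums each tail to a multiple of its first term, which puts the superposition
    under the step criterion. *)
Lemma comb_bound (tau : R) (b : nat -> R) : (0 <= tau)%R -> (forall i, 0 <= b i)%R ->
  (forall i, b i.+1 <= q * b i)%R ->
  let B j := (tau * Kb * b j)%R in
  [/\ forall r, G (H (fun i => tau * b i)%R) r <= (B 0%N)%:E,
      forall j r, (ladder l j < W r)%R -> G (H (fun i => tau * b i)%R) r <= (B j)%:E &
      forall r, (ladder l m < W r)%R -> G (H (fun i => tau * b i)%R) r <= 0].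
Proof.
move=> tau0 b0 bq B.
have tb0 i : (0 <= tau * b i)%R by rewrite mulr_ge0.
have tbq i : (tau * b i.+1 <= q * (tau * b i))%R.
  by rewrite mulrCA; apply: ler_wpM2l.
have tailB j : (\sum_(i < m) tau * b i * (j <= i)%N%:R <= B j)%R.
  apply: le_trans (geometric_tail m q0 q1 tb0 tbq j) _.
  by rewrite /B mulrAC.
split.
- move=> r; apply: le_trans (tailnorm_comb_le r tb0) _; rewrite lee_fin.
  apply: le_trans (tailB 0%N); apply: ler_sum => i _; apply: ler_wpM2l => //.
  by rewrite ler_nat leq_b1.
- move=> j r jr; apply: le_trans (tailnorm_comb_tail tb0 jr) _.
  by rewrite lee_fin.
- move=> r mr; apply: le_trans (tailnorm_comb_tail tb0 mr) _.
  rewrite lee_fin big1// => i _.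
  by rewrite leqNgt ltn_ord mulr0.
Qed.

Lemma test_infty : theta = +oo ->
  (\sum_(i < m) (v i / ladder l i) `^ s <= 4 * C)%R.
Proof.
move=> thE; have s1 : s = 1%R by rewrite thE.
have qE : q = 2^-1%R by rewrite -qs s1 powRr1// ltW.
have KbE : Kb = 2%R by rewrite /Kb qE; field.
(* Here q = 1/2, and b decays by exactly this factor. The scaling 1/4 offsets the tail constant 2
   and the ratio l_{j+1}/l_j = 2. *)
pose b i := ((ladder l i)^-1)%R.
have b0 i : (0 <= b i)%R by rewrite invr_ge0 ltW// ladder_gt0.
have bq i : (b i.+1 <= q * b i)%R by rewrite /b ladderS invfM qE.
have t0 : (0 <= 4^-1 :> R)%R by rewrite invr_ge0.
have [H0 Hj Hm] := comb_bound t0 b0 bq.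
have XH : X (H (fun i => 4^-1 * b i)%R) <= 1.
  apply: (@Xn_step_infty _ _ p _ _ _ theta0 hom _ l m
    (fun j => 4^-1 * Kb * b j)%R l0 _ _ _ _ thE) => //.
  - by move=> j; rewrite KbE !mulr_ge0.
  - by move=> j r _ + _; exact: Hj.
  - rewrite KbE /b; have := ladder_gt0 0 l0; set L := ladder l 0 => L0.
    rewrite (_ : (L * (4^-1 * 2 * L^-1) = 2^-1)%R); first by lra.
    by field; rewrite gt_eqF.
  - move=> j _; rewrite KbE /b ladderS; have := ladder_gt0 j l0; set L := ladder l j => L0.
    rewrite (_ : (2 * L * (4^-1 * 2 * L^-1) = 1)%R)//.
    by field; rewrite gt_eqF.
have tb0 i : (0 <= 4^-1 * b i)%R by rewrite mulr_ge0.
have := le_trans (pairing_comb tb0) (hC (mH _) (fun r _ => le_lt_trans (H0 r) (ltry _)) XH).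
rewrite lee_fin; under eq_bigr do rewrite -mulrA.
rewrite -mulr_sumr s1 => hle.
rewrite -(@ler_pM2l _ 4^-1)%R ?invr_gt0// mulrA mulVf// mul1r.
apply: le_trans hle; apply: ler_wpM2l => //; apply: ler_sum => i _.
by rewrite powRr1 ?divr_ge0// ?(ltW (ladder_gt0 _ l0))// mulrC.
Qed.

(** Extremals for l^{theta'} duality, b_i = c_i^{s-1}/l_i, built from the regularization c of a_i =
    v_i/l_i. Pairing gives tau times the sum of c_i^{s-1} a_i, at least tau S since c majorizes
    a. *)
Lemma test_fin r : theta = r%:E ->
  (\sum_(i < m) (v i / ladder l i) `^ s <= (Kb * (2 * 2 `^ r) `^ r^-1) `^ s * C `^ s)%R.
Proof.
move=> thE; have r1 : (1 < r)%R by rewrite -lte_fin -thE.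
have r0 : (0 < r)%R by rewrite (lt_trans _ r1).
have s1 : (0 <= s - 1)%R by rewrite subr_ge0 conj_eexp_ge1.
have sr : ((s - 1) * r = s)%R.
  by rewrite thE /=; field; rewrite subr_eq0 gt_eqF.
have rs : (1 - r^-1 = s^-1)%R.
  have := conj_exp_inv r1; rewrite -/(conj_exp r).
  have -> : s = conj_exp r by rewrite thE.
  by move=> <-; rewrite addrAC subrr add0r.
pose a i := (v i / ladder l i)%R.
have a0 i : (0 <= a i)%R by rewrite divr_ge0// ltW// ladder_gt0.
set S := (\sum_(i < m) _)%R.
have S0 : (0 <= S)%R by apply: sumr_ge0 => i _; exact: powR_ge0.
have [Sz|Sz] := eqVneq S 0%R; first by rewrite Sz mulr_ge0 ?powR_ge0.
have Sp : (0 < S)%R by rewrite lt_neqAle eq_sym Sz.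
have [c [c0 ac cq cS]] := slow_majorant m q0 s0 qs a0.
pose b i := (c i `^ (s - 1) / ladder l i)%R.
have b0 i : (0 <= b i)%R by rewrite divr_ge0 ?powR_ge0// ltW// ladder_gt0.
have bq i : (b i.+1 <= q * b i)%R.
  rewrite /b ladderS invfM mulrCA mulrA [leRHS]mulrA.
  apply: ler_wpM2r; first by rewrite invr_ge0 ltW// ladder_gt0.
  have : ((q * c i.+1) `^ (s - 1) <= c i `^ (s - 1))%R.
    by apply: powR_le => //; rewrite mulr_ge0// ltW.
  rewrite powRM ?(ltW q0)// => hq.
  have := ler_wpM2l (ltW q0) hq; rewrite mulrA mulr_powRB1 ?(ltW q0)// qs.
  by rewrite mulrC.
(* The 2 is the loss in the regularization and 2^r comes from l_{j+1} = 2 l_j; dividing by [Kb] in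
   [tau] cancels the tail constant, so that the norm in X is at most 1. *)
pose M := (2 * 2 `^ r * S)%R.
have Mp : (0 < M)%R by rewrite !mulr_gt0// powR_gt0.
pose tau := (M `^ (- r^-1) / Kb)%R.
have tau0 : (0 < tau)%R by rewrite divr_gt0// powR_gt0.
have [H0 Hj Hm] := comb_bound (ltW tau0) b0 bq.
have tK : (tau * Kb = M `^ (- r^-1))%R by rewrite /tau mulfVK// gt_eqF.
have Bc j : (ladder l j `^ r * (tau * Kb * b j) `^ r = M^-1 * c j `^ s)%R.
  have L0 := ladder_gt0 j l0.
  rewrite -powRM ?(ltW L0)//; last by rewrite tK mulr_ge0 ?powR_ge0.
  have -> : (ladder l j * (tau * Kb * b j) = M `^ (- r^-1) * c j `^ (s - 1))%R.
    by rewrite tK /b mulrC -!mulrA mulVf ?gt_eqF// mulr1.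
  rewrite powRM ?powR_ge0// -!powRrM sr mulNr mulVf ?gt_eqF//.
  by rewrite powR_inv1// ltW.
have XH : X (H (fun i => tau * b i)%R) <= 1.
  apply: (@Xn_step_fin _ _ p _ _ _ p1 theta0 hom _ l m
    (fun j => tau * Kb * b j)%R (mH _) l0 _ _ _ _ r thE) => //.
  - by move=> j; rewrite mulr_ge0// tK powR_ge0.
  - by move=> j u _ + _; exact: Hj.
  have E j : (ladder l j.+1 `^ r * (tau * Kb * b j) `^ r = 2 `^ r * M^-1 * c j `^ s)%R.
    by rewrite ladderS powRM ?(ltW (ladder_gt0 _ l0))// -mulrA Bc mulrA.
  rewrite Bc; under eq_bigr do rewrite E.
  rewrite -mulr_sumr.
  have two1 : (1 <= 2 `^ r :> R)%R.
    have h12 : (1 <= 2 :> R)%R by rewrite ler1n.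
    by have := powR_le (ltW r0) ler01 h12; rewrite powR1.
  have E1 : (2 `^ r * M^-1 * (2 * S) = 1)%R.
    by rewrite /M; field; rewrite !gt_eqF ?powR_gt0.
  (* The cost of the region {W <= l_0} is absorbed by the extra term c_0^s of the regularization
     bound. *)
  rewrite -[leRHS]E1; apply: (@le_trans _ _ (2 `^ r * M^-1 * (\sum_(i < m) c i `^ s + c 0%N `^ s))%R); last first.
    by apply: ler_wpM2l => //; rewrite mulr_ge0 ?powR_ge0// invr_ge0 ltW.
  rewrite mulrDr addrC lerD2l; apply: ler_wpM2r; first exact: powR_ge0.
  by rewrite -[leLHS]mul1r; apply: ler_wpM2r => //; rewrite invr_ge0 ltW.
have tb0 i : (0 <= tau * b i)%R by rewrite mulr_ge0// ltW.
have := le_trans (pairing_comb tb0) (hC (mH _) (fun u _ => le_lt_trans (H0 u) (ltry _)) XH).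
rewrite lee_fin => hle.
have tS : (tau * S <= C)%R.
  apply: le_trans hle; rewrite mulr_sumr; apply: ler_sum => i _.
  rewrite -mulrA; apply: ler_wpM2l; first exact: ltW.
  rewrite /b mulrAC -mulrA -/(a i) -(mulr_powRB1 (a0 i) s0) mulrC.
  by apply: ler_wpM2r => //; apply: powR_le => //; exact: ac.
have SC : (S `^ s^-1 <= Kb * (2 * 2 `^ r) `^ r^-1 * C)%R.
  have -> : (S `^ s^-1 = Kb * (2 * 2 `^ r) `^ r^-1 * (tau * S))%R.
    set D := (2 * 2 `^ r)%R; have D0 : (0 < D)%R by rewrite mulr_gt0// powR_gt0.
    have ME : (M `^ (- r^-1) = (D `^ r^-1)^-1 * (S `^ r^-1)^-1)%R.
      by rewrite /M -/D powRM ?(ltW D0) ?(ltW Sp)// !powRN.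
    rewrite /tau ME -rs powRD; last by rewrite Sz implybT.
    by rewrite powRr1// powRN; field; rewrite !gt_eqF// powR_gt0.
  by apply: ler_wpM2l => //; rewrite mulr_ge0 ?powR_ge0// ltW.
have -> : S = ((S `^ s^-1) `^ s)%R by rewrite -powRrM mulVf ?gt_eqF// powRr1.
rewrite -powRM ?powR_ge0//; last by rewrite mulr_ge0 ?powR_ge0// ltW.
by apply: powR_le; rewrite ?powR_ge0// ltW.
Qed.

End TestFunction.

(** On each rung the integral is at most the s-th power of the largest ball norm times l_i^{-s}, by
    [nu_Wlevel_le]; test functions nearly attaining these norms are then superposed. *)
Lemma stieltjes_le_pairing : exists K : R, (0 < K)%R /\
  forall F (C : R), measurable_fun setT F -> (0 <= C)%R ->
    pairing_bound p theta omega lam F C ->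
    \int[nu]_(t in D0) (N F t `^ s) <= (K * C `^ s)%:E.
Proof.
have [K0 [K00 hK]] : exists K0 : R, (0 < K0)%R /\
    forall F (C l : R) (m : nat) (v : nat -> R) (h : nat -> RnB R n -> R),
    measurable_fun setT F -> (0 <= C)%R -> pairing_bound p theta omega lam F C ->
    (0 < l)%R -> (forall i, (0 <= v i)%R) -> (forall i, measurable_fun setT (h i)) ->
    (forall i x, (0 <= h i x)%R) ->
    (forall i, Lnorm_on lam p%:E setT (EFin \o h i) <= 1) ->
    (forall i r, (ladder l i.+1 < W r)%R -> G (h i) r <= 0) ->
    (forall i, (v i)%:E <= \int[lam]_x (`|F x * h i x|%R)%:E) ->
    (\sum_(i < m) (v i / ladder l i) `^ s <= K0 * C `^ s)%R.
  have [[r thE]|thE] : (exists r, theta = r%:E) \/ theta = +oo.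
    by case: theta theta1 => [r| |//] _; [left; exists r|right].
  - exists (((1 - 2 `^ (- s^-1))^-1 * (2 * 2 `^ r) `^ r^-1) `^ s)%R; split.
      have si : (0 < s^-1)%R by rewrite invr_gt0.
      apply: powR_gt0; apply: mulr_gt0; first by rewrite invr_gt0 one_sub_2powRN_gt0.
      by apply: powR_gt0; rewrite mulr_gt0// powR_gt0.
    by move=> F C l m v h mF C0 hC l0 v0 mh h0 h1 hh hv; exact: (test_fin m mF C0 hC l0 v0 mh h0 h1 hh hv thE).
  - exists 4%R; split => // F C l m v h mF C0 hC l0 v0 mh h0 h1 hh hv.
    have := test_infty m mF hC l0 v0 mh h0 h1 hh hv thE.
    by rewrite (_ : (C `^ s = C)%R)// thE /= powRr1.
exists (2 `^ s * K0)%R; split; first by rewrite mulr_gt0// powR_gt0.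
move=> F C mF C0 hC.
have bN := ballnorm_le_pairing leb p1 theta0 hom mF C0 hC.
have mD := @measurable_D0 R; have mW := measurable_W theta0 hom.
have mg : measurable_fun D0 (fun t => N F t `^ s).
  apply: (measurableT_comp (measurable_poweR s)).
  by apply: monotone_measurable; [exact: mD|left; exact: (ballnorm_nd lam p1 mF)].
apply: (@integral_le_ladder _ _ _ nu D0 set0 W) => //.
- by move=> *; exact: poweR_ge0.
- by move=> t; rewrite /= in_itv/= andbT => t0 _; exact: (W_gt0 hom).
move=> l m l0.
have ex i : exists vh : R * (RnB R n -> R),
    [/\ (0 <= vh.1)%R, measurable_fun setT vh.2, (forall x, 0 <= vh.2 x)%R &
        Lnorm_on lam p%:E setT (EFin \o vh.2) <= 1] /\
    [/\ (forall r, (ladder l i.+1 < W r)%R -> G vh.2 r <= 0),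
        vh.1%:E <= \int[lam]_x (`|F x * vh.2 x|%R)%:E &
        forall t, level D0 W (ladder l i) (ladder l i.+1) t -> N F t <= (2 * vh.1)%:E].
  have L0 := ladder_gt0 i l0; have L10 := ladder_gt0 i.+1 l0.
  (* Rungs without a positive ball norm, empty ones included, get the zero function. *)
  have [hneg|hpos] := pselect (forall t, level D0 W (ladder l i) (ladder l i.+1) t -> N F t <= 0).
    exists (0%R, fun=> 0%R); split; split => //=.
    - rewrite integral0_eq; first by rewrite poweR0r// invr_eq0 gt_eqF// (lt_le_trans _ p1).
      by move=> x _; rewrite normr0 powR0// gt_eqF// (lt_le_trans _ p1).
    - move=> r lr; apply: (@tailnorm_supp _ _ _ lam p1 _ 0%R) => //.
      by rewrite ltW//; apply: (W_gt0_pos theta0 (ltW L10) lr).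
    - by apply: integral_ge0 => x _; rewrite lee_fin.
    - by move=> t /hneg; rewrite mulr0.
  have [t0 lt0 Nt0] : exists2 t, level D0 W (ladder l i) (ladder l i.+1) t & 0 < N F t.
    apply: contrapT => hn; apply: hpos => t lt; rewrite leNgt; apply/negP => Nt.
    by apply: hn; exists t.
  have bound t : level D0 W (ladder l i) (ladder l i.+1) t ->
      0 <= N F t /\ N F t <= (C * ladder l i.+1)%:E.
    move=> [/= ]; rewrite !in_itv/= andbT => t0' /andP[_ Wt]; split.
      exact: ballnorm_gt0_ge0.
    by apply: le_trans (bN _ t0') _; rewrite lee_fin; apply: ler_wpM2l.
  have NE t : level D0 W (ladder l i) (ladder l i.+1) t -> (fine (N F t))%:E = N F t.
    move=> /bound[h1 h2]; rewrite fineK// ge0_fin_numE//.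
    exact: le_lt_trans h2 (ltry _).
  pose S := [set fine (N F t) | t in level D0 W (ladder l i) (ladder l i.+1)].
  have ubS : ubound S (C * ladder l i.+1)%R.
    by move=> _ [t lt <-]; rewrite -lee_fin NE//; exact: (bound t lt).2.
  have supS : has_sup S.
    by split; [exists (fine (N F t0)), t0|exists (C * ladder l i.+1)%R].
  pose M := sup S.
  have leM t : level D0 W (ladder l i) (ladder l i.+1) t -> N F t <= M%:E.
    move=> lt; rewrite -NE// lee_fin; apply: ub_le_sup; first by case: supS.
    by exists t.
  have M0 : (0 < M)%R by rewrite -lte_fin; exact: lt_le_trans Nt0 (leM _ lt0).
  have M2 : (0 < M / 2)%R by rewrite divr_gt0.
  (* A radius where the ball norm exceeds half its supremum over the rung; the supremum is finite by
     [ballnorm_le_pairing]. The factor 2 reappears as 2^s in the constant. *)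
  have [_ [t lt <-] Mt] := sup_adherent M2 supS.
  have Nt : (M / 2)%:E < N F t.
    by rewrite -NE// lte_fin; apply: le_lt_trans Mt; rewrite -/M; lra.
  have [h [mh h0 hs h1 hF]] := Lnorm_on_dual p1 (ltW M2) (@measurable_oball R n t)
    (lebesgue_oball_lty leb t) mF Nt.
  exists ((M / 2)%R, h); split; split => //=; first exact: ltW.
  - move=> r lr; apply: (@tailnorm_supp _ _ _ lam p1 _ t) => //.
    rewrite leNgt; apply/negP => /ltW /(W_nd theta0 hom) Wrt.
    have [_ /=] := lt; rewrite in_itv/= => /andP[_ Wt].
    by have := lt_le_trans lr (le_trans Wrt Wt); rewrite ltxx.
  - by move=> t' /leM; rewrite mulrC divfK.
have [vh hvh] := choice ex.
pose v i := (vh i).1; pose h i := (vh i).2.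
have v0 i : (0 <= v i)%R by have [[]] := hvh i.
have key := hK F C l m v h mF C0 hC l0 v0 (fun i => let: conj (And4 _ x _ _) _ := hvh i in x)
  (fun i => let: conj (And4 _ _ x _) _ := hvh i in x)
  (fun i => let: conj (And4 _ _ _ x) _ := hvh i in x)
  (fun i => let: conj _ (And3 x _ _) := hvh i in x)
  (fun i => let: conj _ (And3 _ x _) := hvh i in x).
apply: (@le_trans _ _ (\sum_(i < m) (2 `^ s * (v i / ladder l i) `^ s)%:E)); last first.
  rewrite sumEFin lee_fin -mulr_sumr -mulrA; apply: ler_wpM2l => //.
apply: lee_sum => i _; have L0 := ladder_gt0 i l0.
have mL : measurable (level D0 W (ladder l i) (ladder l i.+1)) by exact: measurable_level.
apply: (@le_trans _ _ (\int[nu]_(t in level D0 W (ladder l i) (ladder l i.+1))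
   cst (((2 * v i) `^ s)%:E) t)).
  apply: ge0_le_integral => //.
  - by move=> *; exact: poweR_ge0.
  - by apply: (measurable_funS mD _ mg) => t [].
  - move=> t lt /=; rewrite -poweR_EFin; apply: le_poweR; first exact: ltW.
      have [/= ] := lt; rewrite in_itv/= andbT => t0 _.
      exact: ballnorm_gt0_ge0.
    by have [_ [_ _]] := hvh i; apply.
rewrite integral_cst//.
apply: (@le_trans _ _ (((2 * v i) `^ s)%:E * (ladder l i `^ (- s))%:E)).
  apply: lee_wpmul2l; first by rewrite lee_fin powR_ge0.
  exact: (nu_Wlevel_le theta1 hom LS).
rewrite -EFinM lee_fin powRM// powRN powRM ?invr_ge0 ?(ltW L0)//.
by rewrite -mulrA -[((ladder l i)^-1)%R]powR_inv1 ?(ltW L0)// -powRrM mulN1r powRN.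
Qed.

End LowerStieltjes.

(** * Removal of the weight v *)

Section Reduction.
Context (R : realType) (n : nat) (p : R) (theta : \bar R) (omega : R -> R).
Variables (lam : {measure set (RnB R n) -> \bar R}) (v : RnB R n -> R).
Hypothesis n0 : (0 < n)%N.
Hypothesis leb : is_lebesgue_Rn lam.
Hypothesis p1 : (1 <= p)%R.
Hypothesis theta0 : 0 < theta.
Hypothesis hom : cOmega theta omega.
Hypothesis hv : weightW lam v.

Local Notation D0 := (`]0%R, +oo[%classic : set (measurableTypeR R)).
Local Notation W := (Wn theta omega).
Implicit Types (f g F H : RnB R n -> R).

Let p0 : (0 < p)%R. Proof. exact: lt_le_trans p1. Qed.

(* [v `^ p^-1], corrected on the null set where [v <= 0] so as to be invertible. *)
Definition wroot (x : RnB R n) : R := if (0 < v x)%R then (v x `^ p^-1)%R else 1%R.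

Lemma wroot_gt0 x : (0 < wroot x)%R.
Proof. by rewrite /wroot; case: ifPn => // v0; exact: powR_gt0. Qed.

Lemma measurable_wroot : measurable_fun setT wroot.
Proof.
have [mv _] := hv; apply: measurable_fun_ifT => //.
  exact: measurable_fun_ltr.
by apply: (measurableT_comp (measurable_powR _)).
Qed.

Lemma measurable_div_wroot f : measurable_fun setT f ->
  measurable_fun setT (fun x => f x / wroot x)%R.
Proof.
move=> mf; apply: measurable_funM => //.
rewrite (_ : (fun x => (wroot x)^-1%R) = (fun x => wroot x `^ (-1))%R); last first.
  by apply/funext => x; rewrite powR_inv1// ltW// wroot_gt0.
exact: (measurableT_comp (measurable_powR _) measurable_wroot).
Qed.

Lemma measurable_mul_wroot f : measurable_fun setT f ->
  measurable_fun setT (fun x => f x * wroot x)%R.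
Proof. by move=> mf; apply: measurable_funM => //; exact: measurable_wroot. Qed.

(** For p > 1 the point is the exponent identity 1 - p' = -p'/p; the correction in [wroot] only
    matters on a null set. *)
Lemma Nnorm_wroot A f : measurable A -> measurable_fun setT f ->
  Nnorm lam p v A f = Lnorm_on lam (conj_ext p) A (EFin \o (fun x => f x / wroot x)%R).
Proof.
move=> mA mf; have [mv v0] := hv; rewrite /Nnorm /conj_ext; case: ifPn => [p1'|].
  have q1 := conj_exp_gt1 p1'; have q0 : (0 < conj_exp p)%R by rewrite (lt_trans _ q1).
  rewrite /Lnorm_on; congr (_ `^ _); apply: ge0_ae_eq_integral => //.
  - apply/measurable_EFinP; apply: measurable_funTS; apply: measurable_funM.
      by apply: (measurableT_comp (measurable_powR _)); exact: measurableT_comp.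
    exact: (measurableT_comp (measurable_powR _)).
  - apply: measurable_normpow; apply: measurable_EFin => //; exact: measurable_div_wroot.
  - by move=> x _; rewrite lee_fin mulr_ge0 ?powR_ge0.
  - by move=> x _; exact: poweR_ge0.
  - apply: filterS v0 => x vx _ /=; rewrite normrM powRM// normfV.
    rewrite (gtr0_norm (wroot_gt0 x)) /wroot vx; congr ((_ * _)%R%:E).
    rewrite -powRN -powRrM; congr (_ `^ _)%R.
    have := conj_exp_inv p1' => E.
    have p0' : p != 0%R by rewrite gt_eqF.
    have p1n : (p - 1 != 0)%R by rewrite subr_eq0 gt_eqF.
    by rewrite /conj_exp; field; rewrite p0' p1n.
rewrite -leNgt => p1'; have pE : p = 1%R by apply/eqP; rewrite eq_le p1 p1'.
rewrite /Lnorm_on; congr ereal_inf; apply/seteqP; split => y /=; apply: filterS2 v0 => x vx.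
  by move=> h /h; rewrite /wroot vx pE invr1 powRr1 ?(ltW vx)// normrM normfV (gtr0_norm vx).
by move=> h /h; rewrite /wroot vx pE invr1 powRr1 ?(ltW vx)// normrM normfV (gtr0_norm vx).
Qed.

Lemma Nnorm_oball f t : measurable_fun setT f ->
  Nnorm lam p v (oball t) f = ballnorm p lam (fun x => f x / wroot x)%R t.
Proof. by move=> mf; apply: Nnorm_wroot => //; exact: measurable_oball. Qed.

Lemma cint_wroot g r : measurable_fun setT g ->
  cint lam p v g r `^ p^-1 = tailnorm p lam (fun x => g x * wroot x)%R r.
Proof.
move=> mg; have [mv v0] := hv; rewrite /cint /tailnorm /Lnorm_on; congr (_ `^ _).
have mB : measurable (~` @oball R n r) by apply: measurableC; exact: measurable_oball.
apply: ae_eq_integral => //.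
- apply/measurable_EFinP; apply: measurable_funTS; apply: measurable_funM => //.
  by apply: (measurableT_comp (measurable_powR _)); exact: measurableT_comp.
- apply: measurable_normpow; apply: measurable_EFin => //; exact: measurable_mul_wroot.
- apply: filterS v0 => x vx _ /=; rewrite normrM powRM//.
  rewrite (gtr0_norm (wroot_gt0 x)) /wroot vx -powRrM mulVf ?gt_eqF// powRr1//.
  exact: ltW.
Qed.

Lemma Xnorm_wroot g : measurable_fun setT g ->
  Xnorm lam p theta omega v g = Xn p theta omega lam (fun x => g x * wroot x)%R.
Proof.
move=> mg; rewrite /Xnorm /Xn; congr Lnorm_on; apply/funext => r.
by rewrite cint_wroot.
Qed.

Lemma pairing_wroot f g : \int[lam]_x (`|f x * g x|%R)%:E =
  \int[lam]_x (`|(f x / wroot x) * (g x * wroot x)|%R)%:E.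
Proof.
apply: eq_integral => x _; congr ((`|_|%R)%:E).
by have := wroot_gt0 x; set c := wroot x => c0; field; rewrite gt_eqF.
Qed.

Lemma Xassoc_ge f H : measurable_fun setT H ->
  (forall t, (0 < t)%R -> tailnorm p lam H t < +oo) -> Xn p theta omega lam H <= 1 ->
  \int[lam]_x (`|f x / wroot x * H x|%R)%:E <= Xassoc lam p theta omega v f.
Proof.
move=> mH fin XH; apply: ereal_sup_ubound.
pose g x := (H x / wroot x)%R; have mg : measurable_fun setT g by exact: measurable_div_wroot.
have gH : (fun x => g x * wroot x)%R = H.
  by apply/funext => x; rewrite /g divfK// gt_eqF// wroot_gt0.
have XE := Xnorm_wroot mg; rewrite gH in XE.
have X1 : Xnorm lam p theta omega v g <= 1 by rewrite XE.
exists g; last by rewrite pairing_wroot; apply: eq_integral => x _; rewrite -[in RHS]gH.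
split; last exact: X1.
split; first exact: mg.
split; last exact: le_lt_trans X1 (ltry 1%R).
move=> t t0; apply: (@lty_poweRy _ _ p^-1); first by rewrite invr_eq0 gt_eqF.
have cE := cint_wroot t mg; rewrite gH in cE.
by rewrite cE; exact: fin.
Qed.

Lemma Xassoc_le f c : measurable_fun setT f ->
  (forall H, measurable_fun setT H -> Xn p theta omega lam H <= 1 ->
    \int[lam]_x (`|f x / wroot x * H x|%R)%:E <= c) ->
  Xassoc lam p theta omega v f <= c.
Proof.
move=> mf h; apply: ge_ereal_sup => _ [g [[mg _] Xg] <-].
rewrite pairing_wroot; apply: h; first exact: measurable_mul_wroot.
by rewrite -Xnorm_wroot.
Qed.

Lemma Xassoc_ge0 f : 0 <= Xassoc lam p theta omega v f.
Proof.
pose H0 : RnB R n -> R := fun=> 0%R.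
have G0 r : tailnorm p lam H0 r = 0.
  rewrite /tailnorm /Lnorm_on integral0_eq; first by rewrite poweR0r// invr_eq0 gt_eqF.
  by move=> x _ /=; rewrite normr0 powR0// gt_eqF.
have := @Xassoc_ge f H0; rewrite (_ : \int[lam]_x _ = 0); last first.
  by apply: integral0_eq => x _; rewrite /H0 mulr0 normr0.
move=> h; apply: h; [exact: measurable_cst|by move=> t _; rewrite G0 ltry|].
rewrite /Xn (_ : (fun r => _) = cst 0); last by apply/funext => r; rewrite G0 mule0.
case: theta theta0 => [r| |//] r0 /=.
  rewrite integral0_eq; first by rewrite poweR0r// invr_eq0 gt_eqF.
  by move=> x _; rewrite normr0 powR0// gt_eqF.
apply: ereal_inf_lbound => /=; apply: nearW => x _.
by rewrite normr0.
Qed.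

Lemma Xassoc_pairing_bound f (C : R) : Xassoc lam p theta omega v f = C%:E ->
  (0 <= C)%R /\ pairing_bound p theta omega lam (fun x => f x / wroot x)%R C.
Proof.
move=> E; split; first by rewrite -lee_fin -E Xassoc_ge0.
by move=> H mH fin XH; rewrite -E; exact: Xassoc_ge.
Qed.

(** Each ball norm is at most C W(t) <= C w, and balls exhaust the space. *)
Lemma Nnorm_setT_le F (C : R) (w : R) : measurable_fun setT F -> (0 <= C)%R ->
  pairing_bound p theta omega lam F C -> wnorm_inf theta omega = w%:E ->
  Lnorm_on lam (conj_ext p) setT (EFin \o F) <= (C * w)%:E.
Proof.
move=> mF C0 hC wE; have Ww t : (0 < t)%R -> (W t <= w)%R.
  by move=> t0; rewrite -lee_fin -wE; exact: (W_le_inf theta0 hom).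
have w0 : (0 <= w)%R by rewrite (le_trans _ (Ww 1%R _))// ltW// (W_gt0 hom).
apply: (@Lnorm_on_le_bigcup _ _ _ lam (conj_ext p) setT setT set0 (fun m => @oball R n m.+1%:R)).
- exact: conj_ext_gt0.
- by rewrite lee_fin mulr_ge0.
- by [].
- by [].
- by [].
- exact: measure0.
- by move=> m; exact: measurable_oball.
- by move=> i j ij; apply/subsetPset; apply: oball_subset; rewrite ler_nat.
- by [].
- by [].
- move=> x _; left; exists (Num.bound (enorm x)) => //.
  rewrite /oball/= (lt_trans (archi_boundP (enorm_ge0 x)))//.
  by rewrite ltr_nat.
- exact: measurable_EFin.
- move=> m; apply: le_trans (ballnorm_le_pairing leb p1 theta0 hom mF C0 hC _) _ => //.
  by rewrite lee_fin; apply: ler_wpM2l => //; exact: Ww.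
Qed.

End Reduction.


(** * Assembly of the two equivalences *)

Unset Implicit Arguments.

Theorem theorem4p5 (R : realType) (n : nat) (p : R) (theta : \bar R)
    (omega : R -> R) (lam : {measure set (RnB R n) -> \bar R})
    (v : RnB R n -> R) :
  (0 < n)%N ->
  is_lebesgue_Rn lam ->
  (1 <= p)%R ->
  0 < theta ->
  cOmega theta omega ->
  weightW lam v ->
  (* (i) 0 < theta <= 1 *)
  (theta <= 1 ->
    exists c C : R, (0 < c)%R /\ (0 < C)%R /\
      forall f : RnB R n -> R, measurable_fun setT f ->
        let rhs := ereal_sup
          [set Nnorm lam p v (oball t) f * ((fine (wnorm theta omega t))^-1)%:E
           | t in `]0%R, +oo[%classic] in
        c%:E * rhs <= Xassoc lam p theta omega v f /\
        Xassoc lam p theta omega v f <= C%:E * rhs) /\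
  (* (ii) 1 < theta <= oo *)
  (1 < theta ->
    forall nu : {measure set (measurableTypeR R) -> \bar R},
      is_LS_of_minus_phi theta omega nu ->
      exists c C : R, (0 < c)%R /\ (0 < C)%R /\
        forall f : RnB R n -> R, measurable_fun setT f ->
          let rhs :=
            (\int[nu]_(t in `]0%R, +oo[%classic)
                (Nnorm lam p v (oball t) f) `^ (conj_eexp theta))
              `^ ((conj_eexp theta)^-1)
            + Nnorm lam p v setT f * einv (wnorm_inf theta omega) in
          c%:E * rhs <= Xassoc lam p theta omega v f /\
          Xassoc lam p theta omega v f <= C%:E * rhs).
Proof.
move=> n0 leb p1 theta0 hom hv; split.
- move=> th1; have [C [C0 hC]] := pairing_le_sup n0 leb p1 theta0 hom th1.
  exists 1%R, C; split => //; split => // f mf rhs.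
  pose F x := (f x / wroot p v x)%R.
  have mF : measurable_fun setT F by exact: (measurable_div_wroot p hv mf).
  have NE t : Nnorm lam p v (oball t) f = ballnorm p lam F t by exact: Nnorm_oball.
  have lerhs t : (0 < t)%R -> ballnorm p lam F t * ((Wn theta omega t)^-1)%:E <= rhs.
    move=> t0; apply: ereal_sup_ubound; exists t; first by rewrite /= in_itv/= t0.
    by rewrite NE WnE.
  have rhs0 : 0 <= rhs.
    apply: le_trans (lerhs 1%R ltr01); rewrite mule_ge0//.
      exact: (ballnorm_gt0_ge0 p n0 leb mF).
    by rewrite lee_fin invr_ge0 ltW// (W_gt0 hom).
  split.
    rewrite mul1e; have := Xassoc_ge0 omega p1 theta0 hv f.
    case E : (Xassoc lam p theta omega v f) => [A| |]//; last by move=> _; rewrite leey.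
    move=> _; have [A0 hA] := Xassoc_pairing_bound p1 theta0 hv E.
    apply: ge_ereal_sup => _ [t /= + <-]; rewrite in_itv/= andbT => t0.
    have W0 := W_gt0 hom t0.
    rewrite NE -WnE; have := ballnorm_le_pairing leb p1 theta0 hom mF A0 hA t0.
    have i0 : 0 <= ((Wn theta omega t)^-1)%:E by rewrite lee_fin invr_ge0 ltW.
    move=> /(lee_wpmul2r i0) /le_trans; apply.
    by rewrite -EFinM mulfK// gt_eqF.
  case: rhs rhs0 lerhs => [S| |]//; last first.
    by move=> _ _; rewrite gt0_muley ?leey.
  move=> S0 lerhs; rewrite -EFinM; apply: (Xassoc_le p1 hv mf) => H mH XH.
  apply: hC => //= t t0; have W0 := W_gt0 hom t0.
  have W0' : 0 <= (Wn theta omega t)%:E by rewrite lee_fin ltW.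
  have := lee_wpmul2r W0' (lerhs t t0).
  by rewrite -muleA -!EFinM mulVf ?gt_eqF// mule1.
move=> th1 nu LS; set s := conj_eexp theta; have s0 : (0 < s)%R by exact: conj_eexp_gt0.
have [C [C0 hC]] := pairing_le_stieltjes n0 leb p1 th1 hom LS.
have [K [K0 hK]] := stieltjes_le_pairing n0 leb p1 th1 hom LS.
have k0 : (0 < K `^ s^-1 + 1)%R by rewrite ltr_wpDl ?powR_ge0.
(* With A the associate norm, the Stieltjes term is at most K^{1/s} A and the term at infinity at
   most A. *)
exists (K `^ s^-1 + 1)^-1%R, C; split; first by rewrite invr_gt0.
split => // f mf rhs.
pose F x := (f x / wroot p v x)%R.
have mF : measurable_fun setT F by exact: (measurable_div_wroot p hv mf).
have NE t : Nnorm lam p v (oball t) f = ballnorm p lam F t by exact: Nnorm_oball.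
have NT : Nnorm lam p v setT f = Lnorm_on lam (conj_ext p) setT (EFin \o F).
  exact: Nnorm_wroot.
pose J := \int[nu]_(t in `]0%R, +oo[%classic) (ballnorm p lam F t `^ s).
have J0 : 0 <= J by apply: integral_ge0 => t _; exact: poweR_ge0.
pose M := Lnorm_on lam (conj_ext p) setT (EFin \o F) * einv (wnorm_inf theta omega).
have rhsE : rhs = J `^ s^-1 + M.
  by rewrite /rhs NT; congr (_ `^ _ + _); apply: eq_integral => t _; rewrite NE.
have Nle t : ballnorm p lam F t <= Lnorm_on lam (conj_ext p) setT (EFin \o F).
  apply: Lnorm_on_subset => //; [exact: measurable_oball|exact: measurable_EFin|].
  exact: ltW (conj_ext_gt0 p1).
have Winf0 : 0 < wnorm_inf theta omega.
  by apply: lt_le_trans (W_le_inf theta0 hom ltr01); rewrite lte_fin (W_gt0 hom).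
have M0 : 0 <= M.
  apply: mule_ge0.
    by apply: le_trans (Nle 1%R); exact: (ballnorm_gt0_ge0 p n0 leb mF).
  by case: (wnorm_inf theta omega) Winf0 => [w| |]//= w0; rewrite lee_fin invr_ge0 ltW.
rewrite rhsE; split.
  have := Xassoc_ge0 omega p1 theta0 hv f.
  case E : (Xassoc lam p theta omega v f) => [A| |]//; last by move=> _; rewrite leey.
  move=> _; have [A0 hA] := Xassoc_pairing_bound p1 theta0 hv E.
  have JA : J `^ s^-1 <= (K `^ s^-1 * A)%:E.
    have -> : (K `^ s^-1 * A)%:E = ((K * A `^ s)%:E) `^ s^-1.
      rewrite poweR_EFin powRM ?powR_ge0 ?(ltW K0)//.
      by rewrite -powRrM mulfV ?gt_eqF// powRr1.
    by apply: le_poweR => //; [rewrite invr_ge0 ltW|exact: hK].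
  have MA : M <= A%:E.
    (* If omega has infinite total norm, [einv] is 0 and the term disappears. *)
    rewrite /M; case wE : (wnorm_inf theta omega) Winf0 => [w| |]//= w0; last first.
      by rewrite mule0 lee_fin.
    have w0' : (0 < w)%R by [].
    have i0 : 0 <= (w^-1)%:E by rewrite lee_fin invr_ge0 ltW.
    have := Nnorm_setT_le leb p1 theta0 hom mF A0 hA wE.
    move=> /(lee_wpmul2r i0) /le_trans; apply.
    by rewrite -EFinM mulfK// gt_eqF.
  rewrite lee_pdivrMl//; apply: le_trans (leeD JA MA) _.
  by rewrite -EFinD -EFinM lee_fin mulrDl mul1r.
have rhs0 : 0 <= J `^ s^-1 + M by rewrite adde_ge0 ?poweR_ge0.
case E : (J `^ s^-1 + M) rhs0 => [rho| |]//; last first.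
  by move=> _; rewrite gt0_muley ?leey.
rewrite lee_fin => rho0; rewrite -EFinM; apply: (Xassoc_le p1 hv mf) => H mH XH.
apply: hC => //.
- rewrite -poweR_EFin -[leLHS](poweRe1 J0) -(mulVf (lt0r_neq0 s0)) poweRrM.
  apply: le_poweR; [exact: ltW|exact: poweR_ge0|].
  by rewrite -E leeDl.
- move=> w wE t t0; apply: le_trans (Nle t) _.
  have w0 : (0 < w)%R by rewrite -lte_fin -wE.
  have : M <= rho%:E by rewrite -E leeDr// poweR_ge0.
  rewrite /M wE /=; have w0' : 0 <= w%:E by rewrite lee_fin ltW.
  move=> /(lee_wpmul2r w0').
  by rewrite -muleA -!EFinM mulVf ?gt_eqF// mule1.
Qed.
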